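(* Let $n,k\geq 1$ be integers with $k<n-2$, let $C_n\subset\mathbb{P}^n$ be the rational normal curve of degree $n$, let $L\cong\mathbb{P}^{k-1}$ be a linear subspace of $\mathbb{P}^n$, and let $C=\pi_L(C_n)\subset\mathbb{P}^{n-k}$ be the projection of $C_n$ from $L$, assumed to have only ordinary singularities. Let $\rho=\rho^{n,k}_r$ be the natural number defined in the context and suppose $\rho^{n,k}_r\leq (n-k+1)/3$. Then the following conditions are equivalent: (i) $N_{\pi_L(C_n);\mathbb{P}^{n-k}}\cong\mathcal{O}_{\mathbb{P}^1}(n+2)^{\rho^{n,k}_r}\oplus\mathcal{F}$, where $\deg(\mathcal{F}^{\vee}(n+2))=-2k$ and $\mathcal{F}\cong\bigoplus_{i=1}^{n-1-\rho^{n,k}_r-k}\mathcal{O}_{\mathbb{P}^1}(l_i)$ with all $l_i\geq n+3$; (ii) the centre of projection $L$ is contained in the base locus of a linear system $\Phi$ generated by $\rho^{n,k}_r$ linearly independent $\mathbb{P}^{n-3}$'s which intersect $C_n$ in degree $n-2$. Moreover, if $L$ is general in the variety of those $\mathbb{P}^{k-1}\subset\mathbb{P}^n$ which are contained in the base locus of a linear system $\Phi$ generated by $\rho^{n,k}_r$ linearly independent $\mathbb{P}^{n-3}$'s which intersect $C_n$ in degree $n-2$, then $$N_{\pi_L(C_n);\mathbb{P}^{n-k}}\cong\mathcal{O}_{\mathbb{P}^1}(n+2)^{\rho^{n,k}_r}\oplus\mathcal{O}_{\mathbb{P}^1}(n+2+B)^{A-2k+B\cdot A}\oplus\mathcal{O}_{\mathbb{P}^1}(n+3+B)^{2k-B\cdot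 A},$$ where $A=n-1-\rho^{n,k}_r-k$ and $B=\lfloor 2k/A\rfloor$.
   Context: The ground field is $\mathbb{C}$. $V$ is a 2-dimensional vector space with basis $x_0,x_1$; $S_n=\mathrm{Sym}^nV$, $\mathbb{P}^n=\mathbb{P}(S_n)$; $T_e=\mathrm{Sym}^eV^{\vee}$ is the space of degree $e$ forms in $\partial_0,\partial_1$, acting on $S_n$ by differentiation. $C_n=\nu_n(\mathbb{P}^1)\subset\mathbb{P}^n$, where $\nu_n$ is the $n$-th Veronese map sending (the class of) a linear form $\ell$ to $\ell^n$. For a linear subspace $L\cong\mathbb{P}^{k-1}$ of $\mathbb{P}^n$, $\pi_L$ is the projection from $L$ onto $\mathbb{P}^{n-k}$, and $p=\pi_L\circ\nu_n:\mathbb{P}^1\to\mathbb{P}^{n-k}$, a morphism given by forms of degree $n$. The curve $\pi_L(C_n)$ has only ordinary singularities if $p^*\Omega_{\mathbb{P}^{n-k}}\to\Omega_{\mathbb{P}^1}$ is surjective. In that case $N_{\pi_L(C_n);\mathbb{P}^{n-k}}$ denotes the vector bundle on $\mathbb{P}^1$ (pull-back of the equisingular normal sheaf) which is the cokernel of $T\mathbb{P}^1\to p^*T\mathbb{P}^{n-k}$; it has rank $n-k-1$. $\mathcal{F}^{\vee}(n+2)$ means $\mathcal{F}^{\vee}\otimes\mathcal{O}_{\mathbb{P}^1}(n+2)$. The number $\rho^{n,k}_r\in\mathbb{N}$ is defined by $\rho^{n,k}_r=r$ if $3k\geq n-1$, for $1\leq r<n-k$; and $\rho^{n,k}_r=n-3k+r-1$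 if $3k<n-1$, for $r\leq 2k-1$. A nonzero form $\varphi\in T_{n-2}$, up to scalar, corresponds to an effective divisor of degree $n-2$ on $\mathbb{P}^1\cong C_n$ (its zeros with multiplicity), whose linear span in $\mathbb{P}^n$ is a $\mathbb{P}^{n-3}$, denoted $\pi_\varphi$, intersecting $C_n$ in degree $n-2$. A linear system $\Phi$ generated by $\rho$ linearly independent such $\mathbb{P}^{n-3}$'s is the family $\{\pi_{\lambda_0\varphi_0+\dots+\lambda_{\rho-1}\varphi_{\rho-1}}:[\lambda_0,\dots,\lambda_{\rho-1}]\in\mathbb{P}^{\rho-1}\}$ where $\varphi_0,\dots,\varphi_{\rho-1}\in T_{n-2}$ are linearly independent; its base locus is the intersection of all its members.
   Formalization: Condition (ii) is strengthened: besides L lying in the base locus of a system generated by ρ independent P^{n-3}'s, no such system with more than ρ generators has base locus containing L; without this, (ii) does not imply (i), e.g. n=10, k=3, r=1. *)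

(* Defs.v *)
From HB Require Import structures.
From mathcomp Require Import all_boot all_order all_algebra.
From mathcomp Require Import mpoly.

Set Implicit Arguments.
Unset Strict Implicit.
Unset Printing Implicit Defensive.

Import GRing.Theory.
Local Open Scope ring_scope.

Section RationalCurves.
Variable K : fieldType.

(* Binary forms of degree [d].  The same type serves for Sym^d V (forms in
   x_0, x_1), for T_d (forms in \partial_0, \partial_1) and for the forms of
   degree [d] in the coordinates [a] of the point [a_0 x_0 + a_1 x_1] of
   P^1 = P(V). *)
Definition binary_form (d : nat) := dhomog 2 K d.

Fact veronese_homog (n : nat) (a : 'I_2 -> K) :
  (\sum_(i < 2) a i *: 'X_i : {mpoly K[2]}) ^+ n \is n.-homog.
Proof.
rewrite -[X in X.-homog]mul1n; apply: dhomogMn; apply: rpred_sum => i _.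
by apply: rpredZ; rewrite dhomogX; apply/eqP; exact: mdeg1.
Qed.

Definition veronese (n : nat) (a : 'I_2 -> K) : binary_form n :=
  DHomog (veronese_homog n a).

Definition misses_rnc (n : nat) (L : {vspace binary_form n}) : Prop :=
  forall a : 'I_2 -> K, (exists i, a i != 0) -> veronese n a \notin L.

(* [v] lies on the linear span of the divisor of zeros of [phi] on
   C_n = P^1: every hyperplane [h] cutting on C_n a divisor that contains
   div(phi) passes through [v].  Identities between forms are checked at all
   points, which is enough over an infinite field. *)
Definition in_divisor_span (n e : nat) (phi : binary_form e) (v : binary_form n) : Prop :=
  forall h : 'Hom(binary_form n, K^o),
    (exists psi : binary_form (n - e), forall a : 'I_2 -> K,
        h (veronese n a) = phi.@[a] * psi.@[a]) ->
    h v = 0.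

Definition in_base_locus (n rho : nat) (phi : rho.-tuple (binary_form (n - 2)))
    (v : binary_form n) : Prop :=
  forall lambda : 'I_rho -> K, (exists i, lambda i != 0) ->
    in_divisor_span (\sum_(i < rho) lambda i *: tnth phi i) v.

Definition in_base_locus_of_some_system (n rho : nat) (L : {vspace binary_form n}) :
    Prop :=
  exists phi : rho.-tuple (binary_form (n - 2)),
    free phi /\ forall v : binary_form n, v \in L -> in_base_locus phi v.

(* [pi] is the projection from [L], in some coordinates of the target, and [p]
   is the tuple of forms of degree [n] that represents pi \o veronese. *)
Definition projection_from (n m : nat) (L : {vspace binary_form n})
    (pi : 'Hom(binary_form n, 'rV[K]_m)) (p : 'I_m -> binary_form n) : Prop :=
  lker pi = L /\
  forall (a : 'I_2 -> K) (j : 'I_m), (p j).@[a] = pi (veronese n a) 0 j.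

(* P^1 is covered by U_c = {a_c != 0}, c = 0, 1, with coordinate ring K[t],
   t = a_(1-c) / a_c; on U_c the sheaf O(d) is trivialised by a_c^d, so that a
   form restricts to the polynomial obtained from a_c = 1, a_(1-c) = t. *)
Definition on_chart (c : 'I_2) (f : {mpoly K[2]}) : {poly K} :=
  mmap (@polyC K) (fun i => if i == c then 1 else 'X) f.

Definition section_O (d : int) (f : {mpoly K[2]}) : Prop :=
  if d is Posz e then f \is e.-homog else f = 0.

Section Curve.
Variables (n m : nat) (p : 'I_m -> binary_form n).

Definition lift (c : 'I_2) : 'rV[{poly K}]_m := \row_j on_chart c (p j).
Definition velocity (c : 'I_2) : 'rV[{poly K}]_m := map_mx (@deriv K) (lift c).

(* The tangent space of P(W) at the line l is Hom(l, W / l), so p^*T P(W) is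
   the quotient of O(n) \otimes W by the line subbundle that p generates
   (Euler sequence).  Over U_c it is K[t]^m / K[t] (lift c), the class of [v]
   being the homomorphism lift c |-> v; the next predicate says that this class
   is zero. *)
Definition zero_in_pT (c : 'I_2) (v : 'rV[{poly K}]_m) : Prop :=
  exists g : {poly K}, v = g *: lift c.

(* T P^1 is free on d/dt over U_c, and dp (d/dt) is the class of
   [velocity c]. *)
Definition in_image_dp (c : 'I_2) (v : 'rV[{poly K}]_m) : Prop :=
  exists f : {poly K}, zero_in_pT c (v - f *: velocity c).

(* Surjectivity of p^*\Omega -> \Omega_(P^1).  Dually to the above, over U_c
   p^*\Omega is the module of the [beta] annihilating [lift c], and \Omega_(P^1)
   is free on dt. *)
Definition ordinary_singularities : Prop :=
  forall (c : 'I_2) (omega : {poly K}), exists beta : 'cV[{poly K}]_m,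
    lift c *m beta = 0 /\ velocity c *m beta = omega%:M.

(* Coker (dp : T P^1 -> p^*T P^(m-1)) is isomorphic to the direct sum of the
   O(a_i).  An isomorphism is induced by a morphism Q from O(n)^m to this sum,
   i.e. a matrix of sections of the O(a_i - n), which over each U_c is onto
   with kernel the preimage of the image of dp. *)
Definition normal_bundle_iso (a : seq int) : Prop :=
  exists Q : 'M[{mpoly K[2]}]_(m, size a),
    (forall (j : 'I_m) (i : 'I_(size a)), section_O (a`_i - n%:Z) (Q j i)) /\
    forall c : 'I_2,
      (forall w : 'rV[{poly K}]_(size a), exists v : 'rV[{poly K}]_m,
          v *m map_mx (on_chart c) Q = w) /\
      (forall v : 'rV[{poly K}]_m,
          v *m map_mx (on_chart c) Q = 0 <-> in_image_dp c v).

End Curve.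

(* Zariski topology on the Grassmannian of [k]-dimensional subspaces of [vT]:
   the quotient topology from the space of linearly independent [k]-tuples,
   a [k]-tuple being identified with its k x dim(vT) matrix of coordinates. *)
Section Grassmannian.
Variables (vT : vectType K) (k : nat).

Definition tuple_coords (b : k.-tuple vT) : 'I_(k * \dim {:vT}) -> K :=
  fun l => mxvec (\matrix_(i < k, j < \dim {:vT})
                    coord (vbasis {:vT}) j (tnth b i)) 0 l.

Definition zariski_closed (Z : {vspace vT} -> Prop) : Prop :=
  exists I : {mpoly K[k * \dim {:vT}]} -> Prop,
    forall b : k.-tuple vT, free b ->
      (Z <<b>>%VS <-> forall P, I P -> P.@[tuple_coords b] = 0).

(* [P] holds on a dense relatively open subset, the complement of [Z], of the
   set [X] of [k]-dimensional subspaces. *)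
Definition holds_for_general (X P : {vspace vT} -> Prop) : Prop :=
  exists Z : {vspace vT} -> Prop,
    [/\ zariski_closed Z,
        forall Z' : {vspace vT} -> Prop, zariski_closed Z' ->
          (forall L, \dim L = k -> X L -> ~ Z L -> Z' L) ->
          forall L, \dim L = k -> X L -> Z' L
      & forall L, \dim L = k -> X L -> ~ Z L -> P L].

End Grassmannian.

End RationalCurves.

(* The sequence [a] of integers stands for the bundle \bigoplus_i O(a_i). *)
Definition dual_bundle (a : seq int) : seq int := [seq - d | d <- a].
Definition twist_bundle (e : int) (a : seq int) : seq int :=
  [seq d + e | d <- a].
Definition degree_bundle (a : seq int) : int := \sum_(d <- a) d.

Definition rho_admissible (n k r : nat) : bool :=
  (if n - 1 <= 3 * k then 1 <= r < n - k else r <= 2 * k - 1)%N.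

Definition rho (n k r : nat) : nat :=
  (if n - 1 <= 3 * k then r else n - 3 * k + r - 1)%N.

(* Main.v *)
(* The normal bundle splits as the sum of the O(n + d_i), where the d_i are the degrees of a basis
   of the module of the q with sum_j q_j p_j = sum_j q_j p_j' = 0.  For such a q, sum_j q_j(t) p_j(y)
   is divisible by (y - t)^2; writing it as (y - t)^2 z(t, y), the z that occur are exactly those for
   which L annihilates (y - t)^2 z.
   Hence d_i >= 2, and the syzygies with d_i = 2 correspond to the forms phi(y) of degree n - 2 with
   phi, y phi, y^2 phi annihilated by L, that is to the members of the maximal linear system whose
   base locus contains L.

   For general L, the splitting type is forced by upper bounds on the dimensions of the spaces of
   z of two consecutive degrees in t, which are open conditions.  They are shown to hold on a dense
   subset by joining a given L to a special one: the ancestor structure of the linear system (it is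
   spanned by the products g_i y^c, c < f_i, with no relation among the g_i y^c, c < f_i + 2) makes
   it possible to deform the g_i to monomials, and for each (f_i) a monomial example satisfying the
   bounds is built from blocks of consecutive vanishing coefficients. *)

From HB Require Import structures.
Require Import Defs.
From mathcomp Require Import all_boot all_order all_algebra perm.
From mathcomp Require Import mpoly zify ring.
From mathcomp Require boolp.
Set Implicit Arguments.
Unset Strict Implicit.
Unset Printing Implicit Defensive.
Import Order.TTheory GRing.Theory Num.Theory.
Local Open Scope ring_scope.

(** * Polynomial matrices of constant rank and their kernels *)

Section PolyMatrices.
Variable K : closedFieldType.

Definition eval_mx m n (t : K) (A : 'M[{poly K}]_(m, n)) : 'M[K]_(m, n) :=
  map_mx (horner_eval t) A.

Lemma eval_mxM m n l t (A : 'M[{poly K}]_(m, n)) (B : 'M_(n, l)) :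
  eval_mx t (A *m B) = eval_mx t A *m eval_mx t B.
Proof. exact: map_mxM. Qed.

Lemma eval_mxC m n t (A : 'M[K]_(m, n)) : eval_mx t (map_mx polyC A) = A.
Proof. by apply/matrixP=> i j; rewrite !mxE /horner_eval hornerC. Qed.

Lemma eval_mx0 m n t : eval_mx t (0 : 'M[{poly K}]_(m, n)) = 0.
Proof. exact: map_mx0. Qed.

Lemma eval_mx_eq0P m n t (A : 'M[{poly K}]_(m, n)) :
  eval_mx t A = 0 -> exists A', A = ('X - t%:P) *: A'.
Proof.
move=> A0; exists (map_mx (fun p => p %/ ('X - t%:P)) A).
apply/matrixP=> i j; rewrite !mxE mulrC divpK //.
by rewrite dvdp_XsubCl; apply/rootP; move/matrixP/(_ i j): A0; rewrite !mxE.
Qed.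

Lemma poly_unitmx n (A : 'M[{poly K}]_n) :
  (forall t, eval_mx t A \in unitmx) -> A \in unitmx.
Proof.
move=> Au; rewrite unitmxE poly_unitE.
have nr t : ~~ root (\det A) t.
  by have:= Au t; rewrite unitmxE unitfE /eval_mx (det_map_mx (horner_eval t)).
have sz : size (\det A) == 1%N.
  by apply/negPn/negP=> /closed_rootP [t]; apply/negP.
by rewrite sz; have := nr 0; rewrite rootE horner_coef0 unitfE.
Qed.

Lemma row_base_of_rank (F : fieldType) m n r (A : 'M[F]_(m, n)) :
  \rank A = r -> exists2 B : 'M_(r, n), row_free B & (B :=: A)%MS.
Proof.
move=> rA; move: (row_base A) (row_base_free A) (eq_row_base A); rewrite rA.
by move=> B; exists B.
Qed.

Definition inj_cols (F : pzRingType) m n (A : 'M[F]_(m, n)) :=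
  forall x : 'cV_n, A *m x = 0 -> x = 0.

Lemma inj_cols_row_free (F : fieldType) m n (A : 'M[F]_(m, n)) :
  inj_cols A <-> row_free A^T.
Proof.
split=> [Ai | Af x Ax0].
  rewrite -kermx_eq0; apply/eqP/row_matrixP=> i; rewrite row0.
  apply: trmx_inj; rewrite trmx0; apply: Ai; apply: trmx_inj.
  by rewrite trmx_mul trmxK trmx0 -row_mul mulmx_ker row0.
apply: trmx_inj; rewrite trmx0; apply: (row_free_inj Af).
by rewrite mul0mx -trmx_mul Ax0 trmx0.
Qed.

Lemma inj_colsP (F : fieldType) m n (A : 'M[F]_(m, n)) :
  inj_cols A \/ exists2 x : 'cV_n, x != 0 & A *m x = 0.
Proof.
have [Af | /negP nAf] := boolP (row_free A^T).
  by left; apply/inj_cols_row_free.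
right; move/negP: nAf; rewrite -kermx_eq0 => /rowV0Pn[v /sub_kermxP vA v0].
exists v^T; first by rewrite -trmx0 (inj_eq (@trmx_inj _ _ _)).
by apply: trmx_inj; rewrite trmx_mul trmxK trmx0.
Qed.

Lemma inj_cols_linv (F : fieldType) m n (A : 'M[F]_(m, n)) :
  inj_cols A -> exists B, B *m A = 1%:M.
Proof.
move/inj_cols_row_free=> Af; exists (pinvmx A^T)^T.
by apply: trmx_inj; rewrite trmx_mul trmxK trmx1 mulmxVp.
Qed.

Lemma linv_inj_cols (F : pzRingType) m n (A : 'M[F]_(m, n)) B :
  B *m A = 1%:M -> inj_cols A.
Proof. by move=> BA x Ax; rewrite -[x]mul1mx -BA -mulmxA Ax mulmx0. Qed.

Section Chart.
Variables (N : nat) (Lam : 'M[{poly K}]_(2, 2 + N)) (Q : 'M[{poly K}]_(2 + N, N)).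
Hypothesis LQ : Lam *m Q = 0.
Hypothesis Lam_free : forall t, row_free (eval_mx t Lam).
Hypothesis Q_inj : forall t, inj_cols (eval_mx t Q).

Lemma left_kernel_eval t (M : nat) (V : 'M_(M, 2 + N)) :
  V *m eval_mx t Q = 0 -> exists Y, V = Y *m eval_mx t Lam.
Proof.
move=> V0; apply/submxP.
have le : (eval_mx t Lam <= kermx (eval_mx t Q))%MS.
  by apply/sub_kermxP; rewrite -eval_mxM LQ eval_mx0.
have rk : \rank (kermx (eval_mx t Q)) = 2.
  rewrite mxrank_ker -mxrank_tr.
  by have /inj_cols_row_free/eqP -> := Q_inj (t := t); rewrite addnK.
have /eqmxP e : (eval_mx t Lam == kermx (eval_mx t Q))%MS.
  by rewrite -(geq_leqif (mxrank_leqif_eq le)) rk (eqP (Lam_free t)).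
by rewrite e; apply/sub_kermxP.
Qed.

Lemma left_inverse : exists V, V *m Q = 1%:M.
Proof.
have descent s : forall (dl : {poly K}) V, (size dl <= s)%N -> dl != 0 ->
    V *m Q = dl%:M -> exists V', V' *m Q = 1%:M.
  elim: s => [|s IH] dl V; first by rewrite leqn0 size_poly_eq0 => ->.
  have [/size_poly1P [c c0 ->] _ _ VQ | /closed_rootP [t rt]] := boolP (size dl == 1%N).
    exists ((c^-1)%:P *: V).
    by rewrite -scalemxAl VQ scale_scalar_mx -polyCM mulVf.
  move=> sz dl0 VQ.
  have V0 : eval_mx t V *m eval_mx t Q = 0.
    rewrite -eval_mxM VQ /eval_mx map_scalar_mx /= /horner_eval.
    by rewrite (rootP rt) raddf0.
  have [Y Vt] := left_kernel_eval V0.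
  have /eval_mx_eq0P [V' EV'] : eval_mx t (V - map_mx polyC Y *m Lam) = 0.
    by rewrite /eval_mx raddfB /= -/(eval_mx _ _) -/(eval_mx _ _) eval_mxM eval_mxC Vt subrr.
  have /factor_theorem [e De] := rt.
  have Xt0 : 'X - t%:P != 0 :> {poly K} by rewrite polyXsubC_eq0.
  have e0 : e != 0 by apply: contraNneq dl0 => E; rewrite De E mul0r.
  apply: (IH e V') => //.
    by move: sz; rewrite De size_Mmonic ?monicXsubC // size_XsubC addn2 /=.
  have : ('X - t%:P) *: (V' *m Q) = ('X - t%:P) *: e%:M.
    by rewrite scalemxAl -EV' mulmxBl -mulmxA LQ mulmx0 subr0 VQ De scale_scalar_mx mulrC.
  by apply: scalemx_inj.
have [C CQ] := inj_cols_linv (Q_inj (t := 0)).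
pose A := map_mx polyC C *m Q.
have dA : (\det A).[0] = 1.
  have -> : (\det A).[0] = \det (eval_mx 0 A) by rewrite /eval_mx (det_map_mx (horner_eval 0)).
  by rewrite eval_mxM eval_mxC CQ det1.
apply: (descent _ (\det A) (\adj A *m map_mx polyC C) (leqnn _)).
  by apply: contra_eq_neq dA => ->; rewrite horner0 eq_sym oner_neq0.
by rewrite -mulmxA mul_adj_mx.
Qed.

Lemma frame_unitmx V : V *m Q = 1%:M -> col_mx Lam V \in unitmx.
Proof.
move=> VQ; apply: poly_unitmx => t; rewrite -row_free_unit -kermx_eq0.
apply/rowV0P=> v /sub_kermxP; rewrite -[v]hsubmxK.
set y1 := lsubmx v; set y2 := rsubmx v.
rewrite /eval_mx map_col_mx mul_row_col => E.
have y20 : y2 = 0.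
  move/(congr1 (mulmx^~ (eval_mx t Q))): E; rewrite mulmxDl -!mulmxA -!eval_mxM LQ VQ.
  by rewrite eval_mx0 mulmx0 add0r mul0mx /eval_mx map_mx1 mulmx1.
move: E; rewrite y20 mul0mx addr0 => E.
have -> : y1 = 0 by apply: (row_free_inj (Lam_free t)); rewrite mul0mx.
exact: row_mx0.
Qed.

Lemma row_surj (w : 'rV_N) : exists v, v *m Q = w.
Proof. by have [V VQ] := left_inverse; exists (w *m V); rewrite -mulmxA VQ mulmx1. Qed.

Lemma left_kernel (v : 'rV_(2 + N)) : v *m Q = 0 <-> exists y, v = y *m Lam.
Proof.
split=> [vQ|[y ->]]; last by rewrite -mulmxA LQ mulmx0.
have [V VQ] := left_inverse; have T := frame_unitmx VQ.
pose u := v *m invmx (col_mx Lam V).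
have Dv : v = lsubmx u *m Lam + rsubmx u *m V.
  by rewrite -mul_row_col hsubmxK mulmxKV.
exists (lsubmx u); have : v *m Q = 0 := vQ.
rewrite {1}Dv mulmxDl -!mulmxA LQ VQ mulmx0 add0r mulmx1 => E.
by rewrite Dv E mul0mx addr0.
Qed.

End Chart.

Section MinimalFrame.
Variables (N : nat) (Lam : 'M[{poly K}]_(2, 2 + N)).

Definition lead_mx m n (d : 'I_n -> nat) (Q : 'M[{poly K}]_(m, n)) : 'M[K]_(m, n) :=
  \matrix_(i, j) (Q i j)`_(d j).

Definition syzygy_frame (d : 'I_N -> nat) (Q : 'M[{poly K}]_(2 + N, N)) :=
  [/\ Lam *m Q = 0, forall i j, (size (Q i j) <= (d j).+1)%N
    & exists t, inj_cols (eval_mx t Q)].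

Lemma mulmx_col_sum (F : comPzRingType) m n (A : 'M[F]_(m, n)) (x : 'cV_n) :
  A *m x = \sum_j x j 0 *: col j A.
Proof.
apply/colP=> i; rewrite !mxE summxE; apply: eq_bigr => j _.
by rewrite !mxE mulrC.
Qed.

Lemma replace_column d Q t1 (i : 'I_N) (u : 'cV_(2 + N)) (y : 'cV[K]_N) :
    Lam *m Q = 0 -> (forall i j, (size (Q i j) <= (d j).+1)%N) ->
    inj_cols (eval_mx t1 Q) ->
    Lam *m u = 0 -> (forall e, (size (u e 0%R) <= d i)%N) ->
    eval_mx t1 u = eval_mx t1 Q *m y -> y i 0 != 0 ->
  exists d' Q', syzygy_frame d' Q' /\ (\sum_j d' j < \sum_j d j)%N.
Proof.
move=> LQ szQ Qi Lu szu ut1 yi0.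
have di_gt0 : (0 < d i)%N.
  rewrite lt0n; apply/negP=> /eqP d0.
  have u0 : u = 0.
    apply/colP=> e; rewrite mxE; apply/eqP.
    by rewrite -size_poly_eq0 -leqn0; have := szu e; rewrite d0.
  move: ut1; rewrite u0 eval_mx0 => /esym/Qi y0.
  by rewrite y0 mxE eqxx in yi0.
pose Q' := \matrix_(e, j) (if j == i then u e 0 else Q e j).
pose d' j := if j == i then (d i).-1 else d j.
exists d', Q'; split; last first.
  rewrite (bigD1 i) //= [X in (_ < X)%N](bigD1 i) //= /d' eqxx.
  rewrite (eq_bigr d) => [|j /negbTE -> //].
  by rewrite ltn_add2r prednK.
have colQ' j : col j (eval_mx t1 Q') = if j == i then eval_mx t1 u else col j (eval_mx t1 Q).
  by apply/colP=> e; rewrite !mxE; case: ifP => //; rewrite !mxE.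
split.
- apply/matrixP=> a j; have /colP/(_ a) := Lu.
  have /matrixP/(_ a j) := LQ; rewrite !mxE => LQaj Lua.
  case: (eqVneq j i) => [->|ji].
    by rewrite -[RHS]Lua; apply: eq_bigr => e _; rewrite ?mxE eqxx.
  by rewrite -[RHS]LQaj; apply: eq_bigr => e _; rewrite ?mxE (negbTE ji).
- by move=> e j; rewrite mxE /d'; case: ifP => // _; rewrite prednK.
- exists t1 => x; rewrite mulmx_col_sum => Ex.
  pose x' : 'cV[K]_N := \col_j ((if j == i then 0 else x j 0) + x i 0 * y j 0).
  have x'0 : x' = 0.
    apply: Qi; rewrite -{}Ex mulmx_col_sum [RHS](bigD1 i) //= colQ' eqxx.
    rewrite ut1 mulmx_col_sum scaler_sumr (bigD1 i) //= [in RHS](bigD1 i) //=.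
    rewrite !mxE eqxx add0r scalerA -addrA; congr (_ + _).
    rewrite -big_split; apply: eq_bigr => j ji /=.
    by rewrite colQ' (negbTE ji) mxE (negbTE ji) scalerDl scalerA addrC.
  have xi : x i 0 = 0.
    move/colP/(_ i): x'0; rewrite !mxE eqxx add0r => /eqP.
    by rewrite mulf_eq0 (negbTE yi0) orbF => /eqP.
  apply/colP=> j; move/colP/(_ j): x'0; rewrite !mxE xi mul0r addr0.
  by case: (eqVneq j i) => [->|].
Qed.

Lemma exists_frame : row_free (eval_mx 0 Lam) -> exists d Q, syzygy_frame d Q.
Proof.
move=> Lf; pose L0 := eval_mx 0 Lam.
have [C LC] : exists C, L0 *m C = 1%:M by apply/row_freeP.
pose W := Lam *m map_mx polyC C; pose D := \det W.
have D0 : D.[0] = 1.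
  rewrite -[LHS]/(horner_eval 0 (\det W)) -(det_map_mx (horner_eval 0)) -/(eval_mx 0 W).
  by rewrite eval_mxM eval_mxC LC det1.
have rkL : \rank (kermx L0^T) = N.
  by rewrite mxrank_ker mxrank_tr (eqP Lf) addKn.
have [C' C'f C'ker] := row_base_of_rank rkL.
have LC' : L0 *m C'^T = 0.
  apply: trmx_inj; rewrite trmx_mul trmxK trmx0; apply/sub_kermxP.
  by rewrite C'ker.
pose Q := (D%:M - map_mx polyC C *m \adj W *m Lam) *m map_mx polyC C'^T.
exists (fun j => \max_i size (Q i j))%N, Q; split.
- rewrite mulmxA mulmxBr mul_mx_scalar !mulmxA -[Lam *m _]/W mul_mx_adj.
  by rewrite mul_scalar_mx subrr mul0mx.
- by move=> i j; apply: leqW; apply: (leq_bigmax_cond (F := fun i => size (Q i j))).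
- exists 0; have -> : eval_mx 0 Q = C'^T.
    rewrite eval_mxM eval_mxC {1}/eval_mx raddfB /= -![map_mx (horner_eval 0) _]/(eval_mx 0 _).
    rewrite eval_mxM mulmxBl -[_ *m eval_mx 0 Lam *m _]mulmxA LC' mulmx0 subr0.
    by rewrite /eval_mx map_scalar_mx /= /horner_eval D0 mul1mx.
  by apply/inj_cols_row_free; rewrite trmxK.
Qed.

Lemma minimal_frame : (forall t, row_free (eval_mx t Lam)) ->
  exists (d : 'I_N -> nat) (Q : 'M_(2 + N, N)), [/\ Lam *m Q = 0, forall i j, (size (Q i j) <= (d j).+1)%N,
    forall t, inj_cols (eval_mx t Q) & inj_cols (lead_mx d Q)].
Proof.
move=> Lf; have [d [Q fQ]] := exists_frame (Lf 0).
have [n] := ubnP (\sum_j d j); elim: n => // n IH in d Q fQ *.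
rewrite ltnS => sd; have [LQ szQ [t1 Qt1]] := fQ.
have pick_max (x : 'cV[K]_N) : x != 0 ->
    exists2 i, x i 0 != 0 & forall j, x j 0 != 0 -> (d j <= d i)%N.
  case/cV0Pn=> i0 xi0.
  by case: (@arg_maxnP _ i0 (fun j => x j 0 != 0) d xi0) => i xi dm; exists i.
have reduce d' Q' : syzygy_frame d' Q' /\ (\sum_j d' j < \sum_j d j)%N ->
    exists (d : 'I_N -> nat) (Q : 'M_(2 + N, N)), [/\ Lam *m Q = 0, forall i j, (size (Q i j) <= (d j).+1)%N,
    forall t, inj_cols (eval_mx t Q) & inj_cols (lead_mx d Q)].
  by case=> fQ' lt; apply: (IH d' Q') => //; apply: leq_trans lt sd.
case: (inj_colsP (lead_mx d Q)) => [Qlead | [x x0 Qx]]; last first.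
  have [i xi dm] := pick_max x x0.
  pose w : 'cV[{poly K}]_N := \col_j (x j 0 *: 'X^(d i - d j)).
  pose y : 'cV[K]_N := \col_j (x j 0 * t1 ^+ (d i - d j)).
  have [||||d' [Q' H]] := @replace_column d Q t1 i (Q *m w) y LQ szQ Qt1.
  - by rewrite mulmxA LQ mul0mx.
  - move=> e; apply/leq_sizeP => a; rewrite mxE coef_sum leq_eqVlt => /orP [/eqP <-|lt].
      move/colP/(_ e): Qx; rewrite !mxE => E; rewrite -[RHS]E; apply: eq_bigr => j _.
      rewrite !mxE -scalerAr coefZ coefMXn mulrC.
      have [-> | xj] := eqVneq (x j 0) 0; first by rewrite !mulr0.
      by rewrite ltnNge leq_subr subKn ?dm.
    apply: big1 => j _; rewrite !mxE -scalerAr coefZ coefMXn.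
    have [-> | xj] := eqVneq (x j 0) 0; first by rewrite mul0r.
    case: ifP => [_|_]; first by rewrite mulr0.
    rewrite nth_default ?mulr0 //; apply: leq_trans (szQ e j) _.
    by rewrite ltn_subRL subnK ?dm.
  - rewrite eval_mxM; congr (_ *m _); apply/colP=> j.
    by rewrite !mxE /horner_eval hornerZ hornerXn.
  - by rewrite mxE subnn expr0 mulr1.
  exact: reduce H.
have [Qt | /boolp.existsNP [t0 nQt0]] := boolp.EM (forall t, inj_cols (eval_mx t Q)).
  by exists d, Q.
have [//|[x x0 Qx]] := inj_colsP (eval_mx t0 Q).
have [i xi dm] := pick_max x x0.
pose w : 'cV[{poly K}]_(2 + N) := Q *m map_mx polyC x.
have /eval_mx_eq0P [u wu] : eval_mx t0 w = 0 by rewrite eval_mxM eval_mxC.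
have t10 : t1 - t0 != 0.
  by rewrite subr_eq0; apply/eqP=> E; apply: nQt0; rewrite -E.
have Xt0 : 'X - t0%:P != 0 :> {poly K} by rewrite polyXsubC_eq0.
have [||||d' [Q' H]] := @replace_column d Q t1 i u ((t1 - t0)^-1 *: x) LQ szQ Qt1.
- apply: (scalemx_inj Xt0); rewrite scaler0 scalemxAr -wu mulmxA LQ mul0mx //.
- move=> e; have szw : (size (w e 0%R) <= (d i).+1)%N.
    rewrite mxE; apply: leq_trans (size_sum _ _ _) _; apply/bigmax_leqP=> j _.
    rewrite mxE mulrC; have [-> | xj] := eqVneq (x j 0) 0; first by rewrite mul0r size_poly0.
    by rewrite mul_polyC; apply: leq_trans (size_scale_leq _ _) _; apply: leq_trans (szQ e j) _; rewrite ltnS dm.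
  move/colP/(_ e): wu szw => ->; rewrite mxE.
  have [-> | ue] := eqVneq (u e 0) 0; first by rewrite size_poly0.
  by rewrite mulrC size_Mmonic ?monicXsubC // size_XsubC addn2.
- have : eval_mx t1 w = (t1 - t0) *: eval_mx t1 u.
    by rewrite wu; apply/colP=> e; rewrite !mxE /horner_eval hornerM hornerXsubC.
  rewrite eval_mxM eval_mxC => E.
  by rewrite -scalemxAr E scalerA mulVf ?scale1r.
- by rewrite mxE mulf_neq0 ?invr_eq0.
exact: reduce H.
Qed.
End MinimalFrame.

Section Degrees.

Lemma coefM_top (R : nzSemiRingType) (p q : {poly R}) a b :
  (size p <= a.+1)%N -> (size q <= b.+1)%N -> (p * q)`_(a + b) = p`_a * q`_b.
Proof.
move=> sp sq; have la : (a < (a + b).+1)%N by rewrite ltnS leq_addr.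
rewrite coefM (bigD1 (Ordinal la)) //= addKn big1 ?addr0 // => -[i /= li] /eqP ia.
have [lt|lt|E] := ltngtP i a; last by case: ia; apply: val_inj.
  rewrite [q`__]nth_default ?mulr0 //; apply: leq_trans sq _.
  by rewrite ltn_subRL ltn_add2r.
by rewrite nth_default ?mul0r //; apply: leq_trans sp _.
Qed.

Lemma size_prod_bound (R : comNzSemiRingType) n (F : 'I_n -> {poly R}) (d : 'I_n -> nat) :
  (forall i, (size (F i) <= (d i).+1)%N) ->
  (size (\prod_i F i)%R <= (\sum_i d i).+1)%N /\
  (\prod_i F i)`_(\sum_i d i)%N = \prod_i (F i)`_(d i).
Proof.
elim: n => [|n IH] in F d * => szF.
  by rewrite !big_ord0 size_poly1 coef1.
rewrite !big_ord_recl; have [s1 c1] := IH _ _ (fun i => szF (lift ord0 i)).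
split; last by rewrite coefM_top // c1.
apply: leq_trans (size_polyMleq _ _) _.
by have := leq_add (szF ord0) s1; rewrite addnS addSn -ltnS; case: (_ + _)%N.
Qed.

Lemma det_lead n (A : 'M[{poly K}]_n) d :
  (forall i j, (size (A i j) <= (d j).+1)%N) ->
  (size (\det A)%R <= (\sum_j d j).+1)%N /\
  (\det A)`_(\sum_j d j)%N = \det (lead_mx d A).
Proof.
move=> szA; rewrite -det_tr -[in RHS]det_tr /determinant.
have szAt (s : 'S_n) i : (size (A^T i (s i)) <= (d i).+1)%N by rewrite mxE.
have H (s : 'S_n) := size_prod_bound (szAt s).
have sgE (s : 'S_n) p : (-1) ^+ s * p = ((-1) ^+ s)%:P * p :> {poly K}.
  by rewrite rmorphXn rmorphN1.
split.
  apply: leq_trans (size_sum _ _ _) _; apply/bigmax_leqP=> s _.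
  by rewrite sgE mul_polyC (leq_trans (size_scale_leq _ _)) //; case: (H s).
rewrite coef_sum; apply: eq_bigr => s _.
rewrite sgE coefCM; have [_ ->] := H s; congr (_ * _).
by apply: eq_bigr => i _; rewrite !mxE.
Qed.

Lemma predictable_degree m N (d : 'I_N -> nat) (Q : 'M[{poly K}]_(m, N)) (w : 'cV_N) D :
    (forall i j, (size (Q i j) <= (d j).+1)%N) -> inj_cols (lead_mx d Q) ->
    (forall e, (size ((Q *m w) e 0%R) <= D)%N) ->
  forall j, w j 0 != 0 -> (d j + size (w j 0%R) <= D)%N.
Proof.
move=> szQ Qlead szw j0 wj0.
have [j wj dm] := @arg_maxnP _ j0 (fun j => w j 0 != 0) (fun j => d j + size (w j 0%R))%N wj0.
apply: leq_trans (dm _ wj0) _; rewrite leqNgt; apply/negP=> lt.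
have szj : (0 < size (w j 0%R))%N by rewrite size_poly_gt0.
set M := (d j + (size (w j 0%R)).-1)%N.
have DM : (d j + size (w j 0%R))%N = M.+1 by rewrite /M -addnS prednK.
pose x : 'cV[K]_N := \col_i (if w i 0 == 0 then 0 else (w i 0)`_(M - d i)).
suff x0 : x = 0.
  move/colP/(_ j): x0; rewrite !mxE (negbTE wj) /M addKn => /eqP.
  by rewrite lead_coef_eq0 (negbTE wj).
apply: Qlead; apply/colP=> e; rewrite !mxE.
have : ((Q *m w) e 0)`_M = 0.
  by rewrite nth_default //; apply: leq_trans (szw e) _; rewrite -ltnS -DM.
rewrite mxE coef_sum => E; rewrite -[RHS]E; apply: eq_bigr => i _; rewrite !mxE.
have [-> | wi] := eqVneq; first by rewrite !mulr0 coef0.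
have le : (d i + size (w i 0%R) <= M.+1)%N by rewrite -DM; apply: dm.
have szi : (0 < size (w i 0%R))%N by rewrite size_poly_gt0.
have dM : (d i <= M)%N.
  by rewrite -ltnS; apply: leq_trans le; rewrite -[X in (X < _)%N]addn0 ltn_add2l.
rewrite -{2}(subnKC dM) coefM_top //.
by rewrite -(leq_add2l (d i)) addnS subnKC.
Qed.

Lemma sum_column_degrees (n N : nat) (p : 'rV[{poly K}]_(2 + N)) (Q : 'M_(2 + N, N))
    (d : 'I_N -> nat) (Lam := col_mx p (map_mx (@deriv K) p) : 'M_(1 + 1, 2 + N)) :
    (forall j, (size (p ord0 j) <= n.+3)%N) ->
    Lam *m Q = 0 -> (forall t, row_free (eval_mx t Lam)) ->
    (forall t, inj_cols (eval_mx t Q)) ->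
    (forall i j, (size (Q i j) <= (d j).+1)%N) -> inj_cols (lead_mx d Q) ->
    let Linf : 'M_(1 + 1, 2 + N) := col_mx (\row_j (p 0 j)`_n.+2) (\row_j (p 0 j)`_n.+1) in
    row_free Linf -> Linf *m lead_mx d Q = 0 ->
  (\sum_j d j = n.+1.*2)%N.
Proof.
move=> szp LQ Lf Qi szQ Ql Linf Linff Linf0.
have [V VQ] := left_inverse LQ Lf Qi.
have Tu := frame_unitmx LQ Lf VQ.
have [C LC] := row_freeP Linff.
pose M : 'M[{poly K}]_(2 + N) := row_mx (map_mx polyC C) Q.
pose dM (j : 'I_(2 + N)) := if split j is inr i then d i else 0%N.
have szM i j : (size (M i j) <= (dM j).+1)%N.
  rewrite /M /dM -[in M _ _](splitK j); case: (split j) => l /=.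
    by rewrite row_mxEl mxE size_polyC leq_b1.
  by rewrite row_mxEr.
have sumdM : (\sum_j dM j = \sum_j d j)%N.
  rewrite big_split_ord /= big1 ?add0n => [|i _]; last by rewrite /dM (unsplitK (inl i)).
  by apply: eq_bigr => i _; rewrite /dM (unsplitK (inr i)).
have [szdet topdet] := det_lead szM; rewrite {}sumdM in szdet topdet.
have leadM : lead_mx dM M = row_mx C (lead_mx d Q).
  apply/matrixP=> i j; rewrite mxE /M /dM -[in LHS](splitK j) -[in RHS](splitK j).
  rewrite unsplitK; case: (split j) => l /=.
    by rewrite !row_mxEl mxE coefC.
  by rewrite !row_mxEr mxE.
have leadu : row_mx C (lead_mx d Q) \in unitmx.
  have : inj_cols (row_mx C (lead_mx d Q)).
    move=> x; rewrite -[x]vsubmxK mul_row_col => E.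
    have x1 : usubmx x = 0.
      by move/(congr1 (mulmx Linf)): E; rewrite mulmxDr !mulmxA LC Linf0 mul1mx mul0mx addr0 mulmx0.
    move: E; rewrite x1 mulmx0 add0r => /Ql ->.
    by rewrite col_mx0.
  by move/inj_cols_row_free; rewrite row_free_unit unitmx_tr.
have szdetE : size (\det M) = (\sum_j d j).+1.
  apply/eqP; rewrite eqn_leq szdet ltnNge; apply/negP=> le.
  by move: topdet; rewrite nth_default // leadM => /esym/eqP; apply/negP; rewrite -unitfE -unitmxE.
have detT : \det (col_mx Lam V) * \det M = \det (Lam *m map_mx polyC C).
  rewrite -det_mulmx mul_col_row LQ VQ det_lblock det1 mulr1 //.
have : size (\det (Lam *m map_mx polyC C)) = n.+1.*2.+1.
  set pC := p *m map_mx polyC C.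
  have pCE j : pC 0 j = \sum_e C e j *: p 0 e.
    by rewrite mxE; apply: eq_bigr => e _; rewrite mxE mulrC mul_polyC.
  have szpC j : (size (pC ord0 j) <= n.+3)%N.
    rewrite pCE (leq_trans (size_sum _ _ _)) //; apply/bigmax_leqP=> e _.
    exact: leq_trans (size_scale_leq _ _) (szp e).
  have dpC : map_mx (@deriv K) p *m map_mx polyC C = map_mx (@deriv K) pC.
    apply/matrixP=> i j; rewrite ord1 [RHS]mxE pCE linear_sum mxE.
    by apply: eq_bigr => e _; rewrite !mxE mulrC mul_polyC linearZ.
  have LCE (i : 'I_(1 + 1)) (j : 'I_2) :
      (if split i is inl _ then (pC 0 j)`_n.+2 else (pC 0 j)`_n.+1) = (i == j)%:R.
    transitivity ((1%:M : 'M[K]_(1 + 1)) i j); last by rewrite mxE.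
    rewrite -LC -[in RHS](splitK i) mul_col_mx; case: (split i) => l /=.
      by rewrite col_mxEu [RHS]mxE pCE coef_sum; apply: eq_bigr => e _; rewrite mxE coefZ mulrC.
    by rewrite col_mxEd [RHS]mxE pCE coef_sum; apply: eq_bigr => e _; rewrite mxE coefZ mulrC.
  have ln i : split (lshift 1 i : 'I_(1 + 1)) = inl i := unsplitK (inl i).
  have rn i : split (rshift 1 i : 'I_(1 + 1)) = inr i := unsplitK (inr i).
  set f := pC 0 0; set g := pC 0 1.
  have fn : f`_n.+2 = 1 by have := LCE (lshift 1 0) 0; rewrite ln => ->.
  have gn : g`_n.+2 = 0 by have := LCE (lshift 1 0) 1; rewrite ln => ->.
  have gn1 : g`_n.+1 = 1 by have := LCE (rshift 1 0) 1; rewrite rn => ->.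
  have szg : (size g <= n.+2)%N.
    apply/leq_sizeP=> a; rewrite leq_eqVlt => /orP [/eqP <- // | lt].
    by rewrite nth_default // (leq_trans (szpC _)).
  have szf : (size f <= n.+3)%N by exact: szpC.
  have szdf : (size f^`() <= n.+2)%N.
    by apply/leq_sizeP=> a le; rewrite coef_deriv nth_default ?mul0rn // (leq_trans szf).
  have szdg : (size g^`() <= n.+1)%N.
    by apply/leq_sizeP=> a le; rewrite coef_deriv nth_default ?mul0rn // (leq_trans szg).
  have -> : \det (Lam *m map_mx polyC C) = f * g^`() - g * f^`().
    rewrite mul_col_mx dpC (expand_det_row _ 0) !big_ord_recl big_ord0 addr0.
    rewrite /cofactor !det_mx11 !mxE /= expr0 expr1.
    have -> : split (0 : 'I_(1 + 1)) = inl 0 by rewrite -ln; congr split; apply: val_inj.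
    have -> : split (lift 0 0 : 'I_(1 + 1)) = inr 0 by rewrite -rn; congr split; apply: val_inj.
    have dE j : map_mx (@deriv K) pC 0 j = (pC 0 j)^`() by rewrite mxE.
    rewrite -/pC !dE.
    have -> : lift ord0 0 = 1 :> 'I_2 by apply: val_inj.
    have -> : lift 1 0 = 0 :> 'I_2 by apply: val_inj.
    by rewrite mul1r mulN1r mulrN.
  apply/eqP; rewrite eqn_leq; apply/andP; split.
    apply: leq_trans (size_polyD _ _) _; rewrite size_polyN geq_max.
    apply/andP; split; apply: leq_trans (size_polyMleq _ _) _.
      by move: (leq_add szf szdg); rewrite addSn addnS -addnn; case: (_ + _)%N => //=; lia.
    by move: (leq_add szg szdf); rewrite addSn addnS -addnn; case: (_ + _)%N => //=; lia.
  rewrite ltnNge; apply/negP => /leq_sizeP /(_ n.+1.*2 (leqnn _)).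
  rewrite coefB.
  have -> : (n.+1.*2 = n.+2 + n)%N by lia.
  rewrite coefM_top //; have -> : (n.+2 + n = n.+1 + n.+1)%N by lia.
  rewrite coefM_top // !coef_deriv fn gn1 !mul1r.
  move/eqP; rewrite [X in _ - X]mulrSr opprD addrA subrr sub0r oppr_eq0 oner_eq0 //.
move=> szL; have := etrans (congr1 (fun q : {poly K} => size q) detT) szL; move: szL => _ /=.
have : \det (col_mx Lam V) \is a GRing.unit by rewrite -unitmxE.
rewrite poly_unitE => /andP [/size_poly1P [c c0 ->] _].
by rewrite mul_polyC size_scale // szdetE => -[].
Qed.

End Degrees.
End PolyMatrices.

(** * Binary forms and the apolarity pairing *)

Section Forms.
Variable K : numClosedFieldType.
Implicit Types (f g : {mpoly K[2]}) (q : {poly K}) (e : nat) (c : 'I_2).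

Definition chart_var c : 'I_2 -> {poly K} := fun i => if i == c then 1 else 'X.

Lemma on_chartE c f : on_chart c f = mmap (@polyC K) (chart_var c) f.
Proof. by []. Qed.

Lemma on_chart_is_zmod_morphism c : zmod_morphism (@on_chart K c).
Proof. by move=> f g; rewrite !on_chartE raddfB. Qed.
Lemma on_chart_is_monoid_morphism c : monoid_morphism (@on_chart K c).
Proof. by split=> [|f g]; rewrite !on_chartE ?rmorph1 ?rmorphM. Qed.
HB.instance Definition _ c := GRing.isZmodMorphism.Build _ _ (@on_chart K c) (on_chart_is_zmod_morphism c).
HB.instance Definition _ c := GRing.isMonoidMorphism.Build _ _ (@on_chart K c) (on_chart_is_monoid_morphism c).

Lemma on_chartZ c a f : on_chart c (a *: f) = a *: on_chart c f.
Proof. by rewrite !on_chartE mmapZ mul_polyC. Qed.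

Lemma on_chart_var c i : on_chart c 'X_i = chart_var c i.
Proof. by rewrite on_chartE mmapX mmap1U. Qed.

Definition hform e q : {mpoly K[2]} :=
  \sum_(i < e.+1) q`_i *: ('X_0 ^+ (e - i) * 'X_1 ^+ i).

Lemma hform_homog e q : hform e q \is e.-homog.
Proof.
apply: rpred_sum => i _; apply: rpredZ.
have hX (j : 'I_2) l : ('X_j : {mpoly K[2]}) ^+ l \is l.-homog.
  by have := dhomogMn l (_ : 'X_j \is 1.-homog); rewrite mul1n; apply; rewrite dhomogX; apply/eqP; exact: mdeg1.
by have := dhomogM (hX 0 (e - i)%N) (hX 1 i); rewrite subnK // -ltnS.
Qed.

Lemma on_chart0_hform_poly e q : on_chart 0 (hform e q) = \poly_(i < e.+1) q`_i.
Proof.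
rewrite /hform rmorph_sum /= poly_def; apply: eq_bigr => i _.
rewrite on_chartZ rmorphM !rmorphXn /= !on_chart_var /chart_var /=.
by rewrite expr1n mul1r.
Qed.

Lemma on_chart0_hform e q : (size q <= e.+1)%N -> on_chart 0 (hform e q) = q.
Proof.
move=> sq; rewrite on_chart0_hform_poly; apply/polyP=> i; rewrite coef_poly.
by case: ltnP => // le; rewrite nth_default // (leq_trans sq).
Qed.

Lemma on_chart1_hform e q : on_chart 1 (hform e q) = \poly_(i < e.+1) q`_(e - i).
Proof.
rewrite /hform rmorph_sum /= poly_def [RHS](reindex_inj rev_ord_inj) /=.
apply: eq_bigr => i _; rewrite on_chartZ rmorphM !rmorphXn /= !on_chart_var /chart_var /=.
by rewrite expr1n mulr1 subSS subKn // -ltnS.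
Qed.

Lemma hformD e q1 q2 : hform e (q1 + q2) = hform e q1 + hform e q2.
Proof. by rewrite -big_split; apply: eq_bigr => i _; rewrite coefD scalerDl. Qed.
Lemma hformZ e a q : hform e (a *: q) = a *: hform e q.
Proof. by rewrite scaler_sumr; apply: eq_bigr => i _; rewrite coefZ scalerA. Qed.

Lemma hformK e f : f \is e.-homog -> hform e (on_chart 0 f) = f.
Proof.
move=> hf; rewrite {1}[f]mpolyE rmorph_sum /=.
have H0 : hform e 0 = 0 by apply: big1 => i _; rewrite coef0 scale0r.
rewrite (big_morph (hform e) (hformD e) H0) [RHS]mpolyE !big_seq.
apply: eq_bigr => m mf; rewrite on_chartZ hformZ; congr (_ *: _).
have em : mdeg m = e by apply: (dhomogP _ _ _ hf).
rewrite on_chartE mmapX /mmap1 big_ord_recl big_ord1 /chart_var /= expr1n mul1r.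
have -> : lift ord0 0 = 1 :> 'I_2 by apply: val_inj.
have Em : e = (m 0%R + m 1%R)%N.
  by rewrite -em mdegE big_ord_recl big_ord1; congr (_ + m _)%N; apply: val_inj.
have l1 : (m 1%R < e.+1)%N by rewrite Em ltnS leq_addl.
rewrite /hform (bigD1 (Ordinal l1)) //= coefXn eqxx scale1r big1 => [|i /eqP ne].
  rewrite addr0 [RHS]mpolyXE_id big_ord_recl big_ord1 Em addnK.
  by have -> : lift ord0 0 = 1 :> 'I_2 by apply: val_inj.
rewrite coefXn; case: eqP => [E|]; last by rewrite scale0r.
by case: ne; apply: val_inj.
Qed.

Lemma ord2P c : c = 0 \/ c = 1.
Proof. by case: c => -[|[|//]] i; [left | right]; apply: val_inj. Qed.

Lemma on_chart1_coef e f : f \is e.-homog ->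
  on_chart 1 f = \poly_(i < e.+1) (on_chart 0 f)`_(e - i).
Proof. by move=> /hformK {1}<-; rewrite on_chart1_hform. Qed.

Lemma size_on_chart c e f : f \is e.-homog -> (size (on_chart c f) <= e.+1)%N.
Proof.
move=> hf; case: (ord2P c) => ->; last by rewrite (on_chart1_coef hf) size_poly.
by rewrite -(hformK hf) on_chart0_hform_poly size_poly.
Qed.

Lemma on_chart0_inj e f g : f \is e.-homog -> g \is e.-homog ->
  on_chart 0 f = on_chart 0 g -> f = g.
Proof. by move=> hf hg E; rewrite -[LHS](hformK hf) -[RHS](hformK hg) E. Qed.

Lemma hformM (d e : nat) (p q : {poly K}) : (size p <= d.+1)%N -> (size q <= e.+1)%N ->
  hform (d + e) (p * q) = hform d p * hform e q.
Proof.
move=> sp sq; apply: (@on_chart0_inj (d + e)); rewrite ?hform_homog ?dhomogM ?hform_homog //.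
rewrite rmorphM /= !on_chart0_hform //.
apply: leq_trans (size_polyMleq _ _) _; lia.
Qed.

Lemma on_chart_horner c t f : (on_chart c f).[t] = f.@[fun i => if i == c then 1 else t].
Proof.
rewrite on_chartE /mmap horner_sum mevalE; apply: eq_bigr => m _.
rewrite hornerM hornerC; congr (_ * _); rewrite /mmap1 horner_prod.
apply: eq_bigr => i _; rewrite horner_exp /chart_var; case: ifP => _; first by rewrite hornerC.
by rewrite hornerX.
Qed.

Lemma meval_hform e q a :
  (hform e q).@[a] = \sum_(i < e.+1) q`_i * (a 0 ^+ (e - i) * a 1 ^+ i).
Proof.
rewrite raddf_sum; apply: eq_bigr => i _.
by rewrite /= mevalZ mevalM !rmorphXn /= !mevalXU.
Qed.

Lemma on_chartX c i m : i != c -> on_chart c ('X_[m] : {mpoly K[2]}) = 'X^(m i).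
Proof.
move=> ic; rewrite on_chartE mmapX /mmap1 (bigD1 i) //= big1 => [|j ji].
  by rewrite /chart_var (negbTE ic) mulr1.
rewrite /chart_var; have -> : j == c; last by rewrite expr1n.
by case: (ord2P i) (ord2P j) (ord2P c) ic ji => -> [] -> [] ->.
Qed.

Lemma deriv_on_chart c i f : i != c -> (on_chart c f)^`() = on_chart c f^`M(i).
Proof.
move=> ic; rewrite [f]mpolyE (linear_sum (mderiv i)) !(raddf_sum (@on_chart K c)) (linear_sum (@deriv K)) /=; apply: eq_bigr => m _. 
rewrite mderivZ !on_chartZ derivZ mderivX on_chartZ !(on_chartX _ ic) derivXn.
by rewrite mnmBE mnm1E eqxx subn1 scaler_nat.
Qed.

Lemma euler_mderiv e f : f \is e.-homog ->
  'X_0 * f^`M(0) + 'X_1 * f^`M(1) = e%:R *: f.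
Proof.
move=> hf; rewrite [in RHS](mpolyE f) scaler_sumr [f in f^`M(0)]mpolyE [f in f^`M(1)]mpolyE.
rewrite !linear_sum !mulr_sumr -big_split /= !big_seq; apply: eq_bigr => m mf.
have XX i : 'X_i * ('X_[m])^`M(i) = (m i)%:R *: 'X_[m] :> {mpoly K[2]}.
  rewrite mderivX -scalerAr -mpolyXD; have [-> | mi] := eqVneq (m i) 0%N; first by rewrite !scale0r.
  by rewrite addmC submK // lep1mP.
rewrite !mderivZ -!scalerAr !XX -scalerDr -scalerDl -natrD [RHS]scalerA [X in _ = X *: _]mulrC -scalerA; congr (_ *: (_%:R *: _)).
have <- : mdeg m = e by apply: (dhomogP _ _ _ hf).
by rewrite mdegE big_ord_recl big_ord1; congr (_ + m _)%N; apply: val_inj.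
Qed.

End Forms.

Section Coordinates.
Variable K : numClosedFieldType.

Lemma poly_eq_horner (p q : {poly K}) : (forall t, p.[t] = q.[t]) -> p = q.
Proof.
move=> E; apply/eqP; rewrite -subr_eq0; apply/negPn/negP=> /closed_nonrootP [x].
by rewrite rootE hornerD hornerN E subrr eqxx.
Qed.

Definition pairing n (v : 'rV[K]_n.+1) (f : {poly K}) : K := \sum_(i < n.+1) v 0 i * f`_i.

Lemma pairing_is_linear n v : linear_for *%R (@pairing n v).
Proof.
move=> a f g; rewrite /pairing mulr_sumr -big_split; apply: eq_bigr => i _ /=.
by rewrite coefD coefZ mulrDr mulrCA.
Qed.
HB.instance Definition _ n v :=
  GRing.isLinear.Build K {poly K} K *%R (@pairing n v) (pairing_is_linear v).

Lemma pairingDl n (a : K) (u v : 'rV_n.+1) f : pairing (a *: u + v) f = a * pairing u f + pairing v f.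
Proof.
rewrite /pairing mulr_sumr -big_split; apply: eq_bigr => i _ /=.
by rewrite !mxE mulrDl mulrA.
Qed.

(* The divided-power coordinates, in which the value at [v] of the hyperplane cutting the divisor
   of a form [f] on C_n is [pairing (coords v) f]. *)
Definition coords n (v : binary_form K n) : 'rV[K]_n.+1 :=
  \row_i ((on_chart 0 v)`_i / 'C(n, i)%:R).

Definition form_of n (u : 'rV[K]_n.+1) : binary_form K n :=
  DHomog (hform_homog n (\poly_(i < n.+1) (u 0 (inord i) * 'C(n, i)%:R))).

Lemma coords_is_linear n : linear (@coords n).
Proof.
move=> a u v; apply/rowP=> i; rewrite !mxE /= raddfD /= on_chartZ coefD coefZ.
by rewrite mulrDl mulrA.
Qed.
HB.instance Definition _ n :=
  GRing.isLinear.Build K (binary_form K n) 'rV[K]_n.+1 _ (@coords n) (@coords_is_linear n).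

Lemma bin_neq0 n (i : 'I_n.+1) : 'C(n, i)%:R != 0 :> K.
Proof. by rewrite pnatr_eq0 -lt0n bin_gt0 -ltnS. Qed.

Lemma form_ofK n : cancel (@form_of n) (@coords n).
Proof.
move=> u; apply/rowP=> i; rewrite mxE /= on_chart0_hform ?size_poly //.
by rewrite coef_poly ltn_ord inord_val mulfK ?bin_neq0.
Qed.

Lemma coordsK n : cancel (@coords n) (@form_of n).
Proof.
move=> v; apply: val_inj; apply: (@on_chart0_inj _ n); rewrite ?hform_homog ?dhomog_is_dhomog //=.
rewrite on_chart0_hform ?size_poly //; apply/polyP=> i; rewrite coef_poly.
case: ltnP => [lt|le]; first by rewrite mxE inordK // divfK ?(bin_neq0 (Ordinal lt)).
by rewrite nth_default // (leq_trans (size_on_chart _ (dhomog_is_dhomog v))).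
Qed.

Lemma form_of_is_linear n : linear (@form_of n).
Proof. by move=> a u v; apply: (can_inj (@coordsK n)); rewrite linearP /= !form_ofK. Qed.
HB.instance Definition _ n :=
  GRing.isLinear.Build K 'rV[K]_n.+1 (binary_form K n) _ (@form_of n) (@form_of_is_linear n).

Lemma coords_veronese n a i : coords (veronese n a) 0 i = a 0 ^+ (n - i) * a 1 ^+ i.
Proof.
rewrite mxE /= big_ord_recl big_ord1 rmorphXn rmorphD /= !on_chartZ.
have -> : lift ord0 ord0 = 1 :> 'I_2 by apply: val_inj.
rewrite !on_chart_var /chart_var /= exprDn coef_sum (bigD1 i) //= big1 => [|j /eqP ji].
  rewrite addr0 coefMn !exprZn expr1n -scalerAr -scalerAl mul1r scalerA coefZ coefXn eqxx mulr1.
  by rewrite -(mulr_natr (_ * _)) mulfK ?bin_neq0 // mulrC.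
rewrite coefMn !exprZn expr1n -scalerAr -scalerAl mul1r scalerA coefZ coefXn.
by case: eqP => [E|]; [case: ji; apply: val_inj | rewrite mulr0 mul0rn].
Qed.

Lemma pairing_veronese n a f : pairing (coords (veronese n a)) f = (hform n f).@[a].
Proof.
rewrite meval_hform; apply: eq_bigr => i _.
by rewrite coords_veronese mulrC.
Qed.

Lemma functional_pairing n (h : binary_form K n -> K) f :
    (forall c u v, h (c *: u + v) = c * h u + h v) -> f \is n.-homog ->
    (forall a, h (veronese n a) = f.@[a]) ->
  forall v, h v = pairing (coords v) (on_chart 0 f).
Proof.
move=> hl hf hv.
have h0 : h 0 = 0 by have := hl (-1) 0 0; rewrite scaler0 addr0 mulN1r addNr.
have hE v : h v = \sum_(i < n.+1) coords v 0 i * h (form_of (delta_mx 0 i)).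
  rewrite -{1}[v]coordsK [coords v in LHS]row_sum_delta linear_sum /=.
  rewrite (big_morph h (id1 := 0) (op1 := +%R)) => [|x y|//]; last first.
    by rewrite -[x]scale1r hl mul1r scale1r.
  apply: eq_bigr => i _; rewrite linearZ /= -[_ *: _]addr0 hl h0 addr0 //.
move=> v; rewrite hE; apply: eq_bigr => i _; congr (_ * _).
suff /polyP/(_ i) : \poly_(i < n.+1) h (form_of (delta_mx 0 (inord i))) = on_chart 0 f.
  by rewrite coef_poly ltn_ord inord_val.
apply: poly_eq_horner => t; rewrite on_chart_horner -hv hE horner_poly.
by apply: eq_bigr => j _; rewrite coords_veronese /= expr1n mul1r mulrC inord_val.
Qed.

Definition lin_indep r (V : lmodType K) (phi : 'I_r -> V) :=
  forall c : 'I_r -> K, \sum_i c i *: phi i = 0 -> forall i, c i = 0.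

Lemma in_divisor_spanP n (phi : binary_form K (n - 2)) (v : binary_form K n) : (2 <= n)%N ->
  in_divisor_span phi v <->
  forall j, (j < 3)%N -> pairing (coords v) (on_chart 0 phi * 'X^j) = 0.
Proof.
move=> n2; have en : (n - 2 + (n - (n - 2)) = n)%N by lia.
have e2 : (n - (n - 2) = 2)%N by lia.
have hphi := dhomog_is_dhomog phi.
split=> [H j j3 | H h [psi hpsi]].
  pose g := on_chart 0 phi * 'X^j.
  have lg : linear_for *%R (fun v : binary_form K n => pairing (coords v) g : K^o).
    by move=> a u w; rewrite linearP /= pairingDl.
  pose Lm := GRing.isLinear.Build K (binary_form K n) K^o *%R _ lg.
  pose hl : {linear binary_form K n -> K^o} := HB.pack (fun v : binary_form K n => pairing (coords v) g : K^o) Lm.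
  have := H (linfun hl); rewrite lfunE /=; apply.
  exists (DHomog (hform_homog (n - (n - 2)) 'X^j)) => a; rewrite (lfunE hl) /= pairing_veronese.
  rewrite -[in hform n _]en hformM ?size_polyXn ?e2 ?ltnS //; last exact: size_on_chart.
  by rewrite mevalM hformK.
rewrite (@functional_pairing n h (mpoly_of_dhomog phi * mpoly_of_dhomog psi)); last first.
- by move=> a; rewrite mevalM hpsi.
- by have := dhomogM hphi (dhomog_is_dhomog psi); rewrite en.
- by move=> c u w; rewrite linearP.
rewrite rmorphM /= -[on_chart 0 psi]coefK poly_def mulr_sumr linear_sum big1 // => i _.
rewrite -scalerAr linearZ /= H ?mulr0 //; apply: leq_trans (ltn_ord i) _.
by apply: leq_trans (size_on_chart 0 (dhomog_is_dhomog psi)) _; rewrite e2.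
Qed.

Lemma base_locusP n r (L : {vspace binary_form K n}) : (2 <= n)%N ->
  in_base_locus_of_some_system r L <->
  exists phi : 'I_r -> {poly K}, [/\ lin_indep phi, forall i, (size (phi i) <= n.-1)%N
    & forall v i j, v \in L -> (j < 3)%N -> pairing (coords v) (phi i * 'X^j) = 0].
Proof.
move=> n2; have en : (n - 2).+1 = n.-1 by lia.
split=> [[phi [fphi H]] | [phi [iphi sphi H]]].
  exists (fun i => on_chart 0 (tnth phi i)); split=> [c E||v i j vL j3].
  - move/freeP: fphi => /(_ c); apply; apply: val_inj; apply: (@on_chart0_inj _ (n - 2)).
    + exact: dhomog_is_dhomog.
    + exact: dhomog0.
    rewrite raddf0 -[RHS]E /= raddf_sum rmorph_sum; apply: eq_bigr => i _.
    by rewrite -tnth_nth /= on_chartZ.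
  - by move=> i; rewrite -en size_on_chart // dhomog_is_dhomog.
  have := H v vL (fun i' => (i' == i)%:R); move/(_ _)/in_divisor_spanP.
  have -> : \sum_(i' < r) (i' == i)%:R *: tnth phi i' = tnth phi i.
    rewrite (bigD1 i) //= eqxx scale1r big1 ?addr0 // => i' /negbTE ->.
    by rewrite scale0r.
  by apply=> //; exists i; rewrite eqxx oner_neq0.
pose T := [tuple DHomog (hform_homog (n - 2) (phi i)) | i < r].
have TE (i : 'I_r) : T`_i = DHomog (hform_homog (n - 2) (phi i)) by rewrite -tnth_nth tnth_mktuple.
exists T; split=> [|v vL c _].
  apply/freeP=> c E; apply: iphi; move/(congr1 val): E; rewrite /= raddf_sum => /(congr1 (on_chart 0)).
  rewrite rmorph0 rmorph_sum /= => E; rewrite -[RHS]E; apply: eq_bigr => i _.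
  by rewrite TE /= on_chartZ on_chart0_hform // en.
apply/in_divisor_spanP=> // j j3.
rewrite /= raddf_sum rmorph_sum mulr_suml linear_sum big1 // => i _.
by rewrite tnth_mktuple /= on_chartZ -scalerAl linearZ /= on_chart0_hform ?en // H ?mulr0.
Qed.

End Coordinates.

(** * The projected curve and the splitting of its normal bundle *)

Section ProjectedCurve.
Variable K : numClosedFieldType.
Variables (n m : nat) (p : 'I_m -> binary_form K n).

Local Notation P j := (on_chart 0 (p j : {mpoly K[2]})).

Definition Lam c : 'M[{poly K}]_(1 + 1, m) := col_mx (Defs.lift p c) (velocity p c).

Section Projection.
Variables (L : {vspace binary_form K n}) (pi : 'Hom(binary_form K n, 'rV[K]_m)).
Hypothesis Lp : projection_from L pi p.

Lemma projection_coord v j : pi v 0 j = pairing (coords v) (P j).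
Proof.
have [_ pv] := Lp; apply: (functional_pairing (h := fun v => pi v 0 j)).
- by move=> c u w; rewrite linearP /= !mxE.
- exact: dhomog_is_dhomog.
- by move=> a; rewrite pv.
Qed.

Lemma mem_centre v : v \in L <-> forall j, pairing (coords v) (P j) = 0.
Proof.
have [<- _] := Lp; rewrite memv_ker; split=> [/eqP v0 j|H].
  by rewrite -projection_coord v0 mxE.
by apply/eqP/rowP=> j; rewrite projection_coord H mxE.
Qed.

Lemma centre_forms k : \dim L = k -> (k + m = n.+1)%N ->
  lin_indep (fun j => P j) /\
  forall f : {poly K}, (size f <= n.+1)%N ->
    (forall v, v \in L -> pairing (coords v) f = 0) -> exists c, f = \sum_j c j *: P j.
Proof.
move=> <- dimE; pose M : 'M[K]_(n.+1, m) := \matrix_(i, j) (P j)`_i.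
pose V : 'M[K]_(\dim L, n.+1) := \matrix_(i < \dim L) coords (vbasis L)`_i.
have pM u j : (u *m M) 0 j = pairing u (P j).
  by rewrite mxE; apply: eq_bigr => i _; rewrite mxE.
have VM : V *m M = 0.
  apply/row_matrixP=> i; rewrite row_mul rowK row0; apply/rowP=> j.
  rewrite pM mxE; apply/mem_centre: j; apply: vbasis_mem; apply: mem_nth.
  by rewrite size_tuple.
have fV : row_free V.
  rewrite -kermx_eq0; apply/rowV0P=> x /sub_kermxP xV; apply/rowP=> i; rewrite mxE.
  have /freeP fb := basis_free (vbasisP L).
  apply: (fb (fun i => x 0 i)); apply: (can_inj (@coordsK K n)); rewrite linear0 -[RHS]xV.
  rewrite linear_sum mulmx_sum_row; apply: eq_bigr => l _.
  by rewrite linearZ /= rowK.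
have kV : (kermx M <= V)%MS.
  apply/row_subP=> i; set u := row i _.
  have uM : u *m M = 0 by rewrite /u -row_mul mulmx_ker row0.
  have uL : form_of u \in L.
    by apply/mem_centre=> j; rewrite form_ofK -pM uM mxE.
  rewrite -[u]form_ofK (coord_vbasis uL) linear_sum; apply: summx_sub => l _.
  rewrite linearZ /= scalemx_sub //; have <- : row l V = coords (vbasis L)`_l by rewrite rowK.
  exact: row_sub.
have rM : \rank M = m.
  have /eqmx_rank : (kermx M == V)%MS by rewrite kV; apply/sub_kermxP.
  rewrite mxrank_ker (eqP fV); have := rank_leq_row M; have := rank_leq_col M; lia.
split=> [c E i | f sf fL].
  have Mf : row_free M^T by rewrite /row_free mxrank_tr rM.
  have : \row_j c j *m M^T = 0.
    apply/rowP=> l; rewrite !mxE; have /polyP/(_ l) := E; rewrite coef0 coef_sum => El.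
    by rewrite -[RHS]El; apply: eq_bigr => j _; rewrite !mxE coefZ.
  rewrite -(mul0mx _ M^T) => /(row_free_inj Mf)/rowP/(_ i).
  by rewrite !mxE.
pose F : 'rV[K]_n.+1 := \row_i f`_i.
have FV : F *m V^T = 0.
  apply/rowP=> i; rewrite !mxE.
  have bi : (vbasis L)`_i \in L by apply: vbasis_mem; apply: mem_nth; rewrite size_tuple.
  rewrite -[RHS](fL _ bi); apply: eq_bigr => l _.
  by rewrite !mxE mulrC.
have le : (M^T <= kermx V^T)%MS by apply/sub_kermxP; rewrite -trmx_mul VM trmx0.
have /eqmxP e : (M^T == kermx V^T)%MS.
  rewrite -(geq_leqif (mxrank_leqif_eq le)) mxrank_ker !mxrank_tr rM (eqP fV).
  lia.
have /submxP [c Fc] : (F <= M^T)%MS by rewrite e; apply/sub_kermxP.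
exists (fun j => c 0 j); apply/polyP=> i; rewrite coef_sum.
have [lt | le'] := ltnP i n.+1; last first.
  rewrite nth_default ?(leq_trans sf) // big1 // => j _.
  by rewrite coefZ [_`_i]nth_default ?mulr0 // (leq_trans (size_on_chart _ (dhomog_is_dhomog _))).
move/rowP/(_ (Ordinal lt)): Fc; rewrite !mxE => ->.
by apply: eq_bigr => j _; rewrite !mxE coefZ.
Qed.

Lemma Lam_row_free : misses_rnc L -> ordinary_singularities p ->
  forall c t, row_free (eval_mx t (Lam c)).
Proof.
move=> miss ord c t; have [_ pv] := Lp.
have [beta [lb vb]] := ord c 1.
rewrite -kermx_eq0; apply/rowV0P=> x /sub_kermxP.
rewrite -[x]hsubmxK; set x1 := lsubmx x; set x2 := rsubmx x.
rewrite /eval_mx map_col_mx mul_row_col => E.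
have x20 : x2 = 0.
  move/(congr1 (mulmx^~ (eval_mx t beta))): E; rewrite mulmxDl -!mulmxA -!eval_mxM lb vb.
  by rewrite eval_mx0 mulmx0 add0r mul0mx /eval_mx map_mx1 mulmx1.
suff -> : x1 = 0 by rewrite x20 row_mx0.
move: E; rewrite x20 mul0mx addr0 => E; apply/eqP/negP=> /negP x1n.
have x1n0 : x1 0 0 != 0.
  by apply: contraNneq x1n => x0; apply/eqP/rowP=> i; rewrite ord1 x0 mxE.
pose a (i : 'I_2) := if i == c then 1 else t.
have : veronese n a \notin L by apply: miss; exists c; rewrite /a eqxx oner_neq0.
case/negP; have [<- _] := Lp; rewrite memv_ker; apply/eqP/rowP=> j; rewrite -pv mxE.
clearbody x1; move/rowP/(_ j): E; rewrite !mxE big_ord1 !mxE /horner_eval on_chart_horner => /eqP.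
by rewrite mulf_eq0 (negbTE x1n0) => /eqP.
Qed.

End Projection.
End ProjectedCurve.

Section NormalBundle.
Variable K : numClosedFieldType.
Variables (n m : nat) (p : 'I_m -> binary_form K n).

Definition bundle_iso N (a : 'I_N -> int) : Prop :=
  exists Q : 'M[{mpoly K[2]}]_(m, N),
    (forall j i, section_O (a i - n%:Z) (Q j i)) /\
    forall c : 'I_2,
      (forall w : 'rV[{poly K}]_N, exists v : 'rV_m, v *m map_mx (on_chart c) Q = w) /\
      (forall v : 'rV[{poly K}]_m, v *m map_mx (on_chart c) Q = 0 <-> in_image_dp p c v).

Lemma normal_bundle_isoE N (s : seq int) : size s = N ->
  normal_bundle_iso p s <-> bundle_iso (fun i : 'I_N => s`_i).
Proof. by move=> e; case: N / e. Qed.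

Lemma bundle_iso_perm N (a : 'I_N -> int) (s : 'S_N) :
  bundle_iso a -> bundle_iso (fun i => a (s i)).
Proof.
case=> Q [sQ H]; exists (col_perm s Q); split=> [j i|c]; first by rewrite mxE.
have [surj ker] := H c.
have E v : v *m map_mx (on_chart c) (col_perm s Q) = col_perm s (v *m map_mx (on_chart c) Q).
  by rewrite map_col_perm !col_permE mulmxA.
split=> [w | v].
  have [v vw] := surj (col_perm s^-1 w); exists v.
  by rewrite E vw; apply/rowP=> i; rewrite !mxE permK.
rewrite E -ker; split=> [v0|->]; last by apply/rowP=> i; rewrite !mxE.
by apply/rowP=> i; move/rowP/(_ (s^-1 i)%g): v0; rewrite !mxE permKV.
Qed.

Lemma normal_bundle_iso_perm_eq (s1 s2 : seq int) :
  perm_eq s1 s2 -> normal_bundle_iso p s1 -> normal_bundle_iso p s2.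
Proof.
rewrite perm_sym => s12 iso1; have sz := perm_size s12.
have [s Es] := tuple_permP (t := in_tuple s1) s12.
apply/(normal_bundle_isoE sz); move/(normal_bundle_isoE (erefl (size s1))): iso1.
move/(bundle_iso_perm s); congr bundle_iso; apply: boolp.funext => i.
by rewrite Es (nth_map i) ?size_enum_ord // nth_ord_enum (tnth_nth 0).
Qed.

Lemma in_image_dpE c v : in_image_dp p c v <-> exists y, v = y *m Lam p c.
Proof.
split=> [[f [g E]] | [y ->]].
  exists (row_mx g%:M f%:M); rewrite mul_row_col !mul_scalar_mx -E subrK //.
exists (rsubmx y 0 0), (lsubmx y 0 0); rewrite -{1}[y]hsubmxK mul_row_col.
by rewrite {1}[lsubmx y]mx11_scalar {1}[rsubmx y]mx11_scalar !mul_scalar_mx addrK.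
Qed.

Definition syzygy_basis N (d : 'I_N -> nat) (Q : 'M[{poly K}]_(m, N)) :=
  [/\ Lam p 0 *m Q = 0, forall j i, (size (Q j i) <= (d i).+1)%N,
      inj_cols (lead_mx d Q)
    & forall q : 'cV_m, Lam p 0 *m q = 0 -> exists w, q = Q *m w].

Lemma section_O_homog d (f : {mpoly K[2]}) : section_O ((n + d)%:Z - n%:Z) f <-> f \is d.-homog.
Proof. by have -> : (n + d)%:Z - n%:Z = d%:Z by lia. Qed.

Lemma lead_chart1 N (d : 'I_N -> nat) (Q : 'M[{mpoly K[2]}]_(m, N)) :
    (forall j i, Q j i \is (d i).-homog) ->
  eval_mx 0 (map_mx (on_chart 1) Q) = lead_mx d (map_mx (on_chart 0) Q).
Proof.
move=> hQ; apply/matrixP=> j i; rewrite !mxE /horner_eval horner_coef0.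
by rewrite (on_chart1_coef (hQ j i)) coef_poly subn0.
Qed.

Lemma syzygy_basis_of_iso N (d : 'I_N -> nat) :
  bundle_iso (fun i => (n + d i)%:Z) -> exists Q, syzygy_basis d Q.
Proof.
case=> Q [sQ H]; exists (map_mx (on_chart 0) Q).
have hQ j i : Q j i \is (d i).-homog by apply/section_O_homog/sQ.
have right_inv c : exists V, V *m map_mx (on_chart c) Q = 1%:M.
  have [surj _] := H c; have [f Hf] := boolp.choice (fun i => surj (delta_mx 0 i)).
  by exists (\matrix_i f i); apply/row_matrixP=> i; rewrite row_mul rowK Hf row1.
split.
- apply/row_matrixP=> i; rewrite row_mul row0; have [_ ->] := H 0.
  by apply/in_image_dpE; exists (delta_mx 0 i); rewrite -rowE.
- by move=> j i; rewrite mxE; apply: size_on_chart.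
- rewrite -lead_chart1 //; have [V VQ] := right_inv 1.
  by apply: (@linv_inj_cols _ _ _ _ (eval_mx 0 V)); rewrite -eval_mxM VQ /eval_mx map_mx1.
- move=> q Lq; have [V VQ] := right_inv 0; exists (V *m q).
  have [_ ker] := H 0.
  apply/eqP; rewrite -subr_eq0; apply/eqP.
  have -> : q - map_mx (on_chart 0) Q *m (V *m q) = (1%:M - map_mx (on_chart 0) Q *m V) *m q.
    by rewrite mulmxBl mul1mx mulmxA.
  apply/row_matrixP=> i; rewrite row_mul row0.
  have /ker/in_image_dpE [y ->] : row i (1%:M - map_mx (on_chart 0) Q *m V) *m map_mx (on_chart 0) Q = 0.
    by rewrite -row_mul mulmxBl mul1mx -mulmxA VQ mulmx1 subrr row0.
  by rewrite -mulmxA Lq mulmx0.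
Qed.

Lemma mderiv_homog e (f : {mpoly K[2]}) i : f \is e.+1.-homog -> f^`M(i) \is e.-homog.
Proof.
move=> hf; apply/dhomogP=> mu; rewrite mcoeff_msupp mcoeff_deriv => H.
have : (mu + U_(i))%MM \in msupp f.
  by rewrite mcoeff_msupp; apply: contraNneq H => ->; rewrite mul0rn.
move/(dhomogP _ _ _ hf) => E; have : (mdeg (mu + U_(i))%MM = e.+1)%N by [].
by rewrite mdegD mdeg1 addn1 => -[].
Qed.

End NormalBundle.

Section Swap.
Variable K : numClosedFieldType.
Variables (n m : nat) (p : 'I_m -> binary_form K n.+1).

Lemma syzygy_chart1 d (q : 'I_m -> {mpoly K[2]}) : (forall j, q j \is d.-homog) ->
  Lam p 0 *m \col_j on_chart 0 (q j) = 0 -> Lam p 1 *m \col_j on_chart 1 (q j) = 0.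
Proof.
move=> hq; rewrite /Lam !mul_col_mx => /eqP; rewrite col_mx_eq0 => /andP [/eqP l0 /eqP v0].
pose pf j := mpoly_of_dhomog (p j).
have hp j : pf j \is n.+1.-homog by apply: dhomog_is_dhomog.
have F0 : \sum_j pf j * q j = 0.
  apply: (@on_chart0_inj K (n.+1 + d)); rewrite ?dhomog0 //.
    by apply: rpred_sum => j _; apply: dhomogM.
  rewrite rmorph0 rmorph_sum; move/colP/(_ 0): l0; rewrite !mxE => E; rewrite -[RHS]E.
  by apply: eq_bigr => j _; rewrite rmorphM !mxE.
have G1 : \sum_j (pf j)^`M(1) * q j = 0.
  apply: (@on_chart0_inj K (n + d)); rewrite ?dhomog0 //.
    by apply: rpred_sum => j _; apply: dhomogM => //; apply: mderiv_homog.
  rewrite rmorph0 rmorph_sum; move/colP/(_ 0): v0; rewrite !mxE => E; rewrite -[RHS]E.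
  by apply: eq_bigr => j _; rewrite rmorphM !mxE /= (@deriv_on_chart _ 0 1).
have G0 : \sum_j (pf j)^`M(0) * q j = 0.
  have X0 : ('X_0 : {mpoly K[2]}) != 0.
    apply/eqP=> X0; have := @on_chart_var K 0 0; rewrite X0 rmorph0 => /esym/eqP.
    by rewrite /chart_var eqxx oner_eq0.
  have : 'X_0 * \sum_j (pf j)^`M(0) * q j + 'X_1 * \sum_j (pf j)^`M(1) * q j =
      n.+1%:R * \sum_j pf j * q j.
    rewrite !mulr_sumr -big_split; apply: eq_bigr => j _ /=.
    by rewrite !mulrA -mulrDl (euler_mderiv (hp j)) mulr_natl scaler_nat.
  by rewrite F0 G1 !mulr0 addr0 => /eqP; rewrite mulf_eq0 (negbTE X0) => /eqP.
apply/eqP; rewrite col_mx_eq0; apply/andP; split; apply/eqP/colP=> i; rewrite ord1 !mxE.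
  move/(congr1 (on_chart 1)): F0; rewrite rmorph0 rmorph_sum => E; rewrite -[RHS]E.
  by apply: eq_bigr => j _; rewrite rmorphM !mxE.
move/(congr1 (on_chart 1)): G0; rewrite rmorph0 rmorph_sum => E; rewrite -[RHS]E.
by apply: eq_bigr => j _; rewrite rmorphM !mxE /= (@deriv_on_chart _ 1 0).
Qed.

End Swap.

Section Splitting.
Variable K : numClosedFieldType.
Variables (n N : nat) (p : 'I_(2 + N) -> binary_form K n.+2).

Theorem normal_bundle_splits : (forall c t, row_free (eval_mx t (Lam p c))) ->
  exists d : 'I_N -> nat,
    bundle_iso p (fun i => (n.+2 + d i)%:Z) /\ (\sum_i d i = n.+1.*2)%N.
Proof.
move=> Lf; have [d [Q [LQ sQ Qi Ql]]] := minimal_frame (Lf 0).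
pose Qf : 'M[{mpoly K[2]}]_(2 + N, N) := \matrix_(j, i) hform (d i) (Q j i).
have hQf j i : Qf j i \is (d i).-homog by rewrite mxE; apply: hform_homog.
have Q0 : map_mx (on_chart 0) Qf = Q.
  by apply/matrixP=> j i; rewrite !mxE on_chart0_hform.
pose Q1 := map_mx (on_chart 1) Qf.
have LQ1 : Lam p 1 *m Q1 = 0.
  have col c a i : (Lam p c *m map_mx (on_chart c) Qf) a i = (Lam p c *m \col_j on_chart c (Qf j i)) a 0.
    by rewrite !mxE; apply: eq_bigr => j _; rewrite !mxE.
  apply/matrixP=> a i; rewrite col.
  have E : Lam p 1 *m \col_j on_chart 1 (Qf j i) = 0.
    apply: (@syzygy_chart1 _ _ _ p (d i) (fun j => Qf j i) (fun j => hQf j i)).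
    by apply/colP=> b; have := col 0 b i; rewrite Q0 LQ !mxE.
  by rewrite E !mxE.
have eQ1 t i j : t != 0 -> eval_mx t Q1 j i = t ^+ d i * eval_mx t^-1 Q j i.
  move=> t0; rewrite !mxE /horner_eval on_chart_horner meval_hform (horner_coef_wide _ (sQ j i)).
  rewrite mulr_sumr; apply: eq_bigr => l _.
  rewrite /= expr1n mulr1 mulrCA exprVn; congr (_ * _).
  by apply: (canRL (mulfK (expf_neq0 _ t0))); rewrite -exprD subnK // -ltnS.
have Q1i t : inj_cols (eval_mx t Q1).
  have [-> | t0] := eqVneq t 0.
    by rewrite (lead_chart1 hQf) Q0.
  move=> x Ex; pose y : 'cV[K]_N := \col_i (t ^+ d i * x i 0).
  have y0 : y = 0.
    apply: (Qi t^-1); rewrite -[RHS]Ex; apply/colP=> j; rewrite !mxE.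
    apply: eq_bigr => i _; have := eQ1 t i j t0; rewrite !mxE => ->.
    by rewrite mulrCA mulrA.
  apply/colP=> i; move/colP/(_ i): y0; rewrite !mxE => /eqP.
  by rewrite mulf_eq0 expf_eq0 (negbTE t0) andbF => /eqP.
exists d; split.
  exists Qf; split=> [j i|c]; first by apply/section_O_homog/hQf.
  have {}Lc : Lam p c *m map_mx (on_chart c) Qf = 0.
    by case: (ord2P c) => ->; rewrite ?Q0.
  have Qc t : inj_cols (eval_mx t (map_mx (on_chart c) Qf)).
    by case: (ord2P c) => ->; rewrite ?Q0 //; apply: Q1i.
  split=> [w|v]; first exact: (row_surj Lc (Lf c) Qc).
  by rewrite in_image_dpE; apply: (left_kernel Lc (Lf c) Qc).
have hp j : mpoly_of_dhomog (p j) \is n.+2.-homog by apply: dhomog_is_dhomog.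
have LinfE : col_mx (\row_j (Defs.lift p 0 0 j)`_n.+2) (\row_j (Defs.lift p 0 0 j)`_n.+1)
    = eval_mx 0 (Lam p 1) :> 'M_(1 + 1, 2 + N).
  rewrite /eval_mx map_col_mx; congr col_mx; apply/rowP=> j; rewrite !mxE /horner_eval.
    by rewrite horner_coef0 (on_chart1_coef (hp j)) coef_poly subn0.
  by rewrite horner_coef0 coef_deriv (on_chart1_coef (hp j)) coef_poly /= subn1.
apply: (@sum_column_degrees _ n N (Defs.lift p 0) Q d) => //.
- by move=> j; rewrite mxE; apply: size_on_chart.
- exact: (Lf 0).
- by rewrite LinfE; apply: Lf.
- by rewrite LinfE -Q0 -(lead_chart1 hQf) -eval_mxM LQ1 eval_mx0.
Qed.

End Splitting.

(** * Syzygies and divisibility by the square of y - t *)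

Section Bivariate.
Variable K : numClosedFieldType.

(* {poly {poly K}} stands for K[t][y], so this is (y - t)^2. *)
Definition Dsq : {poly {poly K}} := ('X - 'X%:P) ^+ 2.

Lemma Dsq_monic : Dsq \is monic.
Proof. by rewrite monic_exp ?monicXsubC. Qed.

Lemma size_Dsq : size Dsq = 3.
Proof. by rewrite size_exp_XsubC. Qed.

Lemma DsqE : Dsq = 'X^2 - ('X *+ 2) *: 'X + ('X^2)%:P.
Proof.
by rewrite /Dsq sqrrB -rmorphXn /= mulrC mul_polyC scalerMnl.
Qed.

Lemma coef_mul_Dsq (z : {poly {poly K}}) i :
  (z * Dsq)`_i = (if (i < 2)%N then 0 else z`_(i - 2)) -
    ('X *+ 2) * (if (i < 1)%N then 0 else z`_(i - 1)) + 'X^2 * z`_i.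
Proof.
rewrite DsqE mulrDr mulrBr -scalerAr coefD coefB coefMXn coefZ coefMX coefMC [_ * 'X^2]mulrC.
by rewrite subn1; case: i.
Qed.

Lemma size_mul_Dsq_coef (z : {poly {poly K}}) e :
  (forall i, (size ((z * Dsq)`_i)%R <= e.+2)%N) -> forall i, (size (z`_i)%R <= e)%N.
Proof.
move=> H i; elim/ltn_ind: i => i IH.
have sX (a : {poly K}) : (size (a * 'X^2)%R <= e.+2)%N -> (size a <= e)%N.
  have [->|a0] := eqVneq a 0; first by rewrite size_poly0.
  by rewrite size_Mmonic ?monicXn // size_polyXn addn3 /=.
apply: sX; rewrite mulrC.
have -> : 'X^2 * z`_i = (z * Dsq)`_i + ('X *+ 2) * (if (i < 1)%N then 0 else z`_(i - 1))
    - (if (i < 2)%N then 0 else z`_(i - 2)).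
  by rewrite coef_mul_Dsq; ring.
apply: leq_trans (size_polyD _ _) _; rewrite geq_max; apply/andP; split.
  apply: leq_trans (size_polyD _ _) _; rewrite geq_max H /=.
  case: ifP => i0; first by rewrite mulr0 size_poly0.
  rewrite mulrnAl -scaler_nat; apply: leq_trans (size_scale_leq _ _) _.
  apply: leq_trans (size_polyMleq _ _) _; rewrite size_polyX.
  have lt : (i - 1 < i)%N by lia.
  by rewrite !addSn add0n /= ltnS leqW // IH.
rewrite size_polyN; case: ifP => i2; first by rewrite size_poly0.
have lt : (i - 2 < i)%N by lia.
by apply: leq_trans (IH _ lt) _; lia.
Qed.

Definition vap n (v : 'rV[K]_n.+1) (F : {poly {poly K}}) : {poly K} :=
  \sum_(i < n.+1) v 0 i *: F`_i.

Definition zpoly n e (M : 'M[K]_(n.+1, e)) : {poly {poly K}} :=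
  \sum_(j < n.+1) rVpoly (row j M) *: 'X^j.

Lemma coef_zpoly n e (M : 'M[K]_(n.+1, e)) (j : 'I_n.+1) : (zpoly M)`_j = rVpoly (row j M).
Proof.
rewrite coef_sum (bigD1 j) //= coefZ coefXn eqxx mulr1 big1 ?addr0 // => i /eqP ij.
by rewrite coefZ coefXn; case: eqP => [E|]; [case: ij; apply: val_inj | rewrite mulr0].
Qed.

Lemma size_zpoly n e (M : 'M[K]_(n.+1, e)) : (size (zpoly M) <= n.+1)%N.
Proof.
apply: leq_trans (size_sum _ _ _) _; apply/bigmax_leqP=> i _.
by apply: leq_trans (size_scale_leq _ _) _; rewrite size_polyXn.
Qed.

Lemma zpolyP n e (z : {poly {poly K}}) : (size z <= n.+1)%N -> (forall i, (size (z`_i)%R <= e)%N) ->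
  exists M : 'M[K]_(n.+1, e), z = zpoly M.
Proof.
move=> sz szi; exists (\matrix_(j, l) (z`_j)`_l); apply/polyP=> i.
have [lt | le] := ltnP i n.+1; last by rewrite !nth_default ?(leq_trans (size_zpoly _) le) ?(leq_trans sz le).
rewrite -[i]/(val (Ordinal lt)) coef_zpoly.
have -> : row (Ordinal lt) (\matrix_(j, l) (z`_j)`_l) = poly_rV z`_i :> 'rV_e.
  by apply/rowP=> l; rewrite !mxE.
by rewrite poly_rV_K.
Qed.

Lemma zpoly_is_linear n e : linear_for (fun a z => a%:P *: z) (@zpoly n e).
Proof.
move=> a M1 M2; rewrite /zpoly scaler_sumr -big_split; apply: eq_bigr => j _ /=.
by rewrite linearP /= linearP /= scalerDl -mul_polyC -scalerA.
Qed.

Lemma zpoly_sum n e r (c : 'I_r -> K) (M : 'I_r -> 'M[K]_(n.+1, e)) :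
  zpoly (\sum_i c i *: M i) = \sum_i (c i)%:P *: zpoly (M i).
Proof.
rewrite /zpoly; under [RHS]eq_bigr do rewrite scaler_sumr.
rewrite exchange_big; apply: eq_bigr => j _ /=.
rewrite linear_sum linear_sum scaler_suml; apply: eq_bigr => i _.
by rewrite linearZ /= linearZ /= -mul_polyC scalerA.
Qed.

Lemma zpoly_inj n e (M : 'M[K]_(n.+1, e)) : zpoly M = 0 -> M = 0.
Proof.
move=> z0; apply/row_matrixP=> j; rewrite row0; apply: (can_inj rVpolyK).
by rewrite -coef_zpoly z0 coef0 linear0.
Qed.

Lemma vap_sum n (v : 'rV[K]_n.+1) r (c : 'I_r -> {poly K}) (F : 'I_r -> {poly {poly K}}) :
  vap v (\sum_i c i *: F i) = \sum_i c i * vap v (F i).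
Proof.
rewrite /vap; under [RHS]eq_bigr do rewrite mulr_sumr.
rewrite exchange_big; apply: eq_bigr => j _ /=.
rewrite coef_sum scaler_sumr; apply: eq_bigr => i _.
by rewrite coefZ scalerAr.
Qed.

Lemma vapC n (v : 'rV[K]_n.+1) f : vap v (map_poly polyC f) = (pairing v f)%:P.
Proof.
rewrite /vap /pairing rmorph_sum; apply: eq_bigr => i _.
by rewrite coef_map /= polyCM mul_polyC.
Qed.

Lemma vap_Dsq n (v : 'rV[K]_n.+1) phi :
  vap v (map_poly polyC phi * Dsq) =
    (pairing v (phi * 'X^2))%:P - (pairing v (phi * 'X^1) *+ 2) *: 'X + pairing v (phi * 'X^0) *: 'X^2.
Proof.
have -> : map_poly polyC phi * Dsq =
    \sum_(i < 3) [:: 1; - ('X *+ 2); 'X^2]`_i *: map_poly polyC (phi * 'X^(2 - i)).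
  rewrite !big_ord_recl big_ord0 addr0 /= DsqE !rmorphM /= !map_polyXn expr0 mulr1 expr1.
  by rewrite /bump /= scale1r scaleNr -!mul_polyC polyCMn; ring.
rewrite vap_sum !big_ord_recl big_ord0 addr0 /= !vapC /bump /= mul1r addrA.
by rewrite -!mul_polyC polyCMn; ring.
Qed.

End Bivariate.

Section SyzygiesOfCurve.
Variable K : numClosedFieldType.
Variables (n m : nat) (p : 'I_m -> binary_form K n.+2) (L : {vspace binary_form K n.+2}).
Local Notation P j := (on_chart 0 (p j : {mpoly K[2]})).
Hypothesis P_indep : lin_indep (fun j => P j).
Hypothesis mem_L : forall v, v \in L <-> forall j, pairing (coords v) (P j) = 0.
Hypothesis P_span : forall f : {poly K}, (size f <= n.+3)%N ->
    (forall v, v \in L -> pairing (coords v) f = 0) -> exists c, f = \sum_j c j *: P j.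

Definition bivar (q : 'cV[{poly K}]_m) : {poly {poly K}} :=
  \sum_j q j 0 *: map_poly polyC (P j).

Lemma size_P j : (size (P j) <= n.+3)%N.
Proof. exact/size_on_chart/dhomog_is_dhomog. Qed.

Lemma size_bivar q : (size (bivar q) <= n.+3)%N.
Proof.
apply: leq_trans (size_sum _ _ _) _; apply/bigmax_leqP=> j _.
apply: leq_trans (size_scale_leq _ _) _.
by rewrite size_map_polyC size_P.
Qed.

Lemma bivar_inj q : bivar q = 0 -> q = 0.
Proof.
move=> F0; apply/colP=> j; rewrite mxE; apply/polyP=> l; rewrite coef0.
apply: (P_indep (c := fun j => (q j 0)`_l)); apply/polyP=> i; rewrite coef0.
have := congr1 (fun F : {poly {poly K}} => F`_i`_l) F0.
rewrite !coef0 coef_sum coef_sum => E; rewrite -[RHS]E coef_sum; apply: eq_bigr => a _.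
by rewrite !coefZ coef_map /= coefMC.
Qed.

Lemma bivar_sum r (c : 'I_r -> {poly K}) (q : 'I_r -> 'cV_m) :
  bivar (\sum_i c i *: q i) = \sum_i c i *: bivar (q i).
Proof.
rewrite /bivar; under [RHS]eq_bigr do rewrite scaler_sumr.
rewrite exchange_big; apply: eq_bigr => j _ /=.
by rewrite summxE scaler_suml; apply: eq_bigr => i _; rewrite mxE scalerA.
Qed.

Lemma vap_bivar v q : v \in L -> vap (coords v) (bivar q) = 0.
Proof.
move=> /mem_L vL; rewrite /bivar vap_sum big1 // => j _.
by rewrite vapC vL mulr0.
Qed.

Lemma Lam_mulE (q : 'cV_m) :
  Lam p 0 *m q = 0 <-> \sum_j q j 0 * P j = 0 /\ \sum_j q j 0 * (P j)^`() = 0.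
Proof.
have E1 : (Defs.lift p 0 *m q) = (\sum_j q j 0 * P j)%:M.
  apply/rowP=> i; rewrite ord1 !mxE eqxx mulr1n; apply: eq_bigr => j _.
  by rewrite !mxE mulrC.
have E2 : (velocity p 0 *m q) = (\sum_j q j 0 * (P j)^`())%:M.
  apply/rowP=> i; rewrite ord1 !mxE eqxx mulr1n; apply: eq_bigr => j _.
  by rewrite !mxE mulrC.
have S (x : {poly K}) : x%:M = 0 :> 'M_1 <-> x = 0.
  split=> [/rowP/(_ 0)|->]; first by rewrite !mxE eqxx mulr1n.
  by apply/rowP=> i; rewrite !mxE mul0rn.
rewrite /Lam mul_col_mx E1 E2; split=> [/eqP|[-> ->]]; last by rewrite raddf0 col_mx0.
by rewrite col_mx_eq0 => /andP [/eqP/S -> /eqP/S ->].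
Qed.

Lemma horner_bivar q : (bivar q).['X] = \sum_j q j 0 * P j.
Proof.
rewrite horner_sum; apply: eq_bigr => j _.
by rewrite hornerZ; have := comp_polyXr (P j); rewrite /comp_poly => ->.
Qed.

Lemma horner_deriv_bivar q : (bivar q)^`().['X] = \sum_j q j 0 * (P j)^`().
Proof.
rewrite /bivar (linear_sum (@deriv _)) horner_sum; apply: eq_bigr => j _.
by rewrite /= -mul_polyC derivM derivC mul0r add0r hornerM hornerC deriv_map; have := comp_polyXr (P j)^`(); rewrite /comp_poly => ->.
Qed.

Lemma double_root (F : {poly {poly K}}) : F.['X] = 0 -> F^`().['X] = 0 ->
  exists z, F = z * Dsq K.
Proof.
move=> /rootP/factor_theorem [F1 ->]; rewrite derivM hornerD !hornerM derivXsubC hornerC hornerXsubC.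
rewrite subrr mulr0 add0r mulr1 => /rootP/factor_theorem [z ->].
by exists z; rewrite -mulrA -expr2.
Qed.

Lemma syzygy_quotient e (q : 'cV_m) : Lam p 0 *m q = 0 -> (forall j, (size (q j 0%R) <= e.+2)%N) ->
  exists M : 'M_(n.+1, e), bivar q = zpoly M * Dsq K.
Proof.
move=> /Lam_mulE [q1 q2] sq.
have [z Fz] : exists z, bivar q = z * Dsq K.
  by apply: double_root; rewrite ?horner_bivar ?horner_deriv_bivar.
have sz : (size z <= n.+1)%N.
  have [->|z0] := eqVneq z 0; first by rewrite size_poly0.
  have := size_bivar q; rewrite Fz size_Mmonic ?Dsq_monic // size_Dsq addn3 /=.
  lia.
have szi i : (size (z`_i)%R <= e)%N.
  apply: size_mul_Dsq_coef => {}i; rewrite -Fz coef_sum.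
  apply: leq_trans (size_sum _ _ _) _; apply/bigmax_leqP=> j _.
  by rewrite coefZ coef_map /= mulrC mul_polyC (leq_trans (size_scale_leq _ _)).
have [M zM] := zpolyP sz szi; exists M.
by rewrite Fz -zM.
Qed.

Lemma syzygy_of_form (phi : {poly K}) : (size phi <= n.+1)%N ->
    (forall v j, v \in L -> (j < 3)%N -> pairing (coords v) (phi * 'X^j) = 0) ->
  exists q : 'cV_m, [/\ Lam p 0 *m q = 0, forall j, (size (q j 0%R) <= 3)%N
    & bivar q = map_poly polyC phi * Dsq K].
Proof.
move=> sphi Hphi.
have span j : (j < 3)%N -> exists c, phi * 'X^j = \sum_l c l *: P l.
  move=> j3; apply: P_span => [|v vL]; last exact: Hphi.
  apply: leq_trans (size_polyMleq _ _) _; rewrite size_polyXn; lia.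
have [c0 E0] := span 0%N isT; have [c1 E1] := span 1%N isT; have [c2 E2] := span 2%N isT.
pose q : 'cV[{poly K}]_m := \col_l ((c2 l)%:P - (c1 l *+ 2) *: 'X + c0 l *: 'X^2).
have Fq : bivar q = map_poly polyC phi * Dsq K.
  have -> : map_poly polyC phi * Dsq K = map_poly polyC (phi * 'X^2)
      - ('X *+ 2) *: map_poly polyC (phi * 'X^1) + 'X^2 *: map_poly polyC (phi * 'X^0).
    rewrite DsqE !rmorphM /= !map_polyXn expr0 mulr1 expr1 -!mul_polyC; ring.
  rewrite E0 E1 E2 /bivar !rmorph_sum !scaler_sumr -sumrB -big_split; apply: eq_bigr => l _ /=.
  rewrite mxE !map_polyZ /= -!mul_polyC !(polyCD, polyCN, polyCM, polyCMn); ring.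
exists q; split=> //.
  apply/Lam_mulE; rewrite -horner_bivar -horner_deriv_bivar Fq.
  by rewrite /Dsq expr2 !derivM !derivXsubC !(hornerXsubC, hornerM, hornerC, hornerD) subrr; split; ring.
move=> j; rewrite mxE.
have X2 a b : (a <= 3)%N -> (b <= 3)%N -> (maxn a b <= 3)%N by rewrite geq_max => -> ->.
apply: leq_trans (size_polyD _ _) (X2 _ _ _ _); last first.
  by apply: leq_trans (size_scale_leq _ _) _; rewrite size_polyXn.
apply: leq_trans (size_polyD _ _) (X2 _ _ _ _).
  by apply: leq_trans (size_polyC_leq1 _) _.
by rewrite size_polyN; apply: leq_trans (size_scale_leq _ _) _; rewrite size_polyX.
Qed.

End SyzygiesOfCurve.

Section Counting.
Variable K : numClosedFieldType.
Variables (n m : nat) (p : 'I_m -> binary_form K n.+2) (L : {vspace binary_form K n.+2}).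
Local Notation P j := (on_chart 0 (p j : {mpoly K[2]})).
Hypothesis P_indep : lin_indep (fun j => P j).
Hypothesis mem_L : forall v, v \in L <-> forall j, pairing (coords v) (P j) = 0.
Hypothesis P_span : forall f : {poly K}, (size f <= n.+3)%N ->
    (forall v, v \in L -> pairing (coords v) f = 0) -> exists c, f = \sum_j c j *: P j.
Variables (N : nat) (d : 'I_N -> nat) (Q : 'M[{poly K}]_(m, N)).
Hypothesis Qbasis : syzygy_basis p d Q.

Lemma syzygy_basis_inj (w : 'cV[{poly K}]_N) : Q *m w = 0 -> w = 0.
Proof.
have [_ sQ lQ _] := Qbasis; move=> Qw0; apply/colP=> i; rewrite mxE.
apply/eqP/negPn/negP=> wi.
have := @predictable_degree _ _ _ d Q w 0 sQ lQ _ i wi.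
have szi : (0 < size (w i 0%R))%N by rewrite size_poly_gt0.
rewrite leqn0 addn_eq0 [X in _ && X]eqn0Ngt szi andbF => H; apply: notF; apply: H => a.
by rewrite Qw0 mxE size_poly0.
Qed.

Lemma Lam_col i : Lam p 0 *m col i Q = 0.
Proof. by have [LQ _ _ _] := Qbasis; rewrite colE mulmxA LQ mul0mx. Qed.

Lemma syzygy_degree_ge2 i : (2 <= d i)%N.
Proof.
have [_ sQ lQ _] := Qbasis; rewrite leqNgt; apply/negP=> di.
have [|M FM] := @syzygy_quotient K n m p 0 (col i Q) (Lam_col i).
  by move=> j; rewrite mxE; apply: leq_trans (sQ j i) _.
have M0 : M = 0 by apply/matrixP=> a [].
have q0 : col i Q = 0.
  apply: (bivar_inj P_indep); rewrite FM M0.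
  have -> : zpoly (0 : 'M[K]_(n.+1, 0)) = 0; last by rewrite mul0r.
  by apply: big1 => j _; rewrite row0 linear0 scale0r.
have : lead_mx d Q *m (delta_mx i 0 : 'cV_N) = 0.
  rewrite -(colE i (lead_mx d Q)); apply/colP=> j; rewrite !mxE; move/colP/(_ j): q0; rewrite !mxE => ->.
  by rewrite coef0.
by move/lQ/colP/(_ i); rewrite !mxE !eqxx => /eqP; rewrite oner_eq0.
Qed.

Lemma quotient_vectors e : exists Y : 'M[K]_(\sum_i (e - (d i - 2)), n.+1 * e), row_free Y /\
  forall v a, v \in L -> vap (coords v) (zpoly (vec_mx (row a Y)) * Dsq K) = 0.
Proof.
have [_ sQ lQ _] := Qbasis.
pose S := [set x : 'I_N * 'I_e | (x.2 + (d x.1 - 2) < e)%N].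
have cS : #|S| = (\sum_i (e - (d i - 2)))%N.
  rewrite cardsE -sum1_card.
  rewrite (eq_bigl (fun x : 'I_N * 'I_e => true && (x.2 + (d x.1 - 2) < e)%N)) //.
  rewrite -(pair_big_dep xpredT (fun i (c : 'I_e) => (c + (d i - 2) < e)%N) (fun _ _ => 1%N)) /=.
  apply: eq_bigr => i _; rewrite sum1_card.
  have le : (e - (d i - 2) <= e)%N by rewrite leq_subr.
  rewrite -[RHS]card_ord -(card_image (f := widen_ord le)); last by move=> a b /(congr1 val) /= /val_inj.
  apply: eq_card => c; apply/idP/imageP => [lt|[a _ ->]].
    have lt' : (c < e - (d i - 2))%N by move: lt; rewrite unfold_in; lia.
    by exists (Ordinal lt') => //; apply: val_inj.
  by rewrite unfold_in /=; have := ltn_ord a; lia.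
rewrite -cS; pose q (x : 'I_N * 'I_e) : 'cV[{poly K}]_m := 'X^(x.2) *: col x.1 Q.
have Mex (a : 'I_#|S|) : exists M : 'M_(n.+1, e), bivar p (q (enum_val a)) = zpoly M * Dsq K.
  apply: syzygy_quotient; first by rewrite -scalemxAr Lam_col scaler0.
  move=> j; rewrite mxE; have := enum_valP a; rewrite inE; set x := enum_val a => lt.
  have := syzygy_degree_ge2 x.1; have := sQ j x.1; rewrite !mxE => s1 d2.
  apply: leq_trans (size_polyMleq _ _) _; rewrite size_polyXn.
  by move: lt s1 d2; move: (size _) (d _) (nat_of_ord _) => sz dd cc; lia.
have [M HM] := boolp.choice Mex.
exists (\matrix_a mxvec (M a)); split=> [|v a vL]; last first.
  by rewrite rowK mxvecK -HM; apply: vap_bivar.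
rewrite -kermx_eq0; apply/rowV0P=> c /sub_kermxP cY; apply/rowP=> a0; rewrite mxE.
pose w : 'cV[{poly K}]_N := \col_i \sum_(a | (enum_val a : 'I_N * 'I_e).1 == i) c 0 a *: 'X^((enum_val a : 'I_N * 'I_e).2).
have Qw : Q *m w = \sum_a (c 0 a)%:P *: q (enum_val a).
  rewrite mulmx_col_sum.
  under eq_bigr => i _ do rewrite mxE scaler_suml.
  rewrite (exchange_big_dep xpredT) //=; apply: eq_bigr => a _.
  rewrite (big_pred1 (enum_val a).1) => [|i]; last by rewrite eq_sym.
  by rewrite /q scalerA mul_polyC.
have w0 : w = 0.
  apply: syzygy_basis_inj; rewrite Qw; apply: (bivar_inj P_indep); rewrite bivar_sum.
  under eq_bigr => a _ do rewrite HM scalerAl.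
  rewrite -mulr_suml -zpoly_sum.
  have -> : \sum_a c 0 a *: M a = 0.
    apply: (can_inj mxvecK); rewrite linear0 -[RHS]cY mulmx_sum_row linear_sum.
    by apply: eq_bigr => a _; rewrite rowK linearZ.
  have -> : zpoly (0 : 'M[K]_(n.+1, e)) = 0; last by rewrite mul0r.
  by apply: big1 => j _; rewrite row0 linear0 scale0r.
move/colP/(_ (enum_val a0 : 'I_N * 'I_e).1): w0; rewrite !mxE => /polyP/(_ (enum_val a0 : 'I_N * 'I_e).2).
rewrite coef0 coef_sum (bigD1 a0) //= coefZ coefXn eqxx mulr1 big1 ?addr0 // => a /andP [/eqP e1 na].
rewrite coefZ coefXn; case: eqP => [e2|]; last by rewrite mulr0.
case/eqP: na; apply: enum_val_inj; move: e1 (val_inj e2).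
by case: (enum_val a) (enum_val a0) => [? ?] [? ?] /= -> ->.
Qed.

Definition form_family r (phi : 'I_r -> {poly K}) := [/\ lin_indep phi, forall i, (size (phi i) <= n.+1)%N
    & forall v i j, v \in L -> (j < 3)%N -> pairing (coords v) (phi i * 'X^j) = 0].

Lemma family_le r (phi : 'I_r -> {poly K}) : form_family phi -> (r <= #|[set i | d i == 2]|)%N.
Proof.
case=> iphi sphi Hphi; have [_ sQ lQ kQ] := Qbasis.
have qex a : exists w : 'cV[{poly K}]_N, (forall i, d i != 2 -> w i 0 = 0) /\ (forall i, (size (w i 0%R) <= 1)%N) /\
    bivar p (Q *m w) = map_poly polyC (phi a) * Dsq K.
  have [q [Lq sq Fq]] := syzygy_of_form P_span (sphi a) (fun v j => Hphi v a j).
  have [w Ew] := kQ _ Lq; exists w; rewrite -Ew; split; last split=> //.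
    move=> i di; apply/eqP/negPn/negP=> wi.
    have := @predictable_degree _ _ _ d Q w 3 sQ lQ _ i wi; rewrite -Ew => /(_ sq).
    have szi : (0 < size (w i 0%R))%N by rewrite size_poly_gt0.
    have d2 := syzygy_degree_ge2 i => H.
    have : (d i + 0 < 3)%N by apply: leq_trans H; rewrite ltn_add2l.
    by rewrite addn0 ltnS leq_eqVlt (negbTE di) ltnNge d2.
  move=> i; have [->|wi] := eqVneq (w i 0) 0; first by rewrite size_poly0.
  have := @predictable_degree _ _ _ d Q w 3 sQ lQ _ i wi; rewrite -Ew => /(_ sq) H.
  have : (2 + size (w i 0%R) <= 2 + 1)%N by apply: leq_trans H; rewrite leq_add2r syzygy_degree_ge2.
  by rewrite leq_add2l.
have [w Hw] := boolp.choice qex.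
pose S := [set i | d i == 2].
pose W : 'M[K]_(r, #|S|) := \matrix_(a, b) (w a (enum_val b) 0)`_0.
suff /eqP <- : row_free W by apply: rank_leq_col.
rewrite -kermx_eq0; apply/rowV0P=> c /sub_kermxP cW; apply/rowP=> a; rewrite mxE.
apply: (iphi (fun a => c 0 a)) a.
have cw : \sum_a (c 0 a)%:P *: w a = 0.
  apply/colP=> i; rewrite summxE mxE; have [di|di] := boolP (i \in S); last first.
    by apply: big1 => a _; rewrite mxE (Hw a).1 ?mulr0 //; rewrite inE in di.
  have : (c *m W) 0 (enum_rank_in di i) = 0 by rewrite cW mxE.
  rewrite mxE => E.
  transitivity ((\sum_a c 0 a * W a (enum_rank_in di i))%:P); last by rewrite E.
  rewrite rmorph_sum; apply: eq_bigr => a _.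
  rewrite /= !mxE enum_rankK_in // polyCM; congr (_ * _).
  by apply: size1_polyC; apply: (Hw a).2.1.
have D0 : Dsq K != 0 by apply: monic_neq0; apply: Dsq_monic.
have : map_poly polyC (\sum_a c 0 a *: phi a) * Dsq K = 0.
  rewrite rmorph_sum mulr_suml.
  transitivity (bivar p (Q *m \sum_a (c 0 a)%:P *: w a)); last by rewrite cw mulmx0 /bivar big1 // => j _; rewrite mxE scale0r.
  rewrite mulmx_sumr; under [in RHS]eq_bigr => a _ do rewrite -scalemxAr.
  rewrite bivar_sum; apply: eq_bigr => a _.
  by rewrite /= (Hw a).2.2 map_polyZ scalerAl.
by move/eqP; rewrite mulf_eq0 (negbTE D0) orbF => /eqP E; apply: (map_inj_poly (@polyC_inj K) (polyC0 K)); rewrite E rmorph0.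
Qed.

Lemma family_exists : exists phi : 'I_(#|[set i | d i == 2]|) -> {poly K}, form_family phi.
Proof.
have [_ sQ lQ kQ] := Qbasis; pose S := [set i | d i == 2].
have Mex (a : 'I_#|S|) : exists phi : {poly K}, (size phi <= n.+1)%N /\
    bivar p (col (enum_val a) Q) = map_poly polyC phi * Dsq K.
  have [|M FM] := @syzygy_quotient K n m p 1 (col (enum_val a) Q) (Lam_col _).
    move=> j; rewrite mxE; apply: leq_trans (sQ _ _) _.
    by have := enum_valP a; rewrite inE => /eqP ->.
  exists (\poly_(j < n.+1) M (inord j) 0); rewrite size_poly; split=> //.
  rewrite FM; congr (_ * _); rewrite poly_def rmorph_sum; apply: eq_bigr => j _.
  rewrite /= inord_val map_polyZ map_polyXn; congr (_ *: _).
  apply/polyP=> i; rewrite coefC coef_rVpoly; case: insubP => [[a' la] _ /= <-|].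
    by rewrite mxE; case: a' la => // la; congr (M _ _); apply: val_inj.
  by case: i.
have [phi Hphi] := boolp.choice Mex; exists phi; split=> [c E a|a|v a j vL j3].
- pose x : 'cV[K]_N := \col_i \sum_(a | enum_val a == i) c a.
  have Qx : Q *m map_mx polyC x = \sum_a (c a)%:P *: col (enum_val a) Q.
    rewrite mulmx_col_sum; under eq_bigr => i _ do rewrite !mxE rmorph_sum scaler_suml.
    rewrite (exchange_big_dep xpredT) //=; apply: eq_bigr => b _.
    by rewrite (big_pred1 (enum_val b)) => [|i]; last by rewrite eq_sym.
  have : map_mx polyC x = 0.
    apply: syzygy_basis_inj; rewrite Qx; apply: (bivar_inj P_indep); rewrite bivar_sum.
    transitivity (map_poly polyC (\sum_a c a *: phi a) * Dsq K); last by rewrite E rmorph0 mul0r.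
    rewrite rmorph_sum mulr_suml; apply: eq_bigr => b _.
    by rewrite /= (Hphi b).2 map_polyZ scalerAl.
  move/colP/(_ (enum_val a)); rewrite !mxE => /polyC_inj.
  by rewrite (big_pred1 a) // => b; rewrite (inj_eq enum_val_inj).
- exact: (Hphi a).1.
have := vap_bivar mem_L (col (enum_val a) Q) vL; rewrite (Hphi a).2 vap_Dsq => E.
have := congr1 (fun g : {poly K} => g`_0) E; have := congr1 (fun g : {poly K} => g`_1) E.
have := congr1 (fun g : {poly K} => g`_2) E.
rewrite !(coefD, coefN, coefC, coefZ, coefX, coefXn, coef0) /= !(mulr0, mulr1, addr0, subr0, add0r, oppr0, sub0r).
move=> E2 E1 E0.
have {}E1 : pairing (coords v) (phi a * 'X^1) = 0.
  by move/eqP: E1; rewrite oppr_eq0 mulrn_eq0 => /eqP.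
by move: j3; case: j => [|[|[|j]]] j3; rewrite ?expr0 ?mulr1.
Qed.

End Counting.

Section Equivalence.
Variable K : numClosedFieldType.
Variables (n k N : nat) (p : 'I_(2 + N) -> binary_form K n.+2) (L : {vspace binary_form K n.+2}).
Variable pi : 'Hom(binary_form K n.+2, 'rV[K]_(2 + N)).
Hypothesis kN : (k + N = n.+1)%N.
Hypothesis dimL : \dim L = k.
Hypothesis missL : misses_rnc L.
Hypothesis Lp : projection_from L pi p.
Hypothesis ord : ordinary_singularities p.

Let P_indep : lin_indep (fun j => on_chart 0 (p j : {mpoly K[2]})).
Proof. by have [] := centre_forms Lp dimL (_ : (k + (2 + N) = n.+3)%N); first lia. Qed.

Let P_span : forall f : {poly K}, (size f <= n.+3)%N ->
    (forall v, v \in L -> pairing (coords v) f = 0) -> exists c, f = \sum_j c j *: on_chart 0 (p j : {mpoly K[2]}).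
Proof. by have [] := centre_forms Lp dimL (_ : (k + (2 + N) = n.+3)%N); first lia. Qed.

Lemma base_locus_count N' (d : 'I_N' -> nat) : bundle_iso p (fun i => (n.+2 + d i)%:Z) ->
  [/\ forall i, (2 <= d i)%N,
      forall s, in_base_locus_of_some_system s L -> (s <= #|[set i | d i == 2]|)%N,
      in_base_locus_of_some_system #|[set i | d i == 2]| L
    & forall e, exists Y : 'M[K]_(\sum_i (e - (d i - 2)), n.+1 * e), row_free Y /\
        forall v a, v \in L -> vap (coords v) (zpoly (vec_mx (row a Y)) * Dsq K) = 0].
Proof.
move=> iso; have [Q bQ] := syzygy_basis_of_iso iso.
split.
- exact: (syzygy_degree_ge2 P_indep bQ).
- move=> s /base_locusP [] // phi Hphi.
  exact: (family_le P_indep P_span bQ (phi := phi)).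
- have [phi Hphi] := family_exists P_indep (mem_centre Lp) bQ.
  by apply/base_locusP=> //; exists phi.
exact: (quotient_vectors P_indep (mem_centre Lp) bQ).
Qed.

Lemma curve_splits : exists d : 'I_N -> nat,
  bundle_iso p (fun i => (n.+2 + d i)%:Z) /\ (\sum_i d i = n.+1.*2)%N.
Proof. exact/normal_bundle_splits/(Lam_row_free Lp missL ord). Qed.

Lemma normal_bundle_isoP (d : 'I_N -> nat) (s : seq int) :
    perm_eq [seq (n.+2 + d i)%:Z | i <- enum 'I_N] s ->
  bundle_iso p (fun i => (n.+2 + d i)%:Z) -> normal_bundle_iso p s.
Proof.
move=> ps iso; apply: normal_bundle_iso_perm_eq ps _.
have sz : size [seq (n.+2 + d i)%:Z | i <- enum 'I_N] = N by rewrite size_map size_enum_ord.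
apply/(normal_bundle_isoE p sz); move: iso; congr bundle_iso; apply: boolp.funext => i.
by rewrite (nth_map i) ?size_enum_ord // nth_ord_enum.
Qed.

Lemma count_degree2 (d : 'I_N -> nat) :
  count_mem (n.+2%:Z + 2) [seq (n.+2 + d i)%:Z | i <- enum 'I_N] = #|[set i | d i == 2]|.
Proof.
rewrite count_map -sum1_count big_enum_cond -sum1_card; apply: eq_bigl => i /=.
by rewrite inE; lia.
Qed.

Lemma splitting_iff_base_locus rho :
  (exists l : seq int,
     [/\ size l = (N - rho)%N, all (fun d : int => n.+2%:Z + 3 <= d) l,
         degree_bundle (twist_bundle (n.+2%:Z + 2) (dual_bundle l)) = - (2 * k)%:Z
       & normal_bundle_iso p (nseq rho (n.+2%:Z + 2) ++ l)])
  <->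
  (in_base_locus_of_some_system rho L /\
   forall s, in_base_locus_of_some_system s L -> (s <= rho)%N).
Proof.
split=> [[l [_ ll _ iso]] | [H1 H2]].
  set a := _ ++ l in iso; pose d (i : 'I_(size a)) := absz (a`_i - n.+2%:Z)%R.
  have alla : all (fun x : int => n.+2%:Z + 2 <= x) a.
    rewrite all_cat; apply/andP; split; first by rewrite all_nseq lexx orbT.
    by apply: sub_all ll => x; lia.
  have aE : (fun i : 'I_(size a) => a`_i) = (fun i => (n.+2 + d i)%:Z).
    apply: boolp.funext => i; have ge : n.+2%:Z + 2 <= a`_i := allP alla _ (mem_nth _ (ltn_ord i)).
    rewrite PoszD /d gez0_abs; first by rewrite addrCA subrr addr0.
    by rewrite subr_ge0; apply: le_trans ge; rewrite lerDl.
  move/(normal_bundle_isoE p erefl): iso; rewrite aE => iso.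
  have [_ max sys _] := base_locus_count iso.
  suff <- : #|[set i | d i == 2]| = rho by [].
  have -> : #|[set i | d i == 2]| = count_mem (n.+2%:Z + 2) a.
    rewrite -[a in RHS](mkseq_nth 0) /mkseq -val_enum_ord -map_comp count_map.
    rewrite -sum1_count big_enum_cond -sum1_card; apply: eq_bigl => i /=.
    by have /boolp.funeqP/(_ i) -> := aE; rewrite inE; lia.
  rewrite count_cat count_nseq /= eqxx mul1n [X in (_ + X)%N](_ : _ = 0%N) ?addn0 //.
  apply/eqP; rewrite -leqn0 leqNgt -has_count; apply/hasPn=> x /(allP ll) /=; lia.
have [d [iso sumd]] := curve_splits.
have [d2 max sys _] := base_locus_count iso.
have cd : #|[set i | d i == 2]| = rho by apply/eqP; rewrite eqn_leq H2 // max.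
pose a := [seq (n.+2 + d i)%:Z | i <- enum 'I_N]; pose l := [seq x <- a | x != n.+2%:Z + 2].
have pa : perm_eq a (nseq rho (n.+2%:Z + 2) ++ l).
  have -> : nseq rho (n.+2%:Z + 2) = [seq x <- a | x == n.+2%:Z + 2].
    have /all_pred1P -> : all (pred1 (n.+2%:Z + 2)) [seq x <- a | x == n.+2%:Z + 2] by apply: filter_all.
    by rewrite size_filter count_degree2 cd.
  by rewrite perm_sym; apply: permEl (perm_filterC _ _).
exists l; split; last exact: normal_bundle_isoP pa iso.
- by have := perm_size pa; rewrite size_cat size_nseq size_map size_enum_ord => ->; rewrite addKn.
- apply/allP=> x; rewrite mem_filter => /andP [x2 /mapP [i _ xE]].
  by have := d2 i; move: x2; rewrite xE; lia.
have degE : degree_bundle (twist_bundle (n.+2%:Z + 2) (dual_bundle l)) = \sum_(x <- l) (n.+2%:Z + 2 - x).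
  by rewrite /degree_bundle /twist_bundle /dual_bundle -map_comp big_map; apply: eq_bigr => x _ /=; lia.
have : \sum_(x <- a) (n.+2%:Z + 2 - x) = \sum_(x <- l) (n.+2%:Z + 2 - x).
  rewrite (perm_big _ pa) big_cat /= big_nseq.
  rewrite [X in X + _](_ : _ = 0) ?add0r //; elim: rho {H1 H2 cd pa} => //= r ->; rewrite subrr //.
rewrite -degE => <-; rewrite big_map big_enum /=.
have -> : \sum_(i in 'I_N) (n.+2%:Z + 2 - (n.+2 + d i)%:Z) = \sum_(i < N) (2 - (d i)%:Z).
  by apply: eq_bigr => i _; lia.
rewrite sumrB sumr_const card_ord -(big_morph Posz PoszD erefl) sumd; lia.
Qed.

End Equivalence.

(** * Zariski density along polynomial paths *)

Section PolynomialFunctions.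
Variables (K : fieldType) (D : nat).
Implicit Types f g : ('I_D -> K) -> K.

Definition poly_fun f := exists P : {mpoly K[D]}, forall x, f x = P.@[x].

Lemma poly_fun_const c : poly_fun (fun=> c).
Proof. by exists c%:MP => x; rewrite mevalC. Qed.

Lemma poly_fun_coord i : poly_fun (fun x => x i).
Proof. by exists 'X_i => x; rewrite mevalXU. Qed.

Lemma poly_funD f g : poly_fun f -> poly_fun g -> poly_fun (fun x => f x + g x).
Proof. by move=> [P fP] [Q gQ]; exists (P + Q) => x; rewrite mevalD fP gQ. Qed.

Lemma poly_funM f g : poly_fun f -> poly_fun g -> poly_fun (fun x => f x * g x).
Proof. by move=> [P fP] [Q gQ]; exists (P * Q) => x; rewrite mevalM fP gQ. Qed.

Lemma poly_fun_sum (I : Type) (r : seq I) (F : I -> ('I_D -> K) -> K) :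
  (forall i, poly_fun (F i)) -> poly_fun (fun x => \sum_(i <- r) F i x).
Proof.
move=> H; elim: r => [|i r IH].
  by exists 0 => x; rewrite big_nil meval0.
have [P HP] := poly_funD (H i) IH; exists P => x; rewrite big_cons; exact: HP.
Qed.

Lemma poly_fun_prod (I : Type) (r : seq I) (F : I -> ('I_D -> K) -> K) :
  (forall i, poly_fun (F i)) -> poly_fun (fun x => \prod_(i <- r) F i x).
Proof.
move=> H; elim: r => [|i r IH].
  by exists 1 => x; rewrite big_nil meval1.
have [P HP] := poly_funM (H i) IH; exists P => x; rewrite big_cons; exact: HP.
Qed.

Lemma poly_fun_det n (M : ('I_D -> K) -> 'M[K]_n) :
  (forall i j, poly_fun (fun x => M x i j)) -> poly_fun (fun x => \det (M x)).
Proof.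
move=> H; apply: poly_fun_sum => s; apply: poly_funM; first exact: poly_fun_const.
by apply: poly_fun_prod.
Qed.

Lemma poly_fun_mulmx m n l (M : ('I_D -> K) -> 'M[K]_(m, n)) (N : ('I_D -> K) -> 'M[K]_(n, l)) :
  (forall i j, poly_fun (fun x => M x i j)) -> (forall i j, poly_fun (fun x => N x i j)) ->
  forall i j, poly_fun (fun x => (M x *m N x) i j).
Proof.
move=> HM HN i j; have [P HP] : poly_fun (fun x => \sum_e M x i e * N x e j).
  by apply: poly_fun_sum => e; apply: poly_funM.
by exists P => x; rewrite mxE HP.
Qed.

End PolynomialFunctions.

Lemma rank_geP (K : fieldType) m n r (A : 'M[K]_(m, n)) : (r <= \rank A)%N ->
  exists (U : 'M_(r, m)) (W : 'M_(n, r)), U *m A *m W = 1%:M.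
Proof.
move=> rA; exists (pid_mx r *m invmx (col_ebase A)), (invmx (row_ebase A) *m pid_mx r).
rewrite -{2}(mulmx_ebase A) !mulmxA mulmxKV ?col_ebase_unit //.
rewrite mulmxK ?row_ebase_unit // !mul_pid_mx.
have rm := leq_trans rA (rank_leq_row A); have rn := leq_trans rA (rank_leq_col A).
rewrite [minn _ _](_ : _ = r) ?pid_mx_1 //; lia.
Qed.

Lemma rank_ge_det (K : fieldType) m n r (A : 'M[K]_(m, n)) (U : 'M_(r, m)) (W : 'M_(n, r)) :
  \det (U *m A *m W) != 0 -> (r <= \rank A)%N.
Proof.
move=> d; have /mxrank_unit <- : U *m A *m W \in unitmx by rewrite unitmxE unitfE.
by apply: leq_trans (mxrankM_maxl _ _) (mxrankM_maxr _ _).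
Qed.

Section Zariski.
Variables (K : closedFieldType) (vT : vectType K) (k : nat).
Implicit Types (Z X : {vspace vT} -> Prop) (b : k.-tuple vT).

Lemma zariski_closed_of_open Z :
    (forall b, free b -> ~ Z <<b>>%VS -> exists2 P : {mpoly K[k * \dim {:vT}]},
       P.@[tuple_coords b] != 0 & forall b', free b' -> P.@[tuple_coords b'] != 0 -> ~ Z <<b'>>%VS) ->
  zariski_closed k Z.
Proof.
move=> H; exists (fun P => forall b, free b -> Z <<b>>%VS -> P.@[tuple_coords b] = 0) => b fb.
split=> [Zb P HP | HP]; first exact: HP.
have [//|nZ] := boolp.EM (Z <<b>>%VS); have [P Pb HPb] := H b fb nZ.
case/eqP: Pb; apply: HP => b' fb' Zb'; apply/eqP/negPn/negP=> nP.
exact: HPb fb' nP Zb'.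
Qed.

Lemma meval_path D (x : 'I_D -> {poly K}) (P : {mpoly K[D]}) s :
  (mmap (@polyC K) x P).[s] = P.@[fun l => (x l).[s]].
Proof.
rewrite /mmap horner_sum mevalE; apply: eq_bigr => m _.
rewrite hornerM hornerC; congr (_ * _); rewrite /mmap1 horner_prod.
by apply: eq_bigr => i _; rewrite horner_exp.
Qed.

(* A closed set that contains all but finitely many members of a polynomial family contains every
   independent member of it. *)
Lemma dense_of_path X Z :
    (forall L, \dim L = k -> X L ->
       exists (b : K -> k.-tuple vT) (x : 'I_(k * \dim {:vT}) -> {poly K}) (pi : {poly K}),
         [/\ forall s l, tuple_coords (b s) l = (x l).[s], free (b 0), <<b 0%R>>%VS = L, pi != 0
           & forall s, pi.[s] != 0 -> [/\ free (b s), X <<b s>>%VS & ~ Z <<b s>>%VS]]) ->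
  forall Z', zariski_closed k Z' -> (forall L, \dim L = k -> X L -> ~ Z L -> Z' L) ->
  forall L, \dim L = k -> X L -> Z' L.
Proof.
move=> path Z' [I HI] sub L dL XL; have [b [x [pi [bx fb0 <- pi0 Hpi]]]] := path L dL XL.
apply/(HI _ fb0) => P IP.
have : mmap (@polyC K) x P * pi = 0.
  apply/eqP/negPn/negP=> /closed_nonrootP [s]; rewrite rootE hornerM mulf_eq0 => /norP [Ps pis].
  have [fbs Xs nZs] := Hpi s pis.
  have : Z' <<b s>>%VS by apply: sub => //; have /eqP := fbs; rewrite size_tuple.
  move/(HI _ fbs)/(_ P IP) => P0; case/eqP: Ps; rewrite meval_path -P0.
  by apply: meval_eq => l; rewrite bx.
move/eqP; rewrite mulf_eq0 (negbTE pi0) orbF => /eqP P0.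
rewrite (@meval_eq _ _ _ (fun l => (x l).[0])) => [|l]; last exact: bx.
by rewrite -meval_path P0 horner0.
Qed.

End Zariski.

Section SyzygyRank.
Variable K : numClosedFieldType.
Variables (n k : nat).
Local Notation form := (binary_form K n.+2).

(* The rows of [Y] encode z(t, y) of degree less than [e] in t such that (y - t)^2 z comes from a
   syzygy of the curve projected from [L]. *)
Definition many_quotients e T (L : {vspace form}) : Prop :=
  exists r (Y : 'M[K]_(r, n.+1 * e)), [/\ row_free Y, (T < r)%N
    & forall v a, v \in L -> vap (coords v) (zpoly (vec_mx (row a Y)) * Dsq K) = 0].

Lemma vapDl m a (u v : 'rV[K]_m.+1) F : vap (a *: u + v) F = a *: vap u F + vap v F.
Proof.
rewrite /vap scaler_sumr -big_split; apply: eq_bigr => i _ /=.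
by rewrite !mxE scalerDl scalerA.
Qed.

Lemma vap0l m F : vap (0 : 'rV[K]_m.+1) F = 0.
Proof. by apply: big1 => i _; rewrite mxE scale0r. Qed.

Lemma size_vap e (v : 'rV[K]_n.+3) (M : 'M[K]_(n.+1, e)) :
  (size (vap v (zpoly M * Dsq K)) <= e.+2)%N.
Proof.
have szz i : (size ((zpoly M)`_i)%R <= e)%N.
  have [lt|le] := ltnP i n.+1; last by rewrite nth_default ?size_poly0 ?(leq_trans (size_zpoly _) le).
  by rewrite -[i]/(val (Ordinal lt)) coef_zpoly size_poly.
apply: leq_trans (size_sum _ _ _) _; apply/bigmax_leqP=> i _.
apply: leq_trans (size_scale_leq _ _) _; rewrite coef_mul_Dsq.
have mx3 a b : (a <= e.+2)%N -> (b <= e.+2)%N -> (maxn a b <= e.+2)%N by rewrite geq_max => -> ->.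
apply: leq_trans (size_polyD _ _) (mx3 _ _ _ _); last first.
  by apply: leq_trans (size_polyMleq _ _) _; rewrite size_polyXn /= add2n !ltnS.
apply: leq_trans (size_polyD _ _) (mx3 _ _ _ _).
  by case: ifP => _; rewrite ?size_poly0 // ltnW // ltnW // !ltnS.
rewrite size_polyN; case: ifP => _; first by rewrite mulr0 size_poly0.
rewrite mulrnAl -scaler_nat; apply: leq_trans (size_scale_leq _ _) _.
by apply: leq_trans (size_polyMleq _ _) _; rewrite size_polyX /= add1n ltnS ltnW // ltnS.
Qed.

Definition syz_map e (V : 'M[K]_(k, n.+3)) (M : 'M[K]_(n.+1, e)) : 'M[K]_(k, e.+2) :=
  \matrix_(r, t) (vap (row r V) (zpoly M * Dsq K))`_t.

Lemma syz_map_is_linear e V : linear (@syz_map e V).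
Proof.
move=> a M1 M2; apply/matrixP=> r t; rewrite !mxE -coefZ -coefD; congr (_`_t).
have := zpoly_sum (fun i : 'I_2 => if i == 0 then a else 1) (fun i => if i == 0 then M1 else M2).
rewrite !big_ord_recl !big_ord0 !addr0 /= scale1r => ->.
rewrite mulrDl -!scalerAl; have := vap_sum (row r V) (fun i : 'I_2 => if i == 0 then a%:P else 1%:P)
  (fun i => if i == 0 then zpoly M1 * Dsq K else zpoly M2 * Dsq K).
by rewrite !big_ord_recl !big_ord0 !addr0 /= => ->; rewrite mul1r mul_polyC.
Qed.
HB.instance Definition _ e V := GRing.isLinear.Build K 'M[K]_(n.+1, e) 'M[K]_(k, e.+2) _
  (@syz_map e V) (@syz_map_is_linear e V).

Lemma syz_map_eq0 e V (M : 'M[K]_(n.+1, e)) :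
  syz_map V M = 0 <-> forall r, vap (row r V) (zpoly M * Dsq K) = 0.
Proof.
split=> [E r | H]; last by apply/matrixP=> r t; rewrite !mxE H coef0.
apply/polyP=> t; rewrite coef0; have [lt | le] := ltnP t e.+2.
  by move/matrixP/(_ r (Ordinal lt)): E; rewrite !mxE.
by rewrite nth_default // (leq_trans (size_vap _ _)).
Qed.

Definition tuple_mx (b : k.-tuple form) : 'M[K]_(k, n.+3) := \matrix_i coords (tnth b i).

Lemma many_quotientsP e T (b : k.-tuple form) :
  many_quotients e T <<b>>%VS <-> (\rank (lin_mx (@syz_map e (tuple_mx b))) < n.+1 * e - T)%N.
Proof.
set S := lin_mx _; split=> [[r [Y [fY Tr HY]]] | lt].
  have YS : Y *m S = 0.
    apply/row_matrixP=> a; rewrite row_mul row0 mul_rV_lin /=.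
    suff -> : syz_map (tuple_mx b) (vec_mx (row a Y)) = 0 by rewrite linear0.
    by apply/syz_map_eq0=> i; rewrite rowK; apply: HY; apply: memv_span; apply: mem_tnth.
  have : (Y <= kermx S)%MS by apply/sub_kermxP.
  move/mxrankS; rewrite mxrank_ker (eqP fY); have := rank_leq_row S; lia.
exists (\rank (kermx S)), (row_base (kermx S)); split; first exact: row_base_free.
  by rewrite mxrank_ker; have := rank_leq_row S; lia.
move=> v a vb; set y := row a _; set F := zpoly _ * _.
have yS : y *m S = 0.
  by apply/sub_kermxP; apply: submx_trans (row_sub _ _) _; rewrite eq_row_base.
have Fb i : vap (coords (tnth b i)) F = 0.
  have : syz_map (tuple_mx b) (vec_mx y) = 0.
    by apply: (can_inj mxvecK); rewrite linear0 -[RHS]yS mul_rV_lin.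
  by move/syz_map_eq0/(_ i); rewrite rowK.
rewrite (coord_span vb) linear_sum.
elim/big_rec: _ => [|i u _ Hu]; first exact: vap0l.
by rewrite linearZ /= vapDl Hu addr0 -tnth_nth Fb scaler0.
Qed.

Definition mx_of_coords (x : 'I_(k * \dim {:form}) -> K) : 'M[K]_(k, n.+3) :=
  \matrix_(i, c) \sum_j x (mxvec_index i j) * coords (vbasis {:form})`_j 0 c.

Lemma tuple_mxE b : tuple_mx b = mx_of_coords (tuple_coords b).
Proof.
apply/matrixP=> i c; rewrite !mxE.
have -> : (on_chart 0 (mpoly_of_dhomog (tnth b i)))`_c / 'C(n.+2, c)%:R = coords (tnth b i) 0 c by rewrite mxE.
rewrite {1}(coord_vbasis (memvf (tnth b i))) linear_sum summxE; apply: eq_bigr => j _.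
by rewrite linearZ mxE /tuple_coords mxvecE mxE.
Qed.

Lemma poly_fun_mx_of_coords i c : poly_fun (fun x => mx_of_coords x i c).
Proof.
have [P HP] : poly_fun (fun x : 'I_(k * \dim {:form}) -> K => \sum_j x (mxvec_index i j) * coords (vbasis {:form})`_j 0 c).
  by apply: poly_fun_sum => j; apply: poly_funM; [apply: poly_fun_coord | apply: poly_fun_const].
by exists P => x; rewrite mxE HP.
Qed.

Lemma poly_fun_syz_map e a b :
  poly_fun (fun x => lin_mx (@syz_map e (mx_of_coords x)) a b).
Proof.
case/mxvec_indexP: b => r t; set F := zpoly (vec_mx (delta_mx 0 a : 'rV[K]_(n.+1 * e))) * Dsq K.
have [P HP] : poly_fun (fun x => \sum_(i < n.+3) mx_of_coords x r i * (F`_i)`_t).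
  by apply: poly_fun_sum => j; apply: poly_funM; [apply: poly_fun_mx_of_coords | apply: poly_fun_const].
exists P => x; rewrite -HP mxE /= mxvecE mxE /vap coef_sum; apply: eq_bigr => i _.
by rewrite coefZ mxE.
Qed.

Lemma few_quotients_open e T (b : k.-tuple form) : ~ many_quotients e T <<b>>%VS ->
  exists2 P : {mpoly K[k * \dim {:form}]}, P.@[tuple_coords b] != 0
    & forall b', P.@[tuple_coords b'] != 0 -> ~ many_quotients e T <<b'>>%VS.
Proof.
rewrite many_quotientsP => /negP; rewrite -leqNgt => /rank_geP [U [W E]].
have [P HP] : poly_fun (fun x => \det (U *m lin_mx (@syz_map e (mx_of_coords x)) *m W)).
  apply: poly_fun_det; apply: poly_fun_mulmx => [|i j]; last exact: poly_fun_const.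
  apply: poly_fun_mulmx => [i j|]; [exact: poly_fun_const | exact: poly_fun_syz_map].
exists P; first by rewrite -HP -tuple_mxE E det1 oner_neq0.
move=> b'; rewrite -HP -tuple_mxE => /rank_ge_det; rewrite leqNgt => /negP.
by rewrite many_quotientsP.
Qed.

Lemma free_tuple_mx (b : k.-tuple form) : free b <-> row_free (tuple_mx b).
Proof.
have E (c : 'rV_k) : c *m tuple_mx b = coords (\sum_i c 0 i *: b`_i).
  rewrite mulmx_sum_row linear_sum; apply: eq_bigr => i _.
  by rewrite linearZ rowK -tnth_nth.
split=> [/freeP fb | rf]; last first.
  apply/freeP=> c; have -> : \sum_(i < k) c i *: b`_i = \sum_i (\row_i c i) 0 i *: b`_i.
    by apply: eq_bigr => i _; rewrite mxE.
  move/(congr1 (@coords K n.+2)); rewrite linear0 -E -(mul0mx _ (tuple_mx b)).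
  by move/(row_free_inj rf)/rowP=> H i; have := H i; rewrite !mxE.
rewrite -kermx_eq0; apply/rowV0P=> c /sub_kermxP; rewrite E => c0; apply/rowP=> i; rewrite mxE.
by apply: fb; apply: (can_inj (@coordsK K n.+2)); rewrite c0 linear0.
Qed.

Lemma free_open (b : k.-tuple form) : free b ->
  exists2 P : {mpoly K[k * \dim {:form}]}, P.@[tuple_coords b] != 0
    & forall b', P.@[tuple_coords b'] != 0 -> free b'.
Proof.
move/free_tuple_mx/row_freeP=> [W E].
have [P HP] : poly_fun (fun x => \det (mx_of_coords x *m W)).
  apply: poly_fun_det; apply: poly_fun_mulmx => i j; last exact: poly_fun_const.
  exact: poly_fun_mx_of_coords.
exists P; first by rewrite -HP -tuple_mxE E det1 oner_neq0.
move=> b'; rewrite -HP -tuple_mxE => d; apply/free_tuple_mx.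
have : (k <= \rank (tuple_mx b'))%N by apply: (@rank_ge_det _ _ _ _ _ 1%:M W); rewrite mul1mx.
by rewrite /row_free eqn_leq rank_leq_row => ->.
Qed.

Lemma zariski_closed_many_quotients e1 T1 e2 T2 :
  zariski_closed k (fun L : {vspace form} => many_quotients e1 T1 L \/ many_quotients e2 T2 L).
Proof.
apply: zariski_closed_of_open => b fb /boolp.not_orP [n1 n2].
have [P1 P1b H1] := few_quotients_open n1; have [P2 P2b H2] := few_quotients_open n2.
exists (P1 * P2); first by rewrite mevalM mulf_neq0.
by move=> b' _; rewrite mevalM mulf_eq0 => /norP [/H1 m1 /H2 m2] [].
Qed.

Definition path_tuple (V : 'M[{poly K}]_(k, n.+3)) s : k.-tuple form :=
  [tuple form_of (row i (eval_mx s V)) | i < k].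

Lemma tuple_mx_path V s : tuple_mx (path_tuple V s) = eval_mx s V.
Proof. by apply/row_matrixP=> i; rewrite rowK tnth_mktuple form_ofK. Qed.

Lemma path_coords V : exists x : 'I_(k * \dim {:form}) -> {poly K},
  forall s l, tuple_coords (path_tuple V s) l = (x l).[s].
Proof.
pose c (j : 'I_(\dim {:form})) (i : 'I_n.+3) : K := coord (vbasis {:form}) j (form_of (delta_mx 0 i)).
exists (fun l => mxvec (\matrix_(i, j) \sum_a V i a * (c j a)%:P) 0 l) => s l.
case/mxvec_indexP: l => i j; rewrite /tuple_coords !mxvecE !mxE tnth_mktuple.
rewrite [row i _]row_sum_delta !linear_sum horner_sum; apply: eq_bigr => a _.
by rewrite !linearZ /= !mxE hornerM hornerC.
Qed.

Lemma path_generic (X : {vspace form} -> Prop) (V : 'M[{poly K}]_(k, n.+3)) (dl : {poly K})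
    (L : {vspace form}) e1 T1 e2 T2 :
    free (path_tuple V 0) -> <<path_tuple V 0>>%VS = L -> dl != 0 ->
    ~ many_quotients e1 T1 <<path_tuple V 1>>%VS -> ~ many_quotients e2 T2 <<path_tuple V 1>>%VS ->
    (forall s, dl.[s] != 0 -> X <<path_tuple V s>>%VS) ->
  exists (b : K -> k.-tuple form) (x : 'I_(k * \dim {:form}) -> {poly K}) (pi : {poly K}),
    [/\ forall s l, tuple_coords (b s) l = (x l).[s], free (b 0), <<b 0%R>>%VS = L, pi != 0
      & forall s, pi.[s] != 0 -> [/\ free (b s), X <<b s>>%VS &
          ~ (many_quotients e1 T1 <<b s>>%VS \/ many_quotients e2 T2 <<b s>>%VS)]].
Proof.
move=> f0 L0 dl0 n1 n2 HX; have [x Hx] := path_coords V.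
have ev P s : (mmap (@polyC K) x P).[s] = P.@[tuple_coords (path_tuple V s)].
  by rewrite meval_path; apply: meval_eq => l; rewrite Hx.
have nz P s : P.@[tuple_coords (path_tuple V s)] != 0 -> mmap (@polyC K) x P != 0.
  by rewrite -ev; apply: contraNneq => ->; rewrite horner0.
have [P0 P0b H0] := free_open f0.
have [P1 P1b H1] := few_quotients_open n1; have [P2 P2b H2] := few_quotients_open n2.
exists (path_tuple V), x, (dl * mmap (@polyC K) x P0 * mmap (@polyC K) x P1 * mmap (@polyC K) x P2).
split=> //.
  by rewrite !mulf_neq0 // ?(nz _ _ P0b) ?(nz _ _ P1b) ?(nz _ _ P2b).
move=> s; rewrite !hornerM !ev !mulf_eq0 !negb_or => /andP [/andP [/andP [/HX Xs /H0 fs] /H1 ns1] /H2 ns2].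
by split=> // -[].
Qed.

End SyzygyRank.

Lemma interpolating_path (K : closedFieldType) k N u (V0 V1 : 'M[K]_(k, N)) (G0 G1 : 'M[K]_(N, u)) :
    V0 *m G0 = 0 -> V1 *m G1 = 0 -> inj_cols G0 -> inj_cols G1 ->
  exists (V : 'M[{poly K}]_(k, N)) (dl : {poly K}),
    [/\ eval_mx 0 V = V0, eval_mx 1 V = V1, dl != 0,
        forall s, eval_mx s V *m ((1 - s) *: G0 + s *: G1) = 0
      & forall s, dl.[s] != 0 -> inj_cols ((1 - s) *: G0 + s *: G1)].
Proof.
move=> VG0 VG1 /inj_cols_linv [C0 CG0] /inj_cols_linv [C1 CG1].
pose seg m l (A0 A1 : 'M[K]_(m, l)) : 'M[{poly K}]_(m, l) :=
  (1 - 'X) *: map_mx polyC A0 + 'X *: map_mx polyC A1.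
have segE m l (A0 A1 : 'M[K]_(m, l)) s : eval_mx s (seg _ _ A0 A1) = (1 - s) *: A0 + s *: A1.
  by apply/matrixP=> i j; rewrite !mxE /horner_eval !hornerE.
pose G := seg _ _ G0 G1; pose C := seg _ _ C0 C1; pose dl := \det (C *m G).
pose V := seg _ _ V0 V1 *m (dl%:M - G *m \adj (C *m G) *m C).
have dlE s : dl.[s] = \det (((1 - s) *: C0 + s *: C1) *m ((1 - s) *: G0 + s *: G1)).
  rewrite -[LHS]/(horner_eval s (\det (C *m G))) -(det_map_mx (horner_eval s)).
  by rewrite -/(eval_mx s (C *m G)) eval_mxM !segE.
have dl0 : dl.[0] = 1 by rewrite dlE subr0 !scale1r !scale0r !addr0 CG0 det1.
have dl1 : dl.[1] = 1 by rewrite dlE subrr !scale1r !scale0r !add0r CG1 det1.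
have VE s : eval_mx s V = ((1 - s) *: V0 + s *: V1) *m (dl.[s]%:M -
    ((1 - s) *: G0 + s *: G1) *m eval_mx s (\adj (C *m G)) *m eval_mx s C).
  rewrite /V eval_mxM segE {1}/eval_mx raddfB /= -![map_mx (horner_eval s) _]/(eval_mx s _).
  by rewrite !eval_mxM segE /eval_mx map_scalar_mx.
exists V, dl; split.
- rewrite VE subr0 !scale1r !scale0r !addr0 dl0 mulmxBr mulmx1 !mulmxA VG0 !mul0mx.
  by rewrite subr0.
- rewrite VE subrr !scale1r !scale0r !add0r dl1 mulmxBr mulmx1 !mulmxA VG1 !mul0mx.
  by rewrite subr0.
- by apply: contra_eq_neq dl0 => ->; rewrite horner0 eq_sym oner_neq0.
- move=> s; rewrite -segE -eval_mxM /V -mulmxA mulmxBl -(mulmxA _ C) -(mulmxA G) mul_adj_mx.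
  by rewrite mul_scalar_mx mul_mx_scalar subrr mulmx0 eval_mx0.
move=> s; rewrite dlE; set CC := _ *: C0 + _; set GG := _ *: G0 + _ => d.
have CGu : CC *m GG \in unitmx by rewrite unitmxE unitfE.
by apply: (@linv_inj_cols _ _ _ _ (invmx (CC *m GG) *m CC)); rewrite -mulmxA mulVmx.
Qed.

Lemma filter_pred1_nseq (T : eqType) (s : seq T) x : [seq y <- s | y == x] = nseq (count_mem x s) x.
Proof.
have /all_pred1P -> : all (pred1 x) [seq y <- s | y == x] by apply: filter_all.
by rewrite size_filter.
Qed.

Lemma perm_two_values (s : seq nat) B : all (fun x => (x == B) || (x == B.+1)) s ->
  perm_eq s (nseq (count_mem B s) B ++ nseq (count_mem B.+1 s) B.+1).
Proof.
move=> sB; rewrite -!filter_pred1_nseq.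
have <- : [seq x <- s | x != B] = [seq x <- s | x == B.+1].
  by apply: eq_in_filter => x /(allP sB) /orP [] /eqP ->; rewrite ?eqxx; lia.
by rewrite perm_sym; apply: permEl (perm_filterC _ _).
Qed.

Lemma balanced_type (s : seq nat) A rho k (B := (2 * k %/ A)%N) :
    size s = (A + rho)%N -> sumn s = (2 * k)%N -> (0 < A)%N -> (rho <= count_mem 0%N s)%N ->
    A = 1%N \/ (\sum_(x <- s) (B - x) <= rho * B)%N /\
      (\sum_(x <- s) (B.+1 - x) <= (A + rho) * B.+1 - 2 * k)%N ->
  perm_eq s (nseq rho 0%N ++ nseq (A + B * A - 2 * k) B ++ nseq (2 * k - B * A) B.+1).
Proof.
move=> szs sums A0 cs HAB.
have [s' ps] : exists s', perm_eq s (nseq rho 0%N ++ s').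
  exists (nseq (count_mem 0%N s - rho) 0%N ++ [seq x <- s | x != 0%N]).
  have -> : nseq rho 0%N ++ nseq (count_mem 0%N s - rho) 0%N ++ [seq x <- s | x != 0%N]
      = nseq (count_mem 0%N s) 0%N ++ [seq x <- s | x != 0%N].
    by rewrite catA -nseqD subnKC.
  rewrite -filter_pred1_nseq.
  by rewrite perm_sym; apply: permEl (perm_filterC _ _).
have sumE (f : nat -> nat) : (\sum_(x <- s) f x = rho * f 0 + \sum_(x <- s') f x)%N.
  by rewrite (perm_big _ ps) big_cat /= big_nseq iter_addn_0 mulnC.
have szs' : size s' = A.
  by have /eqP := perm_size ps; rewrite szs size_cat size_nseq addnC eqn_add2l => /eqP <-.
have sums' : (\sum_(x <- s') x = 2 * k)%N.
  by have := sumE id; rewrite /= -sumnE sums muln0.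
apply: perm_trans ps _; rewrite perm_cat2l.
case: HAB => [A1 | [H1 H2]].
  rewrite /B A1 divn1 muln1 addnK subnn cats0.
  case: s' szs' sums' {sumE} => [|x [|//]]; rewrite A1 // big_cons big_nil addn0 => _ <-.
  exact: perm_refl.
have dv := divn_eq (2 * k) A; have lt := ltn_pmod (2 * k) A0; rewrite -/B in dv.
have all1 x : x \in s' -> (B <= x)%N.
  have : (\sum_(x <- s') (B - x) == 0)%N by move: H1; rewrite sumE subn0; lia.
  by rewrite sum_nat_seq_eq0 => /allP H xs; have := H x xs; rewrite /= subn_eq0.
have sumAB : (\sum_(x <- s') (B.+1 - x + x) <= A * B.+1)%N.
  have le : (2 * k <= A * B.+1)%N by rewrite dv mulnS addnC; apply: leq_add; [exact: ltnW | rewrite mulnC].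
  rewrite big_split /= sums'; move: H2; rewrite sumE subn0 mulnDl; lia.
have all2 x : x \in s' -> (x <= B.+1)%N.
  have : (\sum_(x <- s') (x - B.+1) == 0)%N.
    have : (\sum_(x <- s') (B.+1 + (x - B.+1)) <= A * B.+1)%N.
      by apply: leq_trans sumAB; apply: leq_sum => y _; lia.
    by rewrite big_split /= big_const_seq count_predT szs' iter_addn_0; lia.
  by rewrite sum_nat_seq_eq0 => /allP H xs; have := H x xs; rewrite /= subn_eq0.
have aB : all (fun x => (x == B) || (x == B.+1)) s'.
  by apply/allP=> x xs; have := all1 x xs; have := all2 x xs; lia.
have pB := perm_two_values aB; have szB := perm_size pB; have sumB := perm_sumn pB.
move: szB sumB; rewrite size_cat !size_nseq szs' sumn_cat !sumn_nseq sumnE sums' => szB sumB.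
suff [<- <-] : count_mem B s' = (A + B * A - 2 * k)%N /\ count_mem B.+1 s' = (2 * k - B * A)%N by [].
by split; nia.
Qed.

(** * Ancestors of a linear system *)

Section Ancestors.
Variable K : numClosedFieldType.
Implicit Types (G : seq ({poly K} * nat)) (h : nat -> {poly K}) (f g q : {poly K}).

Local Notation x0 := (0%R : {poly K}, 0%N).

Definition comb G h : {poly K} := \sum_(i < size G) h i * (nth x0 G i).1.

Lemma combD G h1 h2 : comb G (fun i => h1 i + h2 i) = comb G h1 + comb G h2.
Proof. by rewrite -big_split; apply: eq_bigr => i _; rewrite mulrDl. Qed.

Lemma combM G q h : comb G (fun i => q * h i) = q * comb G h.
Proof. by rewrite mulr_sumr; apply: eq_bigr => i _; rewrite mulrA. Qed.

Definition coef_bounded G s h := forall i, (i < size G)%N -> (size (h i) <= s - (nth x0 G i).2)%N.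

Definition direct_at G s := forall h, coef_bounded G s h -> comb G h = 0 ->
  forall i, (i < size G)%N -> h i = 0.

Variables (D : nat) (P : {poly K} -> Prop).
Hypothesis P0 : P 0.
Hypothesis P_lin : forall a f g, P f -> P g -> P (a *: f + g).

Definition ancestor s f := (size f <= s)%N /\ forall q, (size q <= D.+2 - s)%N -> P (f * q).

Definition spans_at G s := forall f, ancestor s f -> exists2 h, coef_bounded G s h & f = comb G h.

Definition generators G s := forall i, (i < size G)%N ->
  ((nth x0 G i).2 < s)%N /\ ancestor (nth x0 G i).2.+1 (nth x0 G i).1.

Lemma P_sum r (F : 'I_r -> {poly K}) : (forall i, P (F i)) -> P (\sum_i F i).
Proof.
move=> H; elim/big_rec: _ => // i f _ Pf.
by rewrite -[F i]scale1r; apply: P_lin.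
Qed.

(* A relation [sum h_i g_i = 0] in degree [s] gives, writing [h_i = y h'_i + h''_i], an ancestor form
   [sum h'_i g_i] two degrees lower, so a shorter expression of it by the generators. *)
Lemma direct_succ G s : (0 < s)%N -> (s <= D.+1)%N -> generators G s -> direct_at G s ->
  spans_at G s.-1 -> direct_at G s.+1.
Proof.
move=> s0 sD gen dir span h hb h0.
pose h1 i := drop_poly 1 (h i); pose h2 i := ((h i)`_0)%:P.
have hE i : h i = 'X * h1 i + h2 i.
  rewrite -[LHS](poly_take_drop 1) addrC expr1 mulrC; congr (_ + _).
  by apply/polyP=> j; rewrite coef_take_poly coefC; case: j.
have b1 : coef_bounded G s h1.
  move=> i lt; rewrite size_drop_poly; have := hb i lt; have [] := gen i lt; lia.
have b2 : coef_bounded G s h2.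
  move=> i lt; apply: leq_trans (size_polyC_leq1 _) _; have [] := gen i lt; lia.
pose psi := comb G h1.
have Xpsi : 'X * psi = - comb G h2.
  apply/eqP; rewrite -addr_eq0 /psi -combM -combD -[X in _ == X]h0.
  by apply/eqP; apply: eq_bigr => i _; rewrite -hE.
have sz_psi : (size psi <= s.-1)%N.
  have [->|psi0] := eqVneq psi 0; first by rewrite size_poly0.
  suff : (size ('X * psi)%R <= s)%N by rewrite mulrC size_mulX //; lia.
  rewrite Xpsi size_polyN; apply: leq_trans (size_sum _ _ _) _; apply/bigmax_leqP=> i _.
  rewrite mul_polyC; apply: leq_trans (size_scale_leq _ _) _.
  by have [lt [sg _]] := gen i (ltn_ord i); apply: leq_trans sg lt.
have anc : ancestor s.-1 psi.
  split=> // q sq.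
  have -> : psi * q = ('X * psi) * drop_poly 1 q + (q`_0)%:P * psi.
    rewrite -{1}(poly_take_drop 1 q) mulrDr expr1 addrC; congr (_ + _); first by ring.
    rewrite mulrC; congr (_ * _).
    by apply/polyP=> j; rewrite coef_take_poly coefC; case: j.
  rewrite mul_polyC addrC; apply: P_lin; last rewrite Xpsi mulNr -scaleN1r -[_ *: _]addr0.
    apply: P_sum => i; have [lt [sg]] := gen i (ltn_ord i); rewrite mulrC; apply.
    by have := b1 i (ltn_ord i); lia.
  apply: P_lin => //; rewrite mulr_suml; apply: P_sum => i.
  have [lt [sg anc]] := gen i (ltn_ord i); rewrite mulrAC mulrC; apply: anc.
  rewrite mul_polyC; apply: leq_trans (size_scale_leq _ _) _.
  by rewrite size_drop_poly; lia.
have [w wb wE] := span _ anc.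
have E i : (i < size G)%N -> 'X * w i + h2 i = 0.
  apply: (dir (fun i => 'X * w i + h2 i)).
    move=> j lt; apply: leq_trans (size_polyD _ _) _; rewrite geq_max b2 // andbT.
    have [->|w0] := eqVneq (w j) 0; first by rewrite mulr0 size_poly0.
    have : (0 < size (w j))%N by rewrite size_poly_gt0.
    by rewrite mulrC size_mulX //; have := wb j lt; lia.
  by rewrite combD combM -wE Xpsi addNr.
have h20 i : (i < size G)%N -> h2 i = 0.
  move=> lt; have := congr1 (fun p : {poly K} => p`_0) (E i lt).
  by rewrite coefD mulrC coefMX /= add0r coef0 coefC /h2 /= => ->.
have psi0 : psi = 0.
  apply/eqP.
  have /eqP : 'X * psi = 0.
    by rewrite Xpsi /comb big1 ?oppr0 // => i _; rewrite h20 ?mul0r.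
  by rewrite mulf_eq0 polyX_eq0.
move=> i lt; rewrite hE h20 // addr0 [h1 i](_ : _ = 0) ?mulr0 //.
exact: dir b1 psi0 i lt.
Qed.

Lemma independent_size r s (F : 'I_r -> {poly K}) :
  lin_indep F -> (forall i, (size (F i) <= s)%N) -> (r <= s)%N.
Proof.
move=> iF sF; pose M : 'M[K]_(r, s) := \matrix_i poly_rV (F i).
suff /eqP <- : row_free M by apply: rank_leq_col.
rewrite -kermx_eq0; apply/rowV0P=> c /sub_kermxP; rewrite mulmx_sum_row => cM.
apply/rowP=> i; rewrite mxE; apply: (iF (fun i => c 0 i)).
rewrite -[RHS](linear0 (@rVpoly K s)) -cM linear_sum; apply: eq_bigr => j _.
by rewrite linearZ rowK /= poly_rV_K.
Qed.

Lemma generators_size G s : generators G s -> direct_at G s -> (size G <= s)%N.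
Proof.
move=> gen dir; apply: (@independent_size (size G) s (fun i => (nth x0 G i).1)).
  move=> c E i; pose h j := (odflt 0 (omap c (insub j)))%:P : {poly K}.
  have hE (j : 'I_(size G)) : h j = (c j)%:P by rewrite /h valK.
  apply: (@polyC_inj K); rewrite -hE polyC0; apply: dir => //.
    move=> j lt; apply: leq_trans (size_polyC_leq1 _) _; have [] := gen j lt; lia.
  by rewrite -[RHS]E; apply: eq_bigr => j _; rewrite hE mul_polyC.
by move=> i; have [lt [sg _]] := gen i (ltn_ord i); apply: leq_trans sg lt.
Qed.

Lemma nth_rcons_lt G x i : (i < size G)%N -> nth x0 (rcons G x) i = nth x0 G i.
Proof. by move=> lt; rewrite nth_rcons lt. Qed.

Lemma comb_rcons G x h : comb (rcons G x) h = comb G h + h (size G) * x.1.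
Proof.
rewrite /comb size_rcons big_ord_recr /= nth_rcons ltnn eqxx; congr (_ + _).
by apply: eq_bigr => i _; rewrite nth_rcons_lt.
Qed.

Lemma complete_generators G s : generators G s.+1 -> direct_at G s.+1 -> spans_at G s ->
  exists G', [/\ generators G' s.+1, direct_at G' s.+1, spans_at G' s & spans_at G' s.+1].
Proof.
have [m] := ubnP (s.+1 - size G)%N; elim: m => // m IH in G *; rewrite ltnS => szG gen dir sp.
have [sp1 | /boolp.existsNP [f /boolp.not_implyP [fI nf]]] := boolp.EM (spans_at G s.+1).
  by exists G.
have genf : generators (rcons G (f, s)) s.+1.
  move=> i; rewrite size_rcons ltnS leq_eqVlt => /orP [/eqP -> | lt].
    by rewrite nth_rcons ltnn eqxx.
  by rewrite nth_rcons_lt //; apply: gen.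
have dirf : direct_at (rcons G (f, s)) s.+1.
  move=> h hb; rewrite comb_rcons /= => E.
  have hbG : coef_bounded G s.+1 h.
    by move=> i lt; have := hb i; rewrite size_rcons ltnS (ltnW lt) nth_rcons_lt //; apply.
  have : (size (h (size G)) <= 1)%N.
    by have := hb (size G); rewrite size_rcons nth_rcons ltnn eqxx ltnSn subSnn; apply.
  move/size1_polyC => hc; set c := (_`_0) in hc.
  have c0 : c = 0.
    apply/eqP/negPn/negP=> c0; apply: nf; exists (fun i => (- c^-1)%:P * h i).
      by move=> i lt; rewrite mul_polyC; apply: leq_trans (size_scale_leq _ _) (hbG i lt).
    rewrite combM; move/eqP: E; rewrite addr_eq0 => /eqP ->.
    by rewrite hc mulrN polyCN mulNr opprK mulrA -polyCM mulVf // mul1r.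
  move: E; rewrite hc c0 mul0r addr0 => E.
  move=> i; rewrite size_rcons ltnS leq_eqVlt => /orP [/eqP -> | lt].
    by rewrite hc c0.
  exact: dir hbG E i lt.
apply: (IH (rcons G (f, s))) => //.
  have := generators_size genf dirf; rewrite size_rcons; lia.
move=> q qI; have [h hb ->] := sp q qI.
exists (fun i => if (i < size G)%N then h i else 0).
  move=> i; rewrite size_rcons ltnS leq_eqVlt => /orP [/eqP -> | lt].
    by rewrite ltnn size_poly0.
  by rewrite lt nth_rcons_lt //; apply: hb.
rewrite comb_rcons ltnn mul0r addr0; apply: eq_bigr => i _.
by rewrite ltn_ord.
Qed.

Lemma ancestor_generators s : (s <= D)%N -> exists G,
  [/\ generators G s, direct_at G s, spans_at G s & spans_at G s.-1].
Proof.
have sp0 G : spans_at G 0.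
  move=> f [sf _]; exists (fun=> 0); first by move=> i _; rewrite size_poly0.
  rewrite /comb big1 => [|i _]; last by rewrite mul0r.
  by apply/eqP; rewrite -size_poly_eq0 -leqn0.
elim: s => [|s IH] sD.
  by exists [::]; split; [move=> i | move=> h _ _ i | apply: sp0 | apply: sp0].
have [G [gen dir sp sp1]] := IH (ltnW sD).
have gen' : generators G s.+1 by move=> i lt; have [l a] := gen i lt; split=> //; apply: ltnW.
have dir' : direct_at G s.+1.
  have [s0|s0] := posnP s; last by apply: direct_succ => //; lia.
  by move=> h _ _ i lt; have [] := gen i lt; rewrite s0.
have [G' [g1 d1 s1 s2]] := complete_generators gen' dir' sp.
by exists G'.
Qed.

Lemma direct_generators : (0 < D)%N -> exists G,
  [/\ generators G D.-1, direct_at G D.+1 & spans_at G D.-1].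
Proof.
move=> D0; have [G [gen dir sp sp1]] := @ancestor_generators D.-1 (leq_pred _).
exists G; split=> //.
have genD : generators G D by move=> i lt; have [l a] := gen i lt; split=> //; lia.
have [D1 | D1] := leqP D 1.
  have -> : G = [::].
    by case: G gen {dir sp sp1 genD} => // x G /(_ 0%N isT) []; rewrite ltnNge (leq_trans _ (leq0n _)) //; lia.
  by move=> h _ _ i.
have dirD : direct_at G D.
  have -> : D = D.-1.+1 by lia.
  by apply: direct_succ => //; lia.
by apply: direct_succ => //; lia.
Qed.

End Ancestors.

Section MonomialMultiples.
Variable K : numClosedFieldType.
Implicit Types (fs : seq nat) (g h : nat -> {poly K}).

Definition shifts w fs : seq (nat * nat) :=
  [seq (i, c) | i <- iota 0 (size fs), c <- iota 0 (nth 0 fs i + w)].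

Definition shift_family w fs g (j : nat) : {poly K} :=
  let x := nth (0, 0)%N (shifts w fs) j in g x.1 * 'X^(x.2).

Lemma size_shifts w fs : size (shifts w fs) = (sumn fs + size fs * w)%N.
Proof.
rewrite size_allpairs_dep sumnE big_map.
under eq_bigr => i _ do rewrite size_iota.
rewrite big_split /= big_const_seq count_predT size_iota iter_addn_0.
rewrite [(w * _)%N]mulnC; congr (_ + _)%N.
by rewrite sumnE [RHS](big_nth 0%N) /index_iota subn0.
Qed.

Lemma mem_shifts w fs x : (x \in shifts w fs) = (x.1 < size fs)%N && (x.2 < nth 0 fs x.1 + w)%N.
Proof.
apply/allpairsPdep/idP => [[i [c [+ + ->]]] /= | /andP [lt1 lt2]].
  by rewrite !mem_iota /= !add0n => -> ->.
by exists x.1, x.2; rewrite !mem_iota /= !add0n lt1 lt2; case: x {lt1 lt2}.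
Qed.

Lemma uniq_shifts w fs : uniq (shifts w fs).
Proof.
apply: allpairs_uniq_dep; rewrite ?iota_uniq //.
  by move=> i _; rewrite iota_uniq.
by move=> [a b] [c d] _ _ /= [-> ->].
Qed.

Lemma shift_sum w fs (F : nat -> nat -> {poly K}) :
  \sum_(x <- shifts w fs) F x.1 x.2 = \sum_(i < size fs) \sum_(c < nth 0 fs i + w) F i c.
Proof.
rewrite big_allpairs_dep -/(index_iota 0 (size fs)) -{1}[size fs]subn0 -/(index_iota _ _) big_mkord.
apply: eq_bigr => i _; rewrite -{1}[(_ + w)%N]subn0 -/(index_iota _ _) big_mkord //.
Qed.

Lemma shift_indep w fs g :
    (forall h, (forall i, (i < size fs)%N -> (size (h i) <= nth 0 fs i + w)%N) ->
       \sum_(i < size fs) h i * g i = 0 -> forall i, (i < size fs)%N -> h i = 0) ->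
  lin_indep (fun j : 'I_(size (shifts w fs)) => shift_family w fs g j).
Proof.
move=> dir co E j; set S := shifts w fs in co E j *.
pose cx (x : nat * nat) : K := odflt 0 (omap co (insub (index x S))).
have cxE (a : 'I_(size S)) : cx (nth (0, 0)%N S a) = co a.
  by rewrite /cx index_uniq ?uniq_shifts // valK.
pose h i := \poly_(c < nth 0%N fs i + w) cx (i, c).
have h0 : forall i, (i < size fs)%N -> h i = 0.
  apply: dir => [i _|]; first exact: size_poly.
  rewrite -[RHS]E.
  transitivity (\sum_(x <- S) cx (x.1, x.2) *: (g x.1 * 'X^(x.2))).
    rewrite (shift_sum w fs (fun a b => cx (a, b) *: (g a * 'X^b))).
    apply: eq_bigr => i _; rewrite /h poly_def mulr_suml; apply: eq_bigr => c _.
    by rewrite -scalerAl mulrC.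
  rewrite (big_nth (0, 0)%N) big_mkord; apply: eq_bigr => a _.
  by rewrite -surjective_pairing cxE.
have : nth (0, 0)%N S j \in S by rewrite mem_nth.
rewrite mem_shifts => /andP [lt1 lt2].
have := congr1 (fun p : {poly K} => p`_(nth (0, 0)%N S j).2) (h0 _ lt1).
by rewrite coef_poly lt2 coef0 -surjective_pairing cxE.
Qed.

Lemma shift_span w fs g h : (forall i, (i < size fs)%N -> (size (h i) <= nth 0 fs i + w)%N) ->
  \sum_(i < size fs) h i * g i =
    \sum_(j < size (shifts w fs)) (h (nth (0, 0) (shifts w fs) j).1)`_(nth (0, 0) (shifts w fs) j).2
      *: shift_family w fs g j.
Proof.
move=> hb; rewrite -(big_mkord xpredT (fun j => (h (nth (0, 0)%N (shifts w fs) j).1)`_(nth (0, 0)%N (shifts w fs) j).2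
      *: shift_family w fs g j)) -(big_nth (0, 0)%N xpredT (fun x => (h x.1)`_x.2 *: (g x.1 * 'X^(x.2)))).
rewrite (shift_sum w fs (fun a b => (h a)`_b *: (g a * 'X^b))); apply: eq_bigr => i _.
rewrite -[h i in LHS]coefK poly_def (big_ord_widen _ (fun c => (h i)`_c *: 'X^c) (hb i (ltn_ord i))).
rewrite mulr_suml big_mkcond /=; apply: eq_bigr => c _.
case: ltnP => lt; first by rewrite -scalerAl mulrC.
by rewrite nth_default // scale0r.
Qed.

Lemma indep_in_span r s (F : 'I_r -> {poly K}) (E : 'I_s -> {poly K}) (c : 'I_r -> 'I_s -> K) :
  lin_indep F -> (forall i, F i = \sum_j c i j *: E j) -> (r <= s)%N.
Proof.
move=> iF FE; pose M : 'M[K]_(r, s) := \matrix_(i, j) c i j.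
suff /eqP <- : row_free M by apply: rank_leq_col.
rewrite -kermx_eq0; apply/rowV0P=> a /sub_kermxP aM; apply/rowP=> i; rewrite mxE.
apply: (iF (fun i => a 0 i)).
under eq_bigr => l _ do rewrite FE scaler_sumr.
rewrite exchange_big big1 // => j _ /=.
under eq_bigr => l _ do rewrite scalerA.
rewrite -scaler_suml; move/rowP/(_ j): aM; rewrite !mxE => aMj.
rewrite (_ : \sum_i _ = 0) ?scale0r // -[RHS]aMj; apply: eq_bigr => l _.
by rewrite mxE.
Qed.

Lemma truncate_seq fs r : all (leq 1) fs -> (r <= sumn fs)%N ->
  exists fs', [/\ (size fs' <= size fs)%N, all (leq 1) fs', sumn fs' = r
    & forall i, (i < size fs')%N -> (nth 0 fs' i <= nth 0 fs i)%N].
Proof.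
elim: fs r => [|f fs IH] r /=; first by rewrite leqn0 => _ /eqP ->; exists [::].
case/andP=> f1 fs1 le; have [r0|r0] := posnP r; first by exists [::]; rewrite r0.
have [lt | ge] := ltnP r f.
  exists [:: r]; rewrite /= addn0 andbT; split=> // -[|i] //= _; exact: ltnW.
have [|fs' [s1 s2 s3 s4]] := IH (r - f)%N fs1; first lia.
exists (f :: fs'); rewrite /= f1 s2 s3; split=> //; first lia.
by move=> [|i] //= lt; apply: s4.
Qed.

Lemma forms_structure (D : nat) (P : {poly K} -> Prop) r (phi : 'I_r -> {poly K}) :
    P 0 -> (forall a (f1 f2 : {poly K}), P f1 -> P f2 -> P (a *: f1 + f2)) -> (0 < D)%N ->
    lin_indep phi -> (forall i, (size (phi i) <= D.-1)%N) ->
    (forall i (q : {poly K}), (size q <= 3)%N -> P (phi i * q)) ->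
  exists fs g, [/\ sumn fs = r, all (leq 1) fs,
    forall i, (i < size fs)%N -> (size (g i) + nth 0 fs i <= D)%N /\
      forall q : {poly K}, (size q <= nth 0 fs i + 2)%N -> P (g i * q)
    & lin_indep (fun j : 'I_(size (shifts 2 fs)) => shift_family 2 fs g j)].
Proof.
move=> P0 Pl D0 iphi sphi Pphi; have [G [gen dir sp]] := direct_generators P0 Pl D0.
pose x0 := (0%R : {poly K}, 0%N).
pose fs0 := [seq (D.-1 - x.2)%N | x <- G]; pose g i := (nth x0 G i).1.
have fs0E i : (i < size G)%N -> nth 0%N fs0 i = (D.-1 - (nth x0 G i).2)%N.
  by move=> lt; rewrite (nth_map x0).
have szfs0 : size fs0 = size G by rewrite size_map.
have fs01 : all (leq 1) fs0.
  by apply/(all_nthP 0%N) => i; rewrite szfs0 => lt; rewrite fs0E //; have [lb _] := gen i lt; rewrite /= subn_gt0.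
have rle : (r <= sumn fs0)%N.
  have cex i : exists h, (forall l, (l < size fs0)%N -> (size (h l) <= nth 0 fs0 l + 0)%N) /\
      phi i = \sum_(l < size fs0) h l * g l.
    have [|h hb hE] := sp (phi i).
      by split=> // q sq; apply: Pphi; lia.
    exists h; split; last by rewrite szfs0.
    by move=> l; rewrite szfs0 => lt; rewrite fs0E // addn0; apply: hb.
  have [h Hh] := boolp.choice cex.
  have <- : size (shifts 0 fs0) = sumn fs0 by rewrite size_shifts muln0 addn0.
  apply: (indep_in_span iphi (E := fun j => shift_family 0 fs0 g j)
    (c := fun i (j : 'I_(size (shifts 0 fs0))) =>
       (h i (nth (0, 0) (shifts 0 fs0) j).1)`_(nth (0, 0) (shifts 0 fs0) j).2%N)) => i.
  have [hb hE] := Hh i; rewrite {1}hE.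
  exact: (@shift_span 0 fs0 g (h i) hb).
have [fs [szfs fs1 sumfs fsle]] := truncate_seq fs01 rle.
exists fs, g; split=> // [i lt|].
  have ltG : (i < size G)%N by rewrite -szfs0; apply: leq_trans szfs.
  have := fsle i lt; rewrite fs0E // => le; have [lb [sg anc]] := gen i ltG.
  move: le lb sg anc; rewrite /g; case: (nth x0 G i) => [gg b] /= le lb sg anc.
  by split=> [|q sq]; [|apply: anc]; lia.
apply: shift_indep => h hb E.
pose h' i := if (i < size fs)%N then h i else 0.
have h'0 : forall i, (i < size G)%N -> h' i = 0.
  apply: dir.
    move=> i lt; rewrite /h'; case: ifP => lt'; last by rewrite size_poly0.
    apply: leq_trans (hb i lt') _; have := fsle i lt'; rewrite fs0E //.
    have [lb _] := gen i lt; move: lb; case: (nth x0 G i) => [gg b] /=; lia.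
  rewrite -[RHS]E /comb -szfs0 (big_ord_widen _ (fun i => h i * g i) szfs) [RHS]big_mkcond.
  by apply: eq_bigr => i _ /=; rewrite /h'; case: ifP => // _; rewrite mul0r.
move=> i lt; have := h'0 i; rewrite /h' lt; apply.
by rewrite -szfs0; apply: leq_trans szfs.
Qed.

End MonomialMultiples.

(** * Monomial examples *)

Section Blocks.
Variable K : numClosedFieldType.
Implicit Types (z : nat -> {poly K}).

(* The coefficient of y^(i+2) in (y - t)^2 z, where [z i] is the coefficient of y^i in z. *)
Definition tdiff z i : {poly K} := z i - ('X *+ 2) * z i.+1 + 'X^2 * z i.+2.

Lemma tdiff_sum z l :
  \sum_(i < l) tdiff z i * 'X^i = z 0%N - 'X * z 1%N - z l * 'X^l + z l.+1 * 'X^(l.+1).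
Proof.
elim: l => [|l IH]; first by rewrite big_ord0 expr0 expr1; ring.
by rewrite big_ord_recr /= IH /tdiff !exprS; ring.
Qed.

Lemma tdiff_wsum z l :
  \sum_(i < l) tdiff z i * 'X^i *+ i = 'X * z 1%N - z l * 'X^l *+ l - z l.+1 * 'X^(l.+1)
     + z l.+1 * 'X^(l.+1) *+ l.
Proof.
elim: l => [|l IH]; first by rewrite big_ord0 expr0 expr1 !mulr0n; ring.
by rewrite big_ord_recr /= IH /tdiff !exprS !mulrS; ring.
Qed.

Lemma low_high (f g : {poly K}) l : (size f <= l)%N -> f = g * 'X^l -> f = 0 /\ g = 0.
Proof.
move=> sf fg; have g0 : g = 0.
  apply/eqP/negPn/negP=> g0; move: sf; rewrite fg size_Mmonic ?monicXn // size_polyXn.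
  have : (0 < size g)%N by rewrite size_poly_gt0.
  by lia.
by rewrite fg g0 mul0r.
Qed.

Lemma tdiff_eq0_up z l : z 0%N = 0 -> z 1%N = 0 -> (forall i, (i < l)%N -> tdiff z i = 0) ->
  forall j, (j < l.+2)%N -> z j = 0.
Proof.
move=> z0 z1 H; elim/ltn_ind => -[|[|j]] // IH lt.
have zj : z j = 0 by apply: IH; lia.
have zj1 : z j.+1 = 0 by apply: IH; lia.
have := H j lt; rewrite /tdiff zj zj1.
by rewrite mulr0 subr0 add0r => /eqP; rewrite mulf_eq0 expf_eq0 /= polyX_eq0 /= => /eqP.
Qed.

Lemma run_block z l : (forall i, (i < l)%N -> tdiff z i = 0) ->
  (size (z 0) <= l)%N -> (size (z 1) <= l)%N -> forall j, (j < l.+2)%N -> z j = 0.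
Proof.
move=> H s0 s1.
have S0 : \sum_(i < l) tdiff z i * 'X^i = 0 by apply: big1 => i _; rewrite H ?mul0r.
have S1 : \sum_(i < l) tdiff z i * 'X^i *+ i = 0 by apply: big1 => i _; rewrite H ?mul0r ?mul0rn.
rewrite tdiff_sum in S0; rewrite tdiff_wsum in S1.
set a := z l in S0 S1; set b := z l.+1 in S0 S1.
have [z00 E0] : z 0%N = 0 /\ a *+ l.+1 - 'X * b *+ l = 0.
  apply: (low_high s0); have S01 := congr2 +%R S0 S1; rewrite addr0 in S01.
  by rewrite -[LHS]subr0 -S01 exprS mulrS; ring.
have [z10 b0] : z 1%N *+ l.+1 = 0 /\ b = 0.
  apply: (@low_high _ _ l).
    by rewrite -scaler_nat; apply: leq_trans (size_scale_leq _ _) s1.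
  apply: (mulfI (negbT (polyX_eq0 K))); rewrite -[LHS]subr0 -(mul0rn _ l.+1) -S1.
  rewrite -[RHS]addr0 -(mul0r ('X^l *+ l)) -E0 exprS !mulrS; ring.
apply: tdiff_eq0_up => //; move/eqP: z10.
by rewrite -scaler_nat scaler_eq0 pnatr_eq0 /= => /eqP.
Qed.

Lemma triple_block z l p q e (g : {poly K}) :
    (p < q)%N -> (q < l)%N -> (e < l)%N ->
    (forall i, (i < l)%N -> tdiff z i = g *+ (i == p) + g *+ (i == q)) ->
    (size (z 0) <= e)%N -> (size (z 1) <= e)%N ->
  [/\ forall u, (e < u < l)%N ->
        ((p <= u)%N -> g`_(u - p) = 0) /\ ((q <= u)%N -> g`_(u - q) = 0),
      (q <= e)%N -> g`_(e - p) *+ p.+1 + g`_(e - q) *+ q.+1 = 0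
    & g`_(l - p) *+ (l - p) + g`_(l - q) *+ (l - q) = 0].
Proof.
move=> pq ql el H s0 s1.
have S0 := tdiff_sum z l; have S1 := tdiff_wsum z l.
have delta (F : nat -> {poly K}) : \sum_(i < l) (g *+ (i == p :> nat) + g *+ (i == q :> nat)) * F i = g * F p + g * F q.
  have one j : (j < l)%N -> \sum_(i < l) (g *+ (i == j :> nat)) * F i = g * F j.
    move=> jl; rewrite (bigD1 (Ordinal jl)) //= eqxx mulr1n big1 ?addr0 // => i /eqP ij.
    by case: eqP => [E|_]; [case: ij; apply: val_inj | rewrite mul0r].
  under eq_bigr => i _ do rewrite mulrDl.
  by rewrite big_split /= !one // (ltn_trans pq).
have pl := ltn_trans pq ql.
have T0 : g * 'X^p + g * 'X^q = z 0%N - 'X * z 1%N - z l * 'X^l + z l.+1 * 'X^(l.+1).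
  by rewrite -S0 -(delta (fun i => 'X^i)); apply: eq_bigr => i _; rewrite H.
have T1 : g * 'X^p *+ p + g * 'X^q *+ q = 'X * z 1%N - z l * 'X^l *+ l - z l.+1 * 'X^(l.+1)
     + z l.+1 * 'X^(l.+1) *+ l.
  rewrite -S1 -!mulrnAr -(delta (fun i => 'X^i *+ i)).
  by apply: eq_bigr => i _; rewrite H // mulrnAr.
pose x u := if (u < p)%N then 0 else g`_(u - p).
pose y u := if (u < q)%N then 0 else g`_(u - q).
have C0 u : x u + y u =
    (z 0%N)`_u - (if u == 0%N then 0 else (z 1%N)`_u.-1) - (if (u < l)%N then 0 else (z l)`_(u - l))
    + (if (u < l.+1)%N then 0 else (z l.+1)`_(u - l.+1)).
  have := congr1 (fun f : {poly K} => f`_u) T0.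
  by rewrite !(coefD, coefN, coefMXn) coefXM.
have C1 u : x u *+ p + y u *+ q =
    (if u == 0%N then 0 else (z 1%N)`_u.-1) - (if (u < l)%N then 0 else (z l)`_(u - l)) *+ l
    - (if (u < l.+1)%N then 0 else (z l.+1)`_(u - l.+1))
    + (if (u < l.+1)%N then 0 else (z l.+1)`_(u - l.+1)) *+ l.
  have := congr1 (fun f : {poly K} => f`_u) T1.
  by rewrite !(coefD, coefN, coefMn, coefMXn) coefXM.
have z0u u : (e <= u)%N -> (z 0%N)`_u = 0 by move=> le; rewrite nth_default // (leq_trans s0).
have z1u u : (e <= u)%N -> (z 1%N)`_u = 0 by move=> le; rewrite nth_default // (leq_trans s1).
split.
- move=> u /andP [eu ul].
  have := C0 u; have := C1 u; rewrite ul (ltn_trans ul (ltnSn l)) (z0u u (ltnW eu)).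
  have -> : (if u == 0%N then 0 else (z 1%N)`_u.-1) = 0 by case: eqP => // _; rewrite z1u //; lia.
  rewrite !mul0rn !subr0 !addr0.
  move=> E1 E0.
  have xy : x u = - y u by apply/eqP; rewrite -addr_eq0 E0.
  have y0 : y u = 0.
    have : y u *+ (q - p) = 0 by rewrite mulrnBr ?(ltnW pq) // -[RHS]E1 xy mulNrn addrC.
    by move/eqP; rewrite mulrn_eq0 subn_eq0 leqNgt pq => /eqP.
  have x0 : x u = 0 by rewrite xy y0 oppr0.
  split=> le.
    by move: x0; rewrite /x; case: ltnP => // lt _; move: le; rewrite leqNgt lt.
  by move: y0; rewrite /y; case: ltnP => // lt _; move: le; rewrite leqNgt lt.
- move=> qe; have pe : (p <= e)%N by lia.
  have := C0 e; have := C1 e; rewrite el (ltn_trans el (ltnSn l)) z0u //.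
  rewrite /x /y !ltnNge pe qe /= !mul0rn => E1 E0; rewrite !mulrS addrACA E0 E1; ring.
have := C0 l; have := C1 l; rewrite ltnn ltnSn (z0u l (ltnW el)).
have -> : (if l == 0%N then 0 else (z 1%N)`_l.-1) = 0 by case: eqP => // _; rewrite z1u //; lia.
rewrite /x /y !ltnNge (ltnW ql) (ltnW pl) /= subnn mul0rn => E1 E0.
rewrite !mulrnBr ?(ltnW pl) ?(ltnW ql) // addrACA -mulrnDl E0 -opprD E1; ring.
Qed.

End Blocks.

Section Layouts.
Variable K : numClosedFieldType.
Implicit Types (z : nat -> {poly K}).

(* [brows] linear conditions on [blen] consecutive [tdiff z i]; they become the
   points that span the special centre. *)
Record block := Block { blen : nat; brows : nat; brow : nat -> nat -> K }.

Definition probe z (x : bool * nat * nat) : K :=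
  (if x.1.1 then tdiff z x.1.2 else z x.1.2)`_x.2.

Definition good_block e cnt b := exists sel : seq (bool * nat * nat), (size sel <= cnt)%N /\
  forall z, (forall j, (j < (blen b).+2)%N -> (size (z j) <= e)%N) ->
    (forall a, (a < brows b)%N -> \sum_(i < blen b) brow b a i *: tdiff z i = 0) ->
    (forall x, x \in sel -> probe z x = 0) ->
  forall j, (j < (blen b).+2)%N -> z j = 0.

Definition run l := Block l l (fun a i => (i == a)%:R).

Lemma unit_row z l a : (a < l)%N -> \sum_(i < l) ((i == a :> nat)%:R : K) *: tdiff z i = tdiff z a.
Proof.
move=> al; rewrite (bigD1 (Ordinal al)) //= eqxx scale1r big1 ?addr0 // => i /eqP ia.
by case: eqP => [E|_]; [case: ia; apply: val_inj | rewrite scale0r].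
Qed.

Lemma run_good e l : (e <= l)%N -> good_block e 0 (run l).
Proof.
move=> el; exists [::]; split=> // z sz eqs _; apply: run_block => [i il||].
- by rewrite -(unit_row z il); apply: eqs.
- by apply: leq_trans (sz 0%N isT) el.
by apply: leq_trans (sz 1%N isT) el.
Qed.

Lemma run_good2 l : good_block l.+1 2 (run l).
Proof.
exists [:: (false, 0, l); (false, 1, l)]%N; split=> // z sz eqs sel.
have low j : (j < l.+2)%N -> (z j)`_l = 0 -> (size (z j) <= l)%N.
  move=> jl zl; apply/leq_sizeP => i; rewrite leq_eqVlt => /orP [/eqP <- //|lt].
  by rewrite nth_default // (leq_trans (sz j jl)).
apply: run_block => [i il||].
- by rewrite -(unit_row z il); apply: eqs.
- by apply: low => //; apply: (sel (false, 0, l)%N); rewrite !inE eqxx.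
by apply: low => //; apply: (sel (false, 1, l)%N); rewrite !inE eqxx orbT.
Qed.

Definition skip q a := if (a < q)%N then a else a.+1.

(* The conditions [tdiff z i = 0] for i <> p, q and [tdiff z p = tdiff z q]. *)
Definition triple p q l := Block l l.-1
  (fun a i => (i == skip q a)%:R - (if skip q a == p then (i == q)%:R else 0)).

Definition triple_system p q l e (c : nat -> K) :=
  [/\ forall a, (e < a + p < l)%N -> c a = 0,
      forall a, (e < a + q < l)%N -> c a = 0,
      (q <= e)%N -> c (e - p)%N *+ p.+1 + c (e - q)%N *+ q.+1 = 0,
      c (l - p)%N *+ (l - p) + c (l - q)%N *+ (l - q) = 0
    & forall a, (e.+2 <= a)%N -> c a = 0].

Lemma triple_good p q l e (ts : seq nat) : (p < q)%N -> (q < l)%N -> (e < l)%N ->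
    (forall c, triple_system p q l e c -> (forall t, t \in ts -> c t = 0) -> forall a, c a = 0) ->
  good_block e (size ts) (triple p q l).
Proof.
move=> pq ql el H; exists [seq (true, p, t) | t <- ts]; split; first by rewrite size_map.
move=> z sz eqs sel; have pl := ltn_trans pq ql.
have sq i : (i < l)%N -> i != q -> exists2 a, (a < l.-1)%N & skip q a = i.
  move=> il iq; have [lt|ge] := ltnP i q.
    by exists i; [lia | rewrite /skip lt].
  by exists i.-1; [lia | rewrite /skip; case: ltnP; lia].
have r0 i : (i < l)%N -> i != p -> i != q -> tdiff z i = 0.
  move=> il ip iq; have [a al sa] := sq i il iq; have := eqs a al.
  by under eq_bigr => j _ do rewrite /= sa (negbTE ip) subr0; rewrite unit_row.
have rpq : tdiff z q = tdiff z p.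
  have pq' : p != q by rewrite neq_ltn pq.
  have [a al sa] := sq p pl pq'; have := eqs a al.
  under eq_bigr => j _ do rewrite /= sa eqxx scalerBl.
  by rewrite sumrB !unit_row // => /eqP; rewrite subr_eq0 => /eqP.
set g := tdiff z p in rpq.
have Hg i : (i < l)%N -> tdiff z i = g *+ (i == p) + g *+ (i == q).
  move=> il; have [->|ip] := eqVneq i p.
    by rewrite (_ : p == q = false) ?addr0 // ltn_eqF.
  have [->|iq] := eqVneq i q; first by rewrite add0r rpq.
  by rewrite r0 // addr0.
have s0 := sz 0%N isT; have s1 := sz 1%N isT.
have [F1 F2 F3] := triple_block pq ql el Hg s0 s1.
have g0 : g = 0.
  apply/polyP=> a; rewrite coef0; apply: (H (fun a => g`_a)); last first.
    by move=> t tts; have := sel (true, p, t); rewrite /probe /=; apply; apply: map_f.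
  split=> // {}a => [apl|aql|ea].
  - by have [+ _] := F1 _ apl; rewrite addnK; apply; apply: leq_addl.
  - by have [_ +] := F1 _ aql; rewrite addnK; apply; apply: leq_addl.
  rewrite nth_default //; apply: leq_trans ea.
  have mx3 u v : (u <= e.+2)%N -> (v <= e.+2)%N -> (maxn u v <= e.+2)%N by rewrite geq_max => -> ->.
  apply: leq_trans (size_polyD _ _) (mx3 _ _ _ _); last first.
    apply: leq_trans (size_polyMleq _ _) _; rewrite size_polyXn /= add2n !ltnS.
    by apply: sz; rewrite /= !ltnS.
  apply: leq_trans (size_polyD _ _) (mx3 _ _ _ _).
    by apply: leq_trans (sz p _) _; rewrite /=; lia.
  rewrite size_polyN mulrnAl -scaler_nat; apply: leq_trans (size_scale_leq _ _) _.
  apply: leq_trans (size_polyMleq _ _) _; rewrite size_polyX /= add1n ltnS.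
  by apply: leq_trans (sz p.+1 _) _; rewrite /=; lia.
apply: run_block => [i il||]; first by rewrite Hg // g0 !mul0rn addr0.
- by apply: leq_trans s0 (ltnW el).
by apply: leq_trans s1 (ltnW el).
Qed.

Ltac natlia := repeat match goal with
  | H : is_true _ |- _ => revert H | H : nat |- _ => revert H end; clear; lia.

Lemma mulrn_eq0K (x : K) m : (0 < m)%N -> x *+ m = 0 -> x = 0.
Proof. by move=> m0 /eqP; rewrite mulrn_eq0 eqn0Ngt m0 /= => /eqP. Qed.

Lemma triple1_good b : (0 < b)%N -> good_block b.*2 0 (triple b.-1 b.*2 (3 * b).+1) /\
  good_block b.*2.+1 3 (triple b.-1 b.*2 (3 * b).+1).
Proof.
move=> b0; split.
  apply: (@triple_good _ _ _ _ [::]); [natlia|natlia|natlia|].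
  move=> c [Fp Fq F2 F3 F4] _ a.
  have cb : c b.+1 = 0.
    move: F3.
  have -> : ((3 * b).+1 - b.-1 = b.*2.+2)%N by natlia.
  have -> : ((3 * b).+1 - b.*2 = b.+1)%N by natlia.
    by rewrite F4 // mul0rn add0r => /mulrn_eq0K; apply.
  have c0 : c 0%N = 0.
    move: (F2 (leqnn _)); rewrite subnn.
  have -> : (b.*2 - b.-1 = b.+1)%N by natlia.
    by rewrite cb mul0rn add0r => /mulrn_eq0K; apply.
  have [->//|a0] := eqVneq a 0%N; have [->//|ab] := eqVneq a b.+1.
  have [le|gt] := leqP a b; first by apply: Fq; natlia.
  have [le'|gt'] := leqP a b.*2.+1; [by apply: Fp; natlia | by apply: F4; natlia].
apply: (@triple_good _ _ _ _ [:: 0; b.+1; b.+2]%N); [natlia|natlia|natlia|].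
move=> c [Fp Fq F2 F3 F4] sel a.
have c0 : c 0%N = 0 by apply: sel; rewrite !inE eqxx.
have cb1 : c b.+1 = 0 by apply: sel; rewrite !inE eqxx !orbT.
have cb2 : c b.+2 = 0 by apply: sel; rewrite !inE eqxx !orbT.
have c1 : c 1%N = 0.
  move: F2.
  have -> : (b.*2.+1 - b.*2 = 1)%N by natlia.
  have -> : (b.*2.+1 - b.-1 = b.+2)%N by natlia.
  by rewrite cb2 mul0rn add0r => /(_ (leqnSn _)) /mulrn_eq0K; apply.
have c2 : c b.*2.+2 = 0.
  move: F3.
  have -> : ((3 * b).+1 - b.-1 = b.*2.+2)%N by natlia.
  have -> : ((3 * b).+1 - b.*2 = b.+1)%N by natlia.
  by rewrite cb1 mul0rn addr0 => /mulrn_eq0K; apply.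
have [->//|a0] := eqVneq a 0%N; have [->//|ab] := eqVneq a b.+1.
have [->//|a1] := eqVneq a 1%N; have [->//|ab2] := eqVneq a b.+2.
have [->//|a2] := eqVneq a b.*2.+2.
have [le|gt] := leqP a b; first by apply: Fq; natlia.
have [le'|gt'] := leqP a b.*2.+1; [by apply: Fp; natlia | by apply: F4; natlia].
Qed.

Lemma triple2_good b : good_block b.*2.+1 0 (triple b.+1 b.*2.+2 (3 * b).+3) /\
  good_block b.*2.+2 2 (triple b.+1 b.*2.+2 (3 * b).+3).
Proof.
split.
  apply: (@triple_good _ _ _ _ [::]); [natlia|natlia|natlia|].
  move=> c [Fp Fq F2 F3 F4] _ a.
  have cb : c b.+1 = 0 by apply: Fp; natlia.
  have c2 : c b.*2.+2 = 0.
    move: F3.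
  have -> : ((3 * b).+3 - b.+1 = b.*2.+2)%N by natlia.
  have -> : ((3 * b).+3 - b.*2.+2 = b.+1)%N by natlia.
    by rewrite cb mul0rn addr0 => /mulrn_eq0K; apply.
  have [->//|a2] := eqVneq a b.*2.+2.
  have [le|gt] := leqP a b; first by apply: Fq; natlia.
  have [le'|gt'] := leqP a b.*2.+1; [by apply: Fp; natlia | by apply: F4; natlia].
apply: (@triple_good _ _ _ _ [:: b.+1; b.*2.+3]); [natlia|natlia|natlia|].
move=> c [Fp Fq F2 F3 F4] sel a.
have cb1 : c b.+1 = 0 by apply: sel; rewrite !inE eqxx.
have cb3 : c b.*2.+3 = 0 by apply: sel; rewrite !inE eqxx !orbT.
have c0 : c 0%N = 0.
  move: (F2 (leqnn _)); rewrite subnn.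
  have -> : (b.*2.+2 - b.+1 = b.+1)%N by natlia.
  by rewrite cb1 mul0rn add0r => /mulrn_eq0K; apply.
have c2 : c b.*2.+2 = 0.
  move: F3.
  have -> : ((3 * b).+3 - b.+1 = b.*2.+2)%N by natlia.
  have -> : ((3 * b).+3 - b.*2.+2 = b.+1)%N by natlia.
  by rewrite cb1 mul0rn addr0 => /mulrn_eq0K; apply.
have [->//|a0] := eqVneq a 0%N; have [->//|ab] := eqVneq a b.+1.
have [->//|a3] := eqVneq a b.*2.+3; have [->//|a2] := eqVneq a b.*2.+2.
have [le|gt] := leqP a b; first by apply: Fq; natlia.
have [le'|gt'] := leqP a b.*2.+1; [by apply: Fp; natlia | by apply: F4; natlia].
Qed.

Lemma triple3_good b : (0 < b)%N -> good_block b.*2 0 (triple b b.*2.+1 (3 * b).+2) /\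
  good_block b.*2.+1 1 (triple b b.*2.+1 (3 * b).+2).
Proof.
move=> b0; split.
  apply: (@triple_good _ _ _ _ [::]); [natlia|natlia|natlia|].
  move=> c [Fp Fq F2 F3 F4] _ a.
  have [le|gt] := leqP a b; first by apply: Fq; natlia.
  have [le'|gt'] := leqP a b.*2.+1; [by apply: Fp; natlia | by apply: F4; natlia].
apply: (@triple_good _ _ _ _ [:: b.+1]); [natlia|natlia|natlia|].
move=> c [Fp Fq F2 F3 F4] sel a.
have cb1 : c b.+1 = 0 by apply: sel; rewrite !inE eqxx.
have c0 : c 0%N = 0.
  move: (F2 (leqnn _)); rewrite subnn.
  have -> : (b.*2.+1 - b = b.+1)%N by natlia.
  by rewrite cb1 mul0rn add0r => /mulrn_eq0K; apply.
have c2 : c b.*2.+2 = 0.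
  move: F3.
  have -> : ((3 * b).+2 - b = b.*2.+2)%N by natlia.
  have -> : ((3 * b).+2 - b.*2.+1 = b.+1)%N by natlia.
  by rewrite cb1 mul0rn addr0 => /mulrn_eq0K; apply.
have [->//|a0] := eqVneq a 0%N; have [->//|ab] := eqVneq a b.+1.
have [->//|a2] := eqVneq a b.*2.+2.
have [le|gt] := leqP a b; first by apply: Fq; natlia.
have [le'|gt'] := leqP a b.*2.+1; [by apply: Fp; natlia | by apply: F4; natlia].
Qed.

End Layouts.

Section Layout.
Variable K : numClosedFieldType.
Implicit Types (z : nat -> {poly K}) (bs : seq (block K * nat)).

(* The conditions are indexed by the exponents of y minus 2.  Each block is followed by f + 2
   unconstrained [tdiff z i], where the monomial generators of the linear system live; this leaves
   f unknowns [z i] free. *)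
Fixpoint lrow w bs (a i : nat) : K :=
  if bs is (b, f) :: bs' then
    if (a < brows b)%N then (if (w <= i < w + blen b)%N then brow b a (i - w) else 0)
    else lrow (w + blen b + f.+2) bs' (a - brows b) i
  else 0.

Fixpoint lend w bs : nat :=
  if bs is (b, f) :: bs' then lend (w + blen b + f.+2) bs' else w.

Fixpoint lpos w bs : seq nat :=
  if bs is (b, f) :: bs' then (w + blen b)%N :: lpos (w + blen b + f.+2) bs' else [::].

Definition total_rows bs := sumn [seq brows x.1 | x <- bs].

Lemma lend_ge w bs : (w <= lend w bs)%N.
Proof.
elim: bs w => //= -[b f] bs IH w; apply: leq_trans (IH (w + blen b + f.+2)%N).
by rewrite -addnA leq_addr.
Qed.

Lemma lend_sum w bs : lend w bs = (w + sumn [seq blen x.1 + x.2.+2 | x <- bs])%N.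
Proof. by elim: bs w => [|[b f] bs IH] w /=; rewrite ?addn0 // IH !addnA. Qed.

Lemma window_sum w l E (c : nat -> K) (F : nat -> {poly K}) : (w + l <= E)%N ->
  \sum_(i < E) (if (w <= i < w + l)%N then c (i - w)%N else 0) *: F i = \sum_(i < l) c i *: F (w + i)%N.
Proof.
move=> le; rewrite -(big_mkord xpredT (fun i => (if (w <= i < w + l)%N then c (i - w)%N else 0) *: F i)).
rewrite (big_cat_nat (n := w)) //=; last by apply: leq_trans le; apply: leq_addr.
rewrite [X in X + _]big_nat [X in X + _]big1 ?add0r => [|i /andP [_ lt]]; last first.
  by rewrite leqNgt lt scale0r.
rewrite (big_cat_nat (n := w + l)%N) ?leq_addr //=.
rewrite [X in _ + X]big_nat [X in _ + X]big1 ?addr0 => [|i /andP [ge _]]; last first.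
  by rewrite [(i < _)%N]ltnNge ge andbF scale0r.
have shift (G : nat -> {poly K}) : \sum_(w <= i < w + l) G i = \sum_(i < l) G (w + i)%N.
  elim: (l) => [|m IH]; first by rewrite addn0 big_geq // big_ord0.
  by rewrite addnS big_nat_recr ?leq_addr //= big_ord_recr IH.
rewrite shift; apply: eq_bigr => i _.
by rewrite leq_addr ltn_add2l ltn_ord addKn.
Qed.

Lemma layout_good e (bs : seq (block K * nat)) (cs : seq nat) w :
    size cs = size bs ->
    (forall i, (i < size bs)%N -> forall x0, good_block e (nth 0 cs i) (nth x0 bs i).1) ->
  exists sel : seq (bool * nat * nat), (size sel <= sumn cs + sumn [seq x.2 | x <- bs] * e)%N /\
    forall z E, (lend w bs <= E)%N ->
    (forall j, (w <= j < lend w bs)%N -> (size (z j) <= e)%N) ->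
    (forall a, (a < total_rows bs)%N -> \sum_(i < E) lrow w bs a i *: tdiff z i = 0) ->
    (forall x, x \in sel -> probe z x = 0) ->
  forall j, (w <= j < lend w bs)%N -> z j = 0.
Proof.
elim: bs cs w => [|[b f] bs IH] [|c cs] w //=.
  move=> _ _; exists [::]; split=> // z E _ _ _ _ j /andP [le lt].
  by move: lt; rewrite ltnNge le.
case=> szcs good; set w' := (w + blen b + f.+2)%N.
have [sel' [sz' H']] := IH cs w' szcs (fun i lt x0 => good i.+1 lt x0).
have [sb [szb Hb]] := good 0%N isT (b, f).
exists ([seq (x.1.1, (w + x.1.2)%N, x.2) | x <- sb] ++
  [seq (false, j, t) | j <- iota (w + blen b).+2 f, t <- iota 0 e] ++ sel'); split.
  rewrite !size_cat size_map size_allpairs !size_iota.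
  have := leq_add szb sz'; rewrite /= !mulnDl; lia.
move=> z E leE szz eqs sel.
have lew' := lend_ge w' bs.
have wE : (w + blen b <= E)%N by apply: leq_trans (leq_trans lew' leE); rewrite /w' leq_addr.
have zb j : (j < (blen b).+2)%N -> z (w + j)%N = 0.
  have shift z' i : tdiff (fun j => z' (w + j)%N) i = tdiff z' (w + i) by rewrite /tdiff !addnS.
  move: j; apply: (Hb (fun j => z (w + j)%N)).
  - move=> j lt; apply: szz; rewrite leq_addr /=.
    by apply: leq_trans lew'; rewrite /w' -addnA ltn_add2l; apply: leq_trans lt _; rewrite !addnS !ltnS leq_addr.
  - move=> a lt; have /= := eqs a (ltn_addr _ lt); rewrite lt.
    rewrite (window_sum _ _ wE) => E0; rewrite -[RHS]E0; apply: eq_bigr => i _.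
    by rewrite shift.
  move=> x xs; have := sel (x.1.1, (w + x.1.2)%N, x.2).
  rewrite mem_cat; have -> /= : (x.1.1, (w + x.1.2)%N, x.2) \in [seq (x.1.1, (w + x.1.2)%N, x.2) | x <- sb].
    by apply: map_f.
  by move=> /(_ isT); rewrite /probe /= shift.
have zf j : (w + (blen b).+2 <= j < w')%N -> z j = 0.
  move=> /andP [ge lt]; apply/polyP=> t; rewrite coef0.
  have [te|et] := ltnP t e; last first.
    rewrite nth_default //; apply: leq_trans et; apply: szz.
    by rewrite (leq_trans lt lew') andbT; apply: leq_trans ge; apply: leq_addr.
  have := sel (false, j, t); rewrite /probe /=; apply; rewrite !mem_cat.
  apply/orP; right; apply/orP; left; apply/allpairsP; exists (j, t); split=> //=; rewrite mem_iota //.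
  by move: ge lt; rewrite /w'; lia.
have zr j : (w' <= j < lend w' bs)%N -> z j = 0.
  move: j; apply: (H' z E leE).
  - move=> j /andP [ge lt]; apply: szz; rewrite lt andbT; apply: leq_trans ge.
    by rewrite /w' -addnA leq_addr.
  - move=> a lt; have /= := eqs (brows b + a)%N (etrans (ltn_add2l _ _ _) lt).
    by under eq_bigr => i _ do rewrite ltnNge leq_addr /= addKn.
  by move=> x xs; apply: sel; rewrite !mem_cat xs !orbT.
move=> j /andP [ge lt]; have [lt1|ge1] := ltnP j (w + (blen b).+2).
  by rewrite -(subnKC ge); apply: zb; lia.
by have [lt2|ge2] := ltnP j w'; [apply: zf; rewrite ge1 | apply: zr; rewrite ge2].
Qed.

Lemma lrow_low w bs a i : (i < w)%N -> lrow w bs a i = 0.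
Proof.
elim: bs w a => //= -[b f] bs IH w a iw; case: ifP => _; first by rewrite leqNgt iw.
by apply: IH; apply: ltn_addr; apply: ltn_addr.
Qed.

Lemma lpos_ge w bs i : (i < size bs)%N -> (w <= nth 0 (lpos w bs) i)%N.
Proof.
elim: bs w i => //= -[b f] bs IH w [|i] /= lt; first exact: leq_addr.
by apply: leq_trans (IH (w + blen b + f.+2)%N _ lt); rewrite -addnA leq_addr.
Qed.

Lemma lrow_pos w bs a i c : (i < size bs)%N -> (c < (nth 0 [seq x.2 | x <- bs] i).+2)%N ->
  lrow w bs a (nth 0 (lpos w bs) i + c)%N = 0.
Proof.
elim: bs w a i => //= -[b f] bs IH w a [|i] /= lt cf.
  rewrite [(_ + c < _)%N]ltnNge leq_addr andbF; case: ifP => // _.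
  by apply: lrow_low; rewrite ltn_add2l.
case: ifP => _; last exact: IH.
rewrite [X in _ && X]ltnNge (_ : (w + blen b <= _)%N) ?andbF //.
apply: leq_trans (leq_addr c _); apply: leq_trans (lpos_ge _ lt).
exact: leq_addr.
Qed.

Lemma lpos_end w bs i : (i < size bs)%N ->
  (nth 0 (lpos w bs) i + (nth 0 [seq x.2 | x <- bs] i).+2 <= lend w bs)%N.
Proof.
elim: bs w i => //= -[b f] bs IH w [|i] /= lt; last exact: IH.
exact: lend_ge.
Qed.

Lemma lpos_lt w bs i j : (i < j)%N -> (j < size bs)%N ->
  (nth 0 (lpos w bs) i + (nth 0 [seq x.2 | x <- bs] i).+2 <= nth 0 (lpos w bs) j)%N.
Proof.
elim: bs w i j => //= -[b f] bs IH w [|i] [|j] //= lt lt'; last exact: IH.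
exact: lpos_ge.
Qed.

End Layout.

Section Examples.
Variable K : numClosedFieldType.

Definition block_choice A k B (bl : seq (block K)) (cs : seq nat) :=
  [/\ size bl = A./2, size cs = size bl,
      forall i x0, (i < size bl)%N ->
        good_block B 0 (nth x0 bl i) /\ good_block B.+1 (nth 0 cs i) (nth x0 bl i)
    & [/\ sumn [seq brows b | b <- bl] = k, sumn [seq blen b | b <- bl] = (k + odd A)%N
        & (sumn cs + 2 * k = A * B.+1)%N]].

Lemma run_choice m y B : (y <= m)%N -> block_choice m.*2 (m * B + y) B
  (nseq y (run K B.+1) ++ nseq (m - y) (run K B)) (nseq y 0 ++ nseq (m - y) 2)%N.
Proof.
move=> ym; split.
- by rewrite size_cat !size_nseq subnKC // doubleK.
- by rewrite !size_cat !size_nseq.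
- move=> i x0; rewrite size_cat !size_nseq subnKC // => im; rewrite !nth_cat !size_nseq !nth_nseq.
  case: ltnP => [iy|yi]; first by split; apply: run_good.
  rewrite ltn_sub2r //; last exact: leq_ltn_trans im.
  by split; [apply: run_good | apply: run_good2].
rewrite !map_cat !map_nseq !sumn_cat !sumn_nseq /= odd_double; split; nia.
Qed.

Lemma triple_choice m y B k' c p q : (y <= m)%N ->
    good_block B 0 (triple K p q k'.+1) -> good_block B.+1 c (triple K p q k'.+1) ->
    (c + 2 * k' = 3 * B.+1)%N ->
  block_choice m.*2.+3 (k' + (m * B + y)) B
    (triple K p q k'.+1 :: nseq y (run K B.+1) ++ nseq (m - y) (run K B))
    (c :: nseq y 0 ++ nseq (m - y) 2)%N.
Proof.
move=> ym g0 g1 ck; have [s1 s2 H [b1 b2 b3]] := run_choice B ym; split.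
- by move: s1 => /= ->; rewrite doubleK uphalf_double.
- by rewrite /= s2.
- by case=> [|i] x0 //= lt; apply: H.
rewrite /= b1 b2 odd_double /=; split=> //; first by rewrite addn0 addn1.
by move: b3; nia.
Qed.

Lemma choose_blocks A k (B := (2 * k %/ A)%N) : (2 <= A)%N -> (0 < B)%N ->
  exists bl cs, block_choice A k B bl cs.
Proof.
move=> A2 B0; have A0 : (0 < A)%N by apply: leq_trans A2.
have dv := divn_eq (2 * k) A; have lt := ltn_pmod (2 * k) A0; rewrite -/B in dv.
set x := ((2 * k) %% A)%N in dv lt; clearbody x B.
have [m [Am | Am]] : exists m, A = m.*2 \/ A = m.*2.+3.
  case oA : (odd A); last by exists A./2; left; rewrite -[LHS]odd_double_half oA.
  exists A./2.-1; right; have := odd_double_half A; rewrite oA; lia.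
- have ke : k = (m * B + (k - m * B))%N by rewrite subnKC //; nia.
  rewrite ke Am; exists (nseq (k - m * B) (run K B.+1) ++ nseq (m - (k - m * B)) (run K B)).
  exists (nseq (k - m * B) 0 ++ nseq (m - (k - m * B)) 2)%N.
  by apply: run_choice; nia.
have [b [Bb | Bb]] : exists b, B = b.*2 \/ B = b.*2.+1.
  by exists B./2; have := odd_double_half B; case: (odd B); lia.
- have b0 : (0 < b)%N by lia.
  have [g0 g1] := triple1_good K b0; have [h0 h1] := triple3_good K b0.
  have [xm|mx] := leqP x m.*2.
    have ke : k = (3 * b + (m * B + x./2))%N.
      have := odd_double_half x; have : odd x = false.
        by have := congr1 odd dv; rewrite oddD !oddM Bb odd_double /= => <-.
      by move=> ->; nia.
    rewrite ke Am Bb; eexists; eexists; apply: (triple_choice _ g0 g1); lia.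
  have ke : k = ((3 * b).+1 + (m * B + m))%N by nia.
  rewrite ke Am Bb; eexists; eexists; apply: (triple_choice _ h0 h1); lia.
have [g0 g1] := triple2_good K b.
have ox : odd x.
  by have := congr1 odd dv; rewrite oddD !oddM Bb Am /= !odd_double /=; case: (odd x).
have ke : k = ((3 * b).+2 + (m * B + x./2))%N.
  by have := odd_double_half x; rewrite ox; nia.
rewrite ke Am Bb; eexists; eexists; apply: (triple_choice _ g0 g1); lia.
Qed.

Definition probe_map n e (sel : seq (bool * nat * nat)) (M : 'M[K]_(n.+1, e)) : 'rV[K]_(size sel) :=
  \row_i probe (fun j => (zpoly M)`_j) (nth (false, 0, 0)%N sel i).

Lemma probe_map_is_linear n e sel : linear (@probe_map n e sel).
Proof.
move=> a M1 M2; apply/rowP=> i; rewrite !mxE /probe; set x := nth (false, 0, 0)%N sel i.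
have E j : (zpoly (a *: M1 + M2))`_j = a *: (zpoly M1)`_j + (zpoly M2)`_j.
  by rewrite zpoly_is_linear coefD coefZ mul_polyC.
case: ifP => _ /=; last by rewrite E coefD coefZ.
rewrite /tdiff !E !mulrDr -!scalerAr !(coefD, coefN, coefZ); ring.
Qed.
HB.instance Definition _ n e sel := GRing.isLinear.Build K 'M[K]_(n.+1, e) 'rV[K]_(size sel) _
  (@probe_map n e sel) (@probe_map_is_linear n e sel).

Lemma rank_of_probes n k e T (V : 'M[K]_(k, n.+3)) sel : (size sel <= T)%N ->
    (forall M : 'M[K]_(n.+1, e), (forall a, vap (row a V) (zpoly M * Dsq K) = 0) ->
       (forall x, x \in sel -> probe (fun j => (zpoly M)`_j) x = 0) -> zpoly M = 0) ->
  (n.+1 * e - T <= \rank (lin_mx (@syz_map K n k e V)))%N.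
Proof.
move=> sT H; set S := lin_mx _; pose Q := lin1_mx (@probe_map n e sel \o vec_mx).
have KQ : (kermx S :&: kermx Q)%MS = 0.
  apply/eqP/rowV0P=> y; rewrite sub_capmx => /andP [/sub_kermxP yS /sub_kermxP yQ].
  have M0 : syz_map V (vec_mx y) = 0.
    by apply: (can_inj mxvecK); rewrite linear0 -[RHS]yS -[in RHS](vec_mxK y) mul_vec_lin.
  rewrite -[LHS]vec_mxK; suff -> : vec_mx y = 0 :> 'M[K]_(n.+1, e) by rewrite linear0.
  apply: zpoly_inj; apply: H; first by apply/syz_map_eq0.
  move=> x xs; move: yQ; rewrite mul_rV_lin1 /= => /rowP.
  have lt : (index x sel < size sel)%N by rewrite index_mem.
  by move/(_ (Ordinal lt)); rewrite !mxE nth_index.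
have := mxrank_mul_ker (kermx S) Q; rewrite KQ mxrank0 addn0 mxrank_ker.
move=> rk; rewrite leq_subLR addnC -leq_subLR -rk; apply: leq_trans (rank_leq_col _) sT.
Qed.

Lemma monomials_indep fs (ms : nat -> nat) :
    (forall i j, (i < j)%N -> (j < size fs)%N -> (ms i + (nth 0 fs i + 2) <= ms j)%N) ->
  lin_indep (fun j : 'I_(size (shifts 2 fs)) => shift_family 2 fs (fun i => 'X^(ms i) : {poly K}) j).
Proof.
move=> dis; apply: shift_indep => h hb E i ilt; apply/polyP=> c; rewrite coef0.
have [lt|ge] := ltnP c (nth 0 fs i + 2)%N; last by rewrite nth_default // (leq_trans (hb i ilt)).
have := congr1 (fun f : {poly K} => f`_(ms i + c)) E; rewrite coef_sum coef0 /=.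
rewrite (bigD1 (Ordinal ilt)) //= coefMXn ltnNge leq_addr addKn big1 ?addr0 // => -[j jlt] /eqP ji.
rewrite coefMXn /=; case: ltnP => // le; rewrite nth_default //; apply: leq_trans (hb j jlt) _.
have [ij|ij|ij] := ltngtP i j; first by have := dis i j ij jlt; lia.
  by have := dis j i ij ilt; lia.
by case: ji; apply: val_inj.
Qed.

Definition layout_mx k n w (bs : seq (block K * nat)) : 'M[K]_(k, n.+3) :=
  \matrix_(a, i) (if (i < 2)%N then 0 else lrow w bs a (i - 2)).

Lemma vap_layout k n w bs e (M : 'M[K]_(n.+1, e)) a :
  vap (row a (layout_mx k n w bs)) (zpoly M * Dsq K) =
    \sum_(i < n.+1) lrow w bs a i *: tdiff (fun j => (zpoly M)`_j) i.
Proof.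
rewrite /vap big_ord_recl big_ord_recl !mxE /= !scale0r !add0r; apply: eq_bigr => i _.
by rewrite !mxE coef_mul_Dsq /= /bump /= !add1n /tdiff !subSS !subn0.
Qed.

Lemma layout_rank n k e T w (bs : seq (block K * nat)) cs :
    lend w bs = n.+1 -> total_rows bs = k -> size cs = size bs ->
    (forall i, (i < size bs)%N -> forall x0, good_block e (nth 0 cs i) (nth x0 bs i).1) ->
    (w * e + (sumn cs + sumn [seq x.2 | x <- bs] * e) <= T)%N ->
  (n.+1 * e - T <= \rank (lin_mx (@syz_map K n k e (layout_mx k n w bs))))%N.
Proof.
move=> lE tr sc good sT; have [sel [ss H]] := layout_good w sc good.
pose sel0 := [seq (false, j, t) | j <- iota 0 w, t <- iota 0 e].
apply: (@rank_of_probes _ _ _ _ _ (sel0 ++ sel)).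
  by rewrite size_cat size_allpairs !size_iota; apply: leq_trans sT; rewrite leq_add2l.
move=> M vM pM; have sM j : (size ((zpoly M)`_j)%R <= e)%N.
  have [lt|ge] := ltnP j n.+1; first by rewrite -[j]/(val (Ordinal lt)) coef_zpoly size_poly.
  by rewrite [in size _]nth_default ?size_poly0 // (leq_trans (size_zpoly M)).
apply/polyP=> j; rewrite coef0; have [lt|ge] := ltnP j n.+1; last first.
  by rewrite nth_default // (leq_trans (size_zpoly M)).
have [jw|wj] := ltnP j w; last first.
  apply: (H (fun j => (zpoly M)`_j) n.+1); rewrite ?lE // ?wj //.
    move=> a; rewrite tr => ak; rewrite -[RHS](vM (Ordinal ak)) vap_layout //.
  by move=> x xs; apply: pM; rewrite mem_cat xs orbT.
apply/polyP=> t; rewrite coef0; have [te|et] := ltnP t e; last first.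
  by rewrite nth_default // (leq_trans (sM j)).
apply: (pM (false, j, t)); rewrite mem_cat; apply/orP; left.
by apply/allpairsP; exists (j, t); rewrite !mem_iota.
Qed.

Lemma example_exists n k fs A (B := (2 * k %/ A)%N) :
    all (leq 1) fs -> (0 < size fs)%N -> (k + 3 * sumn fs <= n.+3)%N ->
    (n.+1 = k + sumn fs + A)%N -> (2 <= A)%N -> (0 < B)%N ->
  exists (V : 'M[K]_(k, n.+3)) (ms : nat -> nat),
    [/\ forall i, (i < size fs)%N -> (ms i + nth 0 fs i < n.+2)%N,
        forall a i c, (i < size fs)%N -> (c < nth 0 fs i + 2)%N ->
          pairing (row a V) ('X^(ms i) * 'X^c) = 0,
        lin_indep (fun j : 'I_(size (shifts 2 fs)) => shift_family 2 fs (fun i => 'X^(ms i) : {poly K}) j),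
        (n.+1 * B - sumn fs * B <= \rank (lin_mx (@syz_map K n k B V)))%N
      & (n.+1 * B.+1 - ((A + sumn fs) * B.+1 - 2 * k) <= \rank (lin_mx (@syz_map K n k B.+1 V)))%N].
Proof.
case: fs => // f fs /= /andP [f1 fs1] _ le nE A2 B0.
have [bl [cs [b1 b2 good [b3 b4 b5]]]] := choose_blocks A2 B0.
have sfs : (size fs <= A./2)%N.
  have : (size fs <= sumn fs)%N.
    by elim: (fs) fs1 => //= x s IH /andP [x1 /IH]; lia.
  by lia.
pose seps := fs ++ nseq (A./2 - size fs) 0%N.
have sz : size seps = size bl by rewrite size_cat size_nseq subnKC.
pose bs := zip bl seps.
have u1 : [seq x.1 | x <- bs] = bl by rewrite -/(unzip1 bs) unzip1_zip // sz.
have u2 : [seq x.2 | x <- bs] = seps by rewrite -/(unzip2 bs) unzip2_zip // sz.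
have sbs : size bs = A./2 by rewrite size1_zip ?sz.
have sseps : sumn seps = sumn fs by rewrite sumn_cat sumn_nseq mul0n addn0.
have lE : lend f bs = n.+1.
  rewrite lend_sum.
  have -> : sumn [seq blen x.1 + x.2.+2 | x <- bs] = (sumn [seq blen b | b <- bl] + sumn seps + 2 * size bs)%N.
    rewrite -u1 -u2; elim: (bs) => //= -[b f'] s /= ->; lia.
  rewrite b4 sseps sbs; lia.
have tr : total_rows bs = k by rewrite /total_rows -b3 -[in RHS]u1 -map_comp.
have n2 i : (i < size fs)%N -> nth 0%N seps i = nth 0%N fs i by move=> lt; rewrite nth_cat lt.
have lt2 i : (i < size fs)%N -> (i < size bs)%N by move=> lt; rewrite sbs; apply: leq_trans sfs.
have nbs i x0 : (i < size bs)%N -> (nth x0 bs i).1 = nth x0.1 bl i.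
  by case: x0 => x y lt; rewrite nth_zip ?sz.
pose ms i := if i is j.+1 then (nth 0%N (lpos f bs) j).+2 else 0%N.
exists (layout_mx k n f bs), ms; split.
- case=> [|i] lt; first by rewrite /= add0n ltnS -lE; apply: lend_ge.
  have := lpos_end f (lt2 i lt); rewrite u2 n2 // lE /=; lia.
- move=> a i c lt cf; rewrite -exprD /pairing big1 // => j _; rewrite !mxE coefXn.
  case: eqP => [jE|_]; last by rewrite mulr0.
  rewrite jE; case: i lt cf jE => [|i] lt cf jE /=.
    rewrite add0n; case: ifP => c2; first by rewrite mul0r.
    rewrite lrow_low ?mul0r //; move: cf c2; rewrite /=; lia.
  rewrite !addSn !subSS subn0 lrow_pos ?mul0r ?lt2 //.
  by rewrite u2 n2 // -addn2.
- apply: monomials_indep => -[|i] [|j] //= ij lt.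
    rewrite add0n addn2 !ltnS; apply: lpos_ge; exact: lt2.
  have := @lpos_lt _ f bs i j ij (lt2 j lt); rewrite u2 n2; last exact: ltn_trans (ij : (i < j)%N) (lt : (j < size fs)%N).
  lia.
- apply: (@layout_rank _ _ _ _ _ _ (nseq (size bs) 0%N)) => //; first by rewrite size_nseq.
    move=> i lt x0; rewrite nth_nseq lt nbs //.
    by have [] := good i x0.1; rewrite -?b1 // b1 -sbs.
  by rewrite sumn_nseq mul0n add0n u2 sseps mulnDl.
apply: (@layout_rank _ _ _ _ _ _ cs) => //; first by rewrite b2 b1.
  move=> i lt x0; rewrite nbs //.
  by have [] := good i x0.1; rewrite -?b1 // b1 -sbs.
rewrite u2 sseps; nia.
Qed.

End Examples.

(** * The general splitting type *)

Section GenericSplitting.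
Variable K : numClosedFieldType.

Lemma generic_splitting n k N A r (p : 'I_(2 + N) -> binary_form K n.+2)
    (L : {vspace binary_form K n.+2}) (pi : 'Hom(binary_form K n.+2, 'rV[K]_(2 + N)))
    (B := (2 * k %/ A)%N) :
    (k + N = n.+1)%N -> \dim L = k -> misses_rnc L -> projection_from L pi p ->
    ordinary_singularities p -> (A + r = N)%N -> (0 < A)%N -> in_base_locus_of_some_system r L ->
    A = 1%N \/ ~ (many_quotients B (r * B) L \/ many_quotients B.+1 ((A + r) * B.+1 - 2 * k) L) ->
  normal_bundle_iso p (nseq r (n.+2%:Z + 2) ++ nseq (A + B * A - 2 * k) (n.+2%:Z + 2 + B%:Z) ++
    nseq (2 * k - B * A) (n.+2%:Z + 3 + B%:Z)).
Proof.
move=> kN dimL missL Lp ord AN A0 XL gen.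
have [d [iso sd]] := curve_splits missL Lp ord.
have [d2 cnt _ quot] := base_locus_count kN dimL Lp iso.
pose s := [seq (d i - 2)%N | i <- enum 'I_N].
have sumE (F : nat -> nat) : (\sum_(x <- s) F x = \sum_i F (d i - 2))%N.
  by rewrite big_map big_enum.
have few e T : ~ many_quotients e T L -> (\sum_(x <- s) (e - x) <= T)%N.
  rewrite sumE leqNgt => nm; apply/negP=> lt; apply: nm.
  by have [Y [fY HY]] := quot e; exists (\sum_i (e - (d i - 2)))%N, Y.
apply: (normal_bundle_isoP (d := d)) => //.
pose sh (x : nat) : int := (n.+4 + x)%:Z.
have -> : [seq (n.+2 + d i)%:Z | i <- enum 'I_N] = map sh s.
  rewrite /s -[RHS]map_comp; apply: eq_map => i; have := d2 i; rewrite /sh /=; lia.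
have -> : nseq r (n.+2%:Z + 2) ++ nseq (A + B * A - 2 * k) (n.+2%:Z + 2 + B%:Z) ++
    nseq (2 * k - B * A) (n.+2%:Z + 3 + B%:Z) =
    map sh (nseq r 0 ++ nseq (A + B * A - 2 * k) B ++ nseq (2 * k - B * A) B.+1)%N.
  rewrite !map_cat !map_nseq /sh; congr (nseq _ _ ++ nseq _ _ ++ nseq _ _); lia.
apply: perm_map; apply: balanced_type => //.
- by rewrite size_map size_enum_ord AN.
- rewrite sumnE (sumE id); have : (\sum_i (d i - 2) + \sum_(i < N) 2 = \sum_i d i)%N.
    by rewrite -big_split; apply: eq_bigr => i _; apply: subnK.
  by rewrite sd sum_nat_const card_ord; lia.
- apply: leq_trans (cnt r XL) _; rewrite count_map -sum1_count big_enum_cond -sum1_card.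
  rewrite leq_eqVlt; apply/orP; left; apply/eqP/eq_bigl => i /=.
  by rewrite inE subn_eq0 eqn_leq d2 andbT.
case: gen => [->|/boolp.not_orP [n1 n2]]; [by left | right].
by split; apply: few.
Qed.

Definition family_mx n u (F : 'I_u -> {poly K}) : 'M[K]_(n.+1, u) := \matrix_(i, j) (F j)`_i.

Lemma family_mx_inj n u (F : 'I_u -> {poly K}) : (forall j, (size (F j) <= n.+1)%N) ->
  inj_cols (family_mx n F) <-> lin_indep F.
Proof.
move=> sF; have E (x : 'cV_u) i : (family_mx n F *m x) i 0 = (\sum_j x j 0 *: F j)`_i.
  by rewrite mxE coef_sum; apply: eq_bigr => j _; rewrite mxE coefZ mulrC.
split=> [inj c c0 i | ind x x0].
  have /inj/colP/(_ i) : family_mx n F *m \col_j c j = 0; last by rewrite !mxE.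
  apply/colP=> l; rewrite E mxE; under eq_bigr => j _ do rewrite mxE.
  by rewrite c0 coef0.
apply/colP=> j; rewrite mxE; apply: (ind (fun j => x j 0)); apply/polyP=> i; rewrite coef0.
have [lt|ge] := ltnP i n.+1; first by rewrite -[i]/(val (Ordinal lt)) -E x0 mxE.
rewrite nth_default //; apply: leq_trans ge; apply: leq_trans (size_sum _ _ _) _.
by apply/bigmax_leqP=> l _; apply: leq_trans (size_scale_leq _ _) (sF l).
Qed.

Lemma mul_family_mx n k u (V : 'M[K]_(k, n.+1)) (F : 'I_u -> {poly K}) a j :
  (V *m family_mx n F) a j = pairing (row a V) (F j).
Proof. by rewrite mxE; apply: eq_bigr => i _; rewrite !mxE. Qed.

Lemma lin_indep_sub r u (F : 'I_u -> {poly K}) (h : 'I_r -> 'I_u) : injective h ->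
  lin_indep F -> lin_indep (fun i => F (h i)).
Proof.
move=> hi iF c E i; have : \sum_(j | h j == h i) c j = 0.
  apply: (iF (fun l => \sum_(j | h j == l) c j)); rewrite -[RHS]E.
  rewrite [RHS](partition_big h xpredT) //=; apply: eq_bigr => l _.
  by rewrite scaler_suml; apply: eq_bigr => j /eqP ->.
by rewrite (big_pred1 i) // => j; rewrite /= (inj_eq hi).
Qed.

Lemma base_locus_of_shifts n fs (g : nat -> {poly K}) (L : {vspace binary_form K n.+2}) :
    all (leq 1) fs -> (forall i, (i < size fs)%N -> (size (g i) + nth 0%N fs i <= n.+2)%N) ->
    lin_indep (fun j : 'I_(size (shifts 2 fs)) => shift_family 2 fs g j) ->
    (forall v (j : 'I_(size (shifts 2 fs))), v \in L -> pairing (coords v) (shift_family 2 fs g j) = 0) ->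
  in_base_locus_of_some_system (sumn fs) L.
Proof.
move=> fs1 sg ind pg; have szE : size (shifts 0 fs) = sumn fs by rewrite size_shifts muln0 addn0.
have mem0 (j : 'I_(size (shifts 0 fs))) : nth (0, 0)%N (shifts 0 fs) j \in shifts 0 fs by apply: mem_nth.
have in2 x c : x \in shifts 0 fs -> (c < 3)%N -> (x.1, x.2 + c)%N \in shifts 2 fs.
  rewrite !mem_shifts /= => /andP [-> lt] c3; move: lt c3; lia.
rewrite -szE; apply/base_locusP=> //; exists (fun j => shift_family 0 fs g j); split.
- have lt2 (j : 'I_(size (shifts 0 fs))) : (index (nth (0, 0)%N (shifts 0 fs) j) (shifts 2 fs) < size (shifts 2 fs))%N.
    have := in2 _ 0%N (mem0 j) isT; rewrite addn0 -surjective_pairing index_mem; exact.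
  have hi : injective (fun j => Ordinal (lt2 j)).
    move=> i j /(congr1 val) /= E; apply: val_inj; apply/eqP.
    rewrite -(nth_uniq (0, 0)%N (ltn_ord i) (ltn_ord j) (uniq_shifts 0 fs)); apply/eqP.
    rewrite -[LHS](nth_index (0, 0)%N (s := shifts 2 fs)) -?index_mem ?lt2 // E nth_index // -index_mem lt2 //.
  have := lin_indep_sub hi ind; congr lin_indep; apply: boolp.funext => j.
  by rewrite /shift_family /= nth_index // -index_mem lt2.
- move=> j; have := mem0 j; rewrite mem_shifts /shift_family /=.
  set x := nth _ (shifts 0 fs) j => /andP [lt1 lt2].
  apply: leq_trans (size_polyMleq _ _) _; rewrite size_polyXn.
  by have := sg _ lt1; move: lt2; lia.
move=> v i j vL j3; rewrite /shift_family -mulrA -exprD.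
have m2 := in2 _ j (mem0 i) j3; move: (m2); rewrite -index_mem => lt2.
have := pg v (Ordinal lt2) vL; rewrite /shift_family /= nth_index //.
Qed.

Lemma generic_path n k r A (L : {vspace binary_form K n.+2}) (B := (2 * k %/ A)%N) :
    \dim L = k -> in_base_locus_of_some_system r L -> (0 < r)%N -> (k + 3 * r <= n.+3)%N ->
    (n.+1 = k + r + A)%N -> (2 <= A)%N -> (0 < B)%N ->
  exists (b : K -> k.-tuple (binary_form K n.+2))
         (x : 'I_(k * \dim {:binary_form K n.+2}) -> {poly K}) (pi : {poly K}),
    [/\ forall s l, tuple_coords (b s) l = (x l).[s], free (b 0), <<b 0%R>>%VS = L, pi != 0
      & forall s, pi.[s] != 0 -> [/\ free (b s), in_base_locus_of_some_system r <<b s>>%VS &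
          ~ (many_quotients B (r * B) <<b s>>%VS \/
             many_quotients B.+1 ((A + r) * B.+1 - 2 * k) <<b s>>%VS)]].
Proof.
move=> dimL; subst k => /base_locusP [] // phi [iphi sphi Pphi] r0 le nE A2 B0.
pose P (f : {poly K}) := forall v, v \in L -> pairing (coords v) f = 0.
have P0 : P 0 by move=> v _; rewrite linear0.
have Plin a f1 f2 : P f1 -> P f2 -> P (a *: f1 + f2).
  by move=> p1 p2 v vL; rewrite linearP /= p1 // p2 // mulr0 addr0.
have Pq i (q : {poly K}) : (size q <= 3)%N -> P (phi i * q).
  move=> sq v vL; rewrite -[q]coefK poly_def mulr_sumr linear_sum big1 // => j _.
  by rewrite -scalerAr linearZ /= Pphi ?mulr0 //; apply: leq_trans sq.
have [fs [g [fsr fs1 Hg indg]]] := forms_structure P0 Plin (ltn0Sn n.+1) iphi sphi Pq.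
have fs0 : (0 < size fs)%N by case: (fs) fsr r0 => //= <-.
rewrite -fsr in le nE *.
have [V1 [ms [msb p1 ind1 rk1 rk2]]] := example_exists K fs1 fs0 le nE A2 B0.
set b0 := vbasis L; set V0 := tuple_mx b0.
set S := shifts 2 fs in indg ind1 *.
pose F0 (j : 'I_(size S)) := shift_family 2 fs g j.
pose F1 (j : 'I_(size S)) := shift_family 2 fs (fun i => 'X^(ms i) : {poly K}) j.
have memS (j : 'I_(size S)) : ((nth (0, 0) S j).1 < size fs)%N /\
    ((nth (0, 0) S j).2 < nth 0 fs (nth (0, 0) S j).1 + 2)%N.
  by apply/andP; rewrite -mem_shifts mem_nth.
have szF (h : nat -> {poly K}) : (forall i, (i < size fs)%N -> (size (h i) + nth 0%N fs i <= n.+2)%N) ->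
    forall j : 'I_(size S), (size (shift_family 2 fs h j) <= n.+3)%N.
  move=> sh j; have [lt1 lt2] := memS j; rewrite /shift_family -/S.
  apply: leq_trans (size_polyMleq _ _) _; rewrite size_polyXn.
  by have := sh _ lt1; move: lt2; lia.
have sg i : (i < size fs)%N -> (size (g i) + nth 0%N fs i <= n.+2)%N by case/Hg.
have sX i : (i < size fs)%N -> (size ('X^(ms i) : {poly K}) + nth 0%N fs i <= n.+2)%N.
  by move=> lt; rewrite size_polyXn addSn; apply: msb.
have E0 : V0 *m family_mx n.+2 F0 = 0.
  apply/matrixP=> a j; rewrite mul_family_mx mxE rowK; have [lt1 lt2] := memS j.
  have [_ Pg] := Hg _ lt1; apply: Pg; first by rewrite size_polyXn.
  by apply: vbasis_mem; apply: mem_tnth.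
have E1 : V1 *m family_mx n.+2 F1 = 0.
  apply/matrixP=> a j; rewrite mul_family_mx mxE; have [lt1 lt2] := memS j.
  exact: p1.
have I0 : inj_cols (family_mx n.+2 F0) by apply/family_mx_inj => //; apply: szF.
have I1 : inj_cols (family_mx n.+2 F1) by apply/family_mx_inj => //; apply: szF.
have [V [dl [V0E V1E dl0 HV Hdl]]] := interpolating_path E0 E1 I0 I1.
have b0E : path_tuple V 0 = b0.
  by apply: eq_from_tnth => i; rewrite tnth_mktuple V0E rowK coordsK.
apply: (path_generic (V := V) (dl := dl)) => //.
- by rewrite b0E; apply: basis_free (vbasisP L).
- by rewrite b0E; apply: span_basis (vbasisP L).
- by rewrite many_quotientsP tuple_mx_path V1E; apply/negP; rewrite -leqNgt.
- by rewrite many_quotientsP tuple_mx_path V1E; apply/negP; rewrite -leqNgt.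
move=> s dls; pose gs i := (1 - s) *: g i + s *: 'X^(ms i).
have sgs i : (i < size fs)%N -> (size (gs i) + nth 0%N fs i <= n.+2)%N.
  move=> lt; have mx x y z w : (x <= maxn y z)%N -> (y + w <= n.+2)%N -> (z + w <= n.+2)%N -> (x + w <= n.+2)%N.
    by clear; lia.
  apply: mx (size_polyD _ _) _ _; apply: leq_trans (leq_add (size_scale_leq _ _) (leqnn _)) _.
    exact: sg.
  exact: sX.
have GE : (1 - s) *: family_mx n.+2 F0 + s *: family_mx n.+2 F1 =
    family_mx n.+2 (fun j : 'I_(size S) => shift_family 2 fs gs j).
  apply/matrixP=> i j; rewrite !mxE -!coefZ -coefD; congr (_`_i).
  by rewrite /F0 /F1 /shift_family mulrDl -!scalerAl.
have := Hdl s dls; have := HV s; rewrite GE => Vs /family_mx_inj inds.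
apply: (base_locus_of_shifts fs1 sgs); first by apply: inds; apply: szF.
move=> v j vb; rewrite (coord_span vb) linear_sum.
elim/big_rec: _ => [|i u _ Hu].
  by rewrite /pairing big1 // => i _; rewrite mxE mul0r.
rewrite -tnth_nth tnth_mktuple linearZ /= form_ofK pairingDl Hu addr0.
by rewrite -(mul_family_mx _ (fun j : 'I_(size S) => shift_family 2 fs gs j)) Vs mxE mulr0.
Qed.

Lemma dense_base_locus n k r A (B := (2 * k %/ A)%N) :
    (0 < r)%N -> (k + 3 * r <= n.+3)%N -> (n.+1 = k + r + A)%N -> (0 < A)%N -> (A <= 2 * k)%N ->
  exists Z : {vspace binary_form K n.+2} -> Prop,
    [/\ zariski_closed k Z,
        forall Z' : {vspace binary_form K n.+2} -> Prop, zariski_closed k Z' ->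
          (forall L, \dim L = k -> in_base_locus_of_some_system r L -> ~ Z L -> Z' L) ->
          forall L, \dim L = k -> in_base_locus_of_some_system r L -> Z' L
      & forall L, ~ Z L ->
          A = 1%N \/ ~ (many_quotients B (r * B) L \/ many_quotients B.+1 ((A + r) * B.+1 - 2 * k) L)].
Proof.
move=> r0 le nE A0 Ak; have [A1|A1] := eqVneq A 1%N.
  exists (fun=> False); split=> [||L _]; last by left.
    exists (fun P => P = 1) => b _; split=> // /(_ 1 erefl) /eqP.
    by rewrite meval1 oner_eq0.
  by move=> Z' _ H L dL XL; apply: H.
have A2 : (2 <= A)%N by rewrite ltn_neqAle eq_sym A1.
have B0 : (0 < B)%N by rewrite divn_gt0.
exists (fun L => many_quotients B (r * B) L \/ many_quotients B.+1 ((A + r) * B.+1 - 2 * k) L).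
split; last by move=> L nZ; right.
  exact: zariski_closed_many_quotients.
apply: dense_of_path => L dL XL; exact: generic_path.
Qed.

End GenericSplitting.

From mathcomp Require Import complex reals.

Theorem theorem4p5 (R : realType) (n k r : nat)
    (n_ge1 : (1 <= n)%N) (k_ge1 : (1 <= k)%N) (k_lt : (k < n - 2)%N)
    (r_adm : rho_admissible n k r)
    (rho_le : (3 * rho n k r <= n - k + 1)%N) :
  (forall (L : {vspace binary_form R[i] n})
      (pi : 'Hom(binary_form R[i] n, 'rV[R[i]]_(n - k + 1)))
      (p : 'I_(n - k + 1) -> binary_form R[i] n),
    \dim L = k -> misses_rnc L -> projection_from L pi p ->
    ordinary_singularities p ->
    ((exists l : seq int,
        [/\ size l = (n - 1 - rho n k r - k)%N,
            all (fun d : int => n%:Z + 3 <= d) l,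
            degree_bundle (twist_bundle (n%:Z + 2) (dual_bundle l))
              = - (2 * k)%:Z
          & normal_bundle_iso p (nseq (rho n k r) (n%:Z + 2) ++ l)])
     <->
     (in_base_locus_of_some_system (rho n k r) L /\
      forall sigma : nat, in_base_locus_of_some_system sigma L ->
        (sigma <= rho n k r)%N)))
  /\
  (let A := (n - 1 - rho n k r - k)%N in
   let B := (2 * k %/ A)%N in
   holds_for_general k
     (fun L : {vspace binary_form R[i] n} =>
        in_base_locus_of_some_system (rho n k r) L)
     (fun L : {vspace binary_form R[i] n} =>
        forall (pi : 'Hom(binary_form R[i] n, 'rV[R[i]]_(n - k + 1)))
          (p : 'I_(n - k + 1) -> binary_form R[i] n),
        misses_rnc L -> projection_from L pi p -> ordinary_singularities p ->
        normal_bundle_iso p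
          (nseq (rho n k r) (n%:Z + 2)
           ++ nseq (A + B * A - 2 * k)%N (n%:Z + 2 + B%:Z)
           ++ nseq (2 * k - B * A)%N (n%:Z + 3 + B%:Z)))).
Proof.
case: n n_ge1 k_lt r_adm rho_le => [|[|n]] // _ k_lt r_adm rho_le.
set q := rho n.+2 k r in rho_le *; set m := (n.+2 - k + 1)%N in rho_le *.
set A := (n.+2 - 1 - q - k)%N; pose N := (n.+1 - k)%N.
have q0 : (0 < q)%N by move: r_adm; rewrite /q /rho_admissible /rho; case: ifP; lia.
have qA : (n.+1 <= 3 * k + q)%N.
  by move: r_adm; rewrite /q /rho_admissible /rho; case: ifP; lia.
have mE : m = (2 + N)%N by rewrite /m /N; lia.
have kN : (k + N = n.+1)%N by rewrite /N; lia.
have AE : (A + q = N)%N by rewrite /A; clear qA; move: rho_le; rewrite mE; lia.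
have A0 : (0 < A)%N by move: rho_le; rewrite mE; lia.
clearbody m q A N; subst m; split.
  move=> L pi p dL mL Lp ord; have -> : A = (N - q)%N by lia.
  exact: (splitting_iff_base_locus kN dL mL Lp ord q).
have [Z [clZ dZ gZ]] : exists Z, _ := @dense_base_locus R[i] n k q A q0 ltac:(lia) ltac:(lia) A0 ltac:(lia).
exists Z; split=> // L dL XL nZ pi p mL Lp ord.
exact: (generic_splitting kN dL mL Lp ord AE A0 XL (gZ L nZ)).
Qed.
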